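(* Let $\Gamma$ be a discrete subgroup of the universal cover $\widetilde{SL(2,\mathbb R)}$ such that the quotient $\widetilde{SL(2,\mathbb R)}/\Gamma$ is a compact 3-manifold. Then the Kodaira–Thurston surface $M=S^1\times(\widetilde{SL(2,\mathbb R)}/\Gamma)$ admits a hyper-paracomplex structure with a corresponding hyper-paraHermitian structure (i.e. with a compatible neutral metric $g$) whose Lee form is parallel with respect to the Levi-Civita connection $\nabla^g$ of $g$ and which is locally, but not globally, conformally equivalent to a flat hyper-paraKähler (hypersymplectic) structure.
   Context: A hyper-paracomplex structure on a 4-manifold is a triple $(J_1,J_2,J_3)$ of endomorphisms of $TM$ with $J_1^2=J_2^2=-J_3^2=\mathrm{id}$, $J_1J_2=-J_2J_1=J_3$, each of which is integrable (vanishing Nijenhuis tensor). A metric $g$ is compatible with it if $g(J_1\cdot,J_1\cdot)=g(J_2\cdot,J_2\cdot)=-g(J_3\cdot,J_3\cdot)=-g(\cdot,\cdot)$; such a $g$ has neutral signature $(2,2)$ and $(g,J_1,J_2,J_3)$ is called a hyper-paraHermitian structure. With $F_\alpha(X,Y)=g(X,J_\alpha Y)$, there is in dimension 4 a common Lee form $\theta$, characterized by $dF_\alpha=\theta\wedge F_\alpha$, $\alpha=1,2,3$. The structure is hyper-paraKähler (hypersymplectic) if $J_1,J_2,J_3$ are all parallel for the Levi-Civita connection of $g$, and flat if that connection is flat. Conformal equivalence means replacing $g$ by $e^{u}g$ for a (local, resp. global) function $u$ while keeping $J_1,J_2,J_3$. *)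

(* Defs.v *)
From HB Require Import structures.
From mathcomp Require Import all_boot all_order all_algebra.
From mathcomp Require Import all_classical all_reals all_analysis.

Set Implicit Arguments.
Unset Strict Implicit.
Unset Printing Implicit Defensive.

Import Order.TTheory GRing.Theory Num.Theory.
Import numFieldNormedType.Exports.

Local Open Scope classical_set_scope.
Local Open Scope ring_scope.

(** * Topological groups and the universal cover of SL(2, R) *)

HB.mixin Record Group_isTopGroup G of Group G & Topological G := {
  mulg_continuous : continuous (fun x : G * G => (x.1 * x.2)%g);
  invg_continuous : continuous (fun x : G => (x^-1)%g) }.

#[short(type="topGroupType")]
HB.structure Definition TopGroup :=
  {G of Group G & Topological G & Group_isTopGroup G}.

Definition simply_connected (R : realType) (T : topologicalType) : Prop :=
  (forall x y : T, exists c : R -> T,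
     [/\ {within `[0, 1], continuous c}, c 0 = x & c 1 = y]) /\
  (forall c : R -> T, {within `[0, 1], continuous c} -> c 0 = c 1 ->
     exists H : R * R -> T,
       {within `[0, 1] `*` `[0, 1], continuous H} /\
       forall t, t \in `[0, 1]%R ->
         [/\ H (0, t) = c t, H (1, t) = c 0, H (t, 0) = c 0 & H (t, 1) = c 0]).

(* [p] is a covering map onto the subspace [B] of [Y]: [s] is the inverse of
   the homeomorphism induced by [p] from the sheet [U i] to [W `&` B]. *)
Definition covering_map (T Y : topologicalType) (p : T -> Y) (B : set Y) :=
  [/\ continuous p, range p = B &
    forall b, B b -> exists W : set Y, [/\ open W, W b &
      exists (I : Type) (U : I -> set T),
        [/\ forall i, open (U i), trivIset setT U,
            p @^-1` W = \bigcup_i U i &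
            forall i, p @` U i = W `&` B /\
              exists s : Y -> T, {within W `&` B, continuous s} /\
                forall x, U i x -> s (p x) = x]]].

Definition SL2 (R : realType) : set 'M[R]_2 := [set A | \det A = 1].

Definition universal_cover_SL2 (R : realType) (G : topGroupType)
    (p : G -> 'M[R]_2) : Prop :=
  [/\ simply_connected R G,
      forall x y, p (x * y)%g = p x *m p y &
      covering_map p (@SL2 R)].

Definition discrete_subgroup (G : topGroupType) (Gamma : groupClosed G) :=
  forall x, x \in Gamma -> exists U : set G,
    [/\ open U, U x & forall y, U y -> y \in Gamma -> y = x].

Section Cosets.
Context (G : topGroupType) (Gamma : groupClosed G).

Definition coset_rel (x y : G) : bool := (x^-1 * y)%g \in Gamma.

Lemma coset_rel_refl : reflexive coset_rel.
Proof. by move=> x; rewrite /coset_rel mulVg gpred1. Qed.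

Lemma coset_rel_sym : symmetric coset_rel.
Proof.
by move=> x y; rewrite /coset_rel -[in RHS]gpredV invgM invgK.
Qed.

Lemma coset_rel_trans : transitive coset_rel.
Proof.
move=> y x z; rewrite /coset_rel => xy yz.
by rewrite -[z](mulVKg y) mulgA gpredM.
Qed.

Canonical coset_equiv :=
  EquivRel coset_rel coset_rel_refl coset_rel_sym coset_rel_trans.

Definition coset_space := quotient_topology {eq_quot coset_equiv}%qT.
HB.instance Definition _ := Topological.on coset_space.

Definition coset_proj (x : G) : coset_space := (\pi_coset_space x)%qT.

End Cosets.

Definition compact_manifold (R : realType) (n : nat) (T : topologicalType) :=
  [/\ compact [set: T], hausdorff_space T &
    forall x : T, exists (U : set T) (f : T -> 'rV[R]_n) (k : 'rV[R]_n -> T),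
      [/\ open U, U x & open (f @` U)] /\
      [/\ {within U, continuous f}, {within f @` U, continuous k} &
          forall y, U y -> k (f y) = y]].

(** * Smooth functions *)

Fixpoint is_Ck (R : realType) (V : normedModType R) (k : nat) (A : set V)
    (f : V -> R) : Prop :=
  (forall x, A x -> {for x, continuous f}) /\
  (if k is k'.+1 then
     forall v, (forall x, A x -> derivable f x v) /\ is_Ck k' A ('D_v f)
   else True).

Definition smooth_near (R : realType) (V : normedModType R) (q : V)
    (f : V -> R) : Prop :=
  exists A : set V, [/\ open A, A q & forall k, is_Ck k A f].

(* A smooth structure is recorded by its sheaf of smooth functions:
   [smooth_at x f] means that [f] is smooth on a neighbourhood of [x]. *)
Record smoothSpace (R : realType) := SmoothSpace {
  space :> topologicalType;
  smooth_at : space -> (space -> R) -> Prop }.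
Arguments smooth_at {R s} x f.

(** * Tensor calculus on a manifold [S] *)

Section Geometry.
Context {R : realType} {S : smoothSpace R}.
Implicit Types (U V : set S) (x y : S) (f : S -> R).

Definition smooth_on U f : Prop := forall x, U x -> smooth_at x f.

(* Tangent vectors at [x] are the derivations of the germs of smooth functions
   at [x].  They are extended by 0 to the functions that are not smooth at [x],
   so that equality of the underlying functions is equality of derivations. *)
Definition preTangent := (S -> R) -> R.
Implicit Types (v w : preTangent).

Record tangent x v : Prop := Tangent {
  tangent_local : forall f h, smooth_at x f -> smooth_at x h ->
    (\forall y \near x, f y = h y) -> v f = v h;
  tangent_linear : forall a f h, smooth_at x f -> smooth_at x h ->
    v (fun y => a * f y + h y) = a * v f + v h;
  tangent_leibniz : forall f h, smooth_at x f -> smooth_at x h ->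
    v (fun y => f y * h y) = v f * h x + f x * v h;
  tangent_out : forall f, ~ smooth_at x f -> v f = 0 }.

Definition field := S -> preTangent.
Implicit Types (X Y Z : field).

Definition vector_field U X : Prop := forall x, U x ->
  tangent x (X x) /\
  forall f, smooth_at x f -> smooth_at x (fun y => X y f).

Definition bracket X Y : field := fun x f =>
  if `[< smooth_at x f >]
  then X x (fun y => Y y f) - Y x (fun y => X y f) else 0.

Definition open_in U V : Prop := open V /\ V `<=` U.

(** ** Endomorphisms of the tangent bundle *)

Definition endo := S -> preTangent -> preTangent.
Implicit Types (J : endo).

Definition endo_app J X : field := fun x => J x (X x).

Record endomorphism U J : Prop := Endomorphism {
  endo_tangent : forall x v, U x -> tangent x v -> tangent x (J x v);
  endo_linear : forall x a v w, U x -> tangent x v -> tangent x w ->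
    J x (a *: v + w) = a *: J x v + J x w;
  endo_smooth : forall V X, open_in U V -> vector_field V X ->
    vector_field V (endo_app J X) }.

Definition nijenhuis J X Y : field := fun x =>
  J x (J x (bracket X Y x)) + bracket (endo_app J X) (endo_app J Y) x
  - J x (bracket (endo_app J X) Y x) - J x (bracket X (endo_app J Y) x).

Definition integrable_endo U J : Prop :=
  forall V X Y, open_in U V -> vector_field V X -> vector_field V Y ->
  forall x, V x -> nijenhuis J X Y x = 0.

Definition hyper_paracomplex U (J1 J2 J3 : endo) : Prop :=
  [/\ endomorphism U J1, endomorphism U J2 & endomorphism U J3] /\
  (forall x v, U x -> tangent x v ->
     [/\ J1 x (J1 x v) = v, J2 x (J2 x v) = v, J3 x (J3 x v) = - v,
         J1 x (J2 x v) = J3 x v & - J2 x (J1 x v) = J3 x v]) /\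
  [/\ integrable_endo U J1, integrable_endo U J2 & integrable_endo U J3].

(** ** Metrics *)

Definition bilinear_field := S -> preTangent -> preTangent -> R.
Implicit Types (g : bilinear_field).

(* Nondegeneracy is implied by the existence of pseudo-orthonormal bases. *)
Record neutral_metric U g : Prop := NeutralMetric {
  metric_sym : forall x v w, U x -> tangent x v -> tangent x w ->
    g x v w = g x w v;
  metric_linear : forall x a v v' w, U x ->
    tangent x v -> tangent x v' -> tangent x w ->
    g x (a *: v + v') w = a * g x v w + g x v' w;
  metric_smooth : forall V X Y, open_in U V ->
    vector_field V X -> vector_field V Y ->
    smooth_on V (fun x => g x (X x) (Y x));
  metric_signature22 : forall x, U x -> exists e : 'I_4 -> preTangent,
    [/\ forall i, tangent x (e i),
        forall v, tangent x v -> exists c : 'I_4 -> R, v = \sum_i c i *: e i &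
        forall i j, g x (e i) (e j) =
          if i == j then (if (i < 2)%N then 1 else -1) else 0] }.

Definition compatible U g (J1 J2 J3 : endo) : Prop :=
  forall x v w, U x -> tangent x v -> tangent x w ->
    [/\ g x (J1 x v) (J1 x w) = - g x v w,
        g x (J2 x v) (J2 x w) = - g x v w &
        g x (J3 x v) (J3 x w) = g x v w].

Definition hyper_paraHermitian U g (J1 J2 J3 : endo) : Prop :=
  [/\ hyper_paracomplex U J1 J2 J3, neutral_metric U g &
      compatible U g J1 J2 J3].

Definition conformal (u : S -> R) g : bilinear_field :=
  fun x v w => expR (u x) * g x v w.

(** ** Differential forms and the Lee form *)

Definition one_form := S -> preTangent -> R.
Implicit Types (theta : one_form).

Record smooth_one_form U theta : Prop := SmoothOneForm {
  one_form_linear : forall x a v w, U x -> tangent x v -> tangent x w ->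
    theta x (a *: v + w) = a * theta x v + theta x w;
  one_form_smooth : forall V X, open_in U V -> vector_field V X ->
    smooth_on V (fun x => theta x (X x)) }.

Definition fundamental_form g J : bilinear_field := fun x v w => g x v (J x w).

Definition ext_d2 (F : bilinear_field) X Y Z x : R :=
  X x (fun y => F y (Y y) (Z y)) + Y x (fun y => F y (Z y) (X y))
  + Z x (fun y => F y (X y) (Y y))
  - F x (bracket X Y x) (Z x) - F x (bracket Y Z x) (X x)
  - F x (bracket Z X x) (Y x).

Definition wedge12 theta (F : bilinear_field) x u v w : R :=
  theta x u * F x v w + theta x v * F x w u + theta x w * F x u v.

Definition lee_equation U g J theta : Prop :=
  forall V X Y Z, open_in U V ->
    vector_field V X -> vector_field V Y -> vector_field V Z ->
  forall x, V x -> ext_d2 (fundamental_form g J) X Y Z x =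
    wedge12 theta (fundamental_form g J) x (X x) (Y x) (Z x).

Definition lee_form U g (J1 J2 J3 : endo) theta : Prop :=
  smooth_one_form U theta /\
  [/\ lee_equation U g J1 theta, lee_equation U g J2 theta &
      lee_equation U g J3 theta].

(** ** Connections *)

(* [nabla x v Y] is the covariant derivative at [x] of the field [Y] in the
   direction of the tangent vector [v]. *)
Definition preConnection := S -> preTangent -> field -> preTangent.
Implicit Types (nabla : preConnection).

Definition cov_deriv nabla X Y : field := fun x => nabla x (X x) Y.

Record connection U nabla : Prop := Connection {
  conn_smooth : forall V X Y, open_in U V ->
    vector_field V X -> vector_field V Y ->
    vector_field V (cov_deriv nabla X Y);
  conn_tangent : forall V Y x v, open_in U V -> vector_field V Y ->
    V x -> tangent x v -> tangent x (nabla x v Y);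
  conn_local : forall V Y Z x v, open_in U V ->
    vector_field V Y -> vector_field V Z -> (forall y, V y -> Y y = Z y) ->
    V x -> tangent x v -> nabla x v Y = nabla x v Z;
  conn_linear : forall V Y x a v w, open_in U V -> vector_field V Y ->
    V x -> tangent x v -> tangent x w ->
    nabla x (a *: v + w) Y = a *: nabla x v Y + nabla x w Y;
  conn_add : forall V Y Z x v, open_in U V ->
    vector_field V Y -> vector_field V Z -> V x -> tangent x v ->
    nabla x v (fun y => Y y + Z y) = nabla x v Y + nabla x v Z;
  conn_leibniz : forall V f Y x v, open_in U V ->
    smooth_on V f -> vector_field V Y -> V x -> tangent x v ->
    nabla x v (fun y => f y *: Y y) = v f *: Y x + f x *: nabla x v Y }.

Definition torsion_free U nabla : Prop :=
  forall V X Y, open_in U V -> vector_field V X -> vector_field V Y ->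
  forall x, V x ->
    cov_deriv nabla X Y x - cov_deriv nabla Y X x = bracket X Y x.

Definition metric_connection U g nabla : Prop :=
  forall V Y Z x v, open_in U V -> vector_field V Y -> vector_field V Z ->
    V x -> tangent x v ->
    v (fun y => g y (Y y) (Z y)) =
      g x (nabla x v Y) (Z x) + g x (Y x) (nabla x v Z).

Definition levi_civita U g nabla : Prop :=
  [/\ connection U nabla, torsion_free U nabla & metric_connection U g nabla].

Definition parallel_endo U nabla J : Prop :=
  forall V Y x v, open_in U V -> vector_field V Y -> V x -> tangent x v ->
    nabla x v (endo_app J Y) = J x (nabla x v Y).

Definition parallel_one_form U nabla theta : Prop :=
  forall V Y x v, open_in U V -> vector_field V Y -> V x -> tangent x v ->
    v (fun y => theta y (Y y)) = theta x (nabla x v Y).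

Definition flat_connection U nabla : Prop :=
  forall V X Y Z, open_in U V ->
    vector_field V X -> vector_field V Y -> vector_field V Z ->
  forall x, V x ->
    cov_deriv nabla X (cov_deriv nabla Y Z) x
    - cov_deriv nabla Y (cov_deriv nabla X Z) x
    - cov_deriv nabla (bracket X Y) Z x = 0.

Definition flat_hyper_paraKahler U g (J1 J2 J3 : endo) : Prop :=
  hyper_paraHermitian U g J1 J2 J3 /\
  exists nabla, levi_civita U g nabla /\
    [/\ parallel_endo U nabla J1, parallel_endo U nabla J2,
        parallel_endo U nabla J3 & flat_connection U nabla].

Definition locally_conf_flat_hpK g (J1 J2 J3 : endo) : Prop :=
  forall x, exists (U : set S) (u : S -> R),
    [/\ open U, U x, smooth_on U u &
        flat_hyper_paraKahler U (conformal u g) J1 J2 J3].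

Definition globally_conf_flat_hpK g (J1 J2 J3 : endo) : Prop :=
  exists u : S -> R, smooth_on [set: S] u /\
    flat_hyper_paraKahler [set: S] (conformal u g) J1 J2 J3.

End Geometry.

Arguments endo {R} S.
Arguments bilinear_field {R} S.
Arguments one_form {R} S.
Arguments preConnection {R} S.

(** * The Kodaira-Thurston surface *)

Definition circle (R : realType) : set 'rV[R]_2 :=
  [set z | z ord0 ord0 ^+ 2 + z ord0 ord_max ^+ 2 = 1].

(* Smooth functions on S^1 x G, where G carries the smooth structure pulled
   back from SL(2, R) by the covering map [p]: since S^1 and SL(2, R) are
   embedded submanifolds of R^2 and M_2(R), these are locally the restrictions
   of smooth functions on R^2 x M_2(R). *)
Definition cover_smooth_at (R : realType) (G : topGroupType)
    (p : G -> 'M[R]_2) (y : set_type (@circle R) * G)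
    (f : set_type (@circle R) * G -> R) : Prop :=
  exists h : 'rV[R]_2 * 'M[R]_2 -> R,
    smooth_near (set_val y.1, p y.2) h /\
    \forall y' \near y, f y' = h (set_val y'.1, p y'.2).

(* The smooth structure is the one for which S^1 x G -> S^1 x G/Gamma is a
   local diffeomorphism. *)
Definition kodaira_thurston (R : realType) (G : topGroupType)
    (p : G -> 'M[R]_2) (Gamma : groupClosed G) : smoothSpace R :=
  @SmoothSpace R (set_type (@circle R) * coset_space Gamma)%type
    (fun m f => forall z x, m = (z, coset_proj Gamma x) ->
       cover_smooth_at p (z, x) (fun y => f (y.1, coset_proj Gamma y.2))).

(* Main.v *)
Require Import Defs.
From HB Require Import structures.
From mathcomp Require Import all_boot all_order all_algebra.
From mathcomp Require Import all_classical all_reals all_analysis.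
From mathcomp Require Import ring lra.

(* Let [A = M_2(R)].  On the cone [det > 0] of [A], whose universal cover is that of
   R x SL(2, R), the flat neutral metric [det] is hypersymplectic for the left
   multiplications by units [j1, j2, j3 = j1 j2] of the split quaternions [A].  All of
   this commutes with right multiplication by SL(2, R), and [g = det / det(q)] is also
   invariant under dilations, so it descends to S^1 x (G / Gamma), where the angle of
   the circle is the logarithm of the dilation factor.

   Let [E(a)], [a] in [A], be the vector field induced by [q |-> a q].  These fields
   form a global frame in which everything is constant: [[E(a), E(b)] = E(ba - ab)],
   [J_k E(a) = E(j_k a)], [g(E(a), E(b))] is the polarization of [det], the Levi-Civita
   connection is [E((ba - ab) / 2)], the flat connection is [E(ba)], and the Lee form is
   [- tr a], which is parallel.  The flat connection is the Levi-Civita connection of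
   [exp(u) g] as soon as [du = tr], so [u] can be twice the local angle.  If [exp(u) g]
   were globally hypersymplectic, its closed fundamental form evaluated on
   [E(1), E(j2), E(j3)] would give [E(1) exp(u) = 2 exp(u)], which is impossible for a
   periodic function on the circle.

   That every derivation of germs is some [E(a)] at each point follows from Hadamard's
   lemma in the ambient space R^2 x M_2(R), together with the equations [|z|^2 = 1] and
   [det P = 1]; the same argument computes the brackets on linear coordinates only, so
   that symmetry of second derivatives is never needed. *)

Set Implicit Arguments.
Unset Strict Implicit.
Unset Printing Implicit Defensive.

Import Order.TTheory GRing.Theory Num.Theory.
Import numFieldNormedType.Exports.

Local Open Scope classical_set_scope.
Local Open Scope ring_scope.

(** Smoothness on the quotient is only given through germs of ambient functions, and this shapes the
    proof. A germ on M has many ambient representatives and many lifts to S^1 x G, so [E(a)],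
    defined by differentiating any representative at any lift, must be shown independent of both
    choices. Independence of the lift holds because left and right multiplications commute;
    independence of the representative holds because each frame vector is the velocity of a curve
    inside the circle times SL(2). Rational curves serve for this, so that only polynomial
    identities have to be checked. Both connections belong to the family [E(s ba + t ab)], which is
    torsion-free when [s - t = 1] and differentiates the metric with defect [(s + t) tr a]: the flat
    one is [(1, 0)], the Levi-Civita one [(1/2, -1/2)]. The defect of the flat one is where the Lee
    form [- tr a] comes from. Integrability of the [J_k] needs no bracket computation, because they
    are parallel for a torsion-free connection. Differentiability is always directional, so even
    additivity of ['D_v f] in [v] has to be derived from continuity of the derivatives. *)

(** * C^k functions *)

Section CkFunctions.
Context {R : realType} {V : normedModType R}.
Implicit Types (A B : set V) (f g : V -> R) (k : nat).

Lemma is_Ck_continuous k A f x : is_Ck k A f -> A x -> {for x, continuous f}.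
Proof. by case: k => [|k] [+ _]; apply. Qed.

Lemma is_Ck_pred k A f : is_Ck k.+1 A f -> is_Ck k A f.
Proof.
elim: k f => [|k IH] f [cf df]; first by split.
by split=> // v; have [dfv /IH] := df v.
Qed.

Lemma is_Ck_subset k A B f : B `<=` A -> is_Ck k A f -> is_Ck k B f.
Proof.
move=> BA; elim: k f => [|k IH] f [cf df].
  by split=> // x /BA; exact: cf.
split=> [x /BA|v]; first exact: cf.
by have [dfv /IH] := df v; split=> // x /BA; exact: dfv.
Qed.

Lemma eq_is_Ck k A f g : open A -> (forall x, A x -> f x = g x) ->
  is_Ck k A f -> is_Ck k A g.
Proof.
move=> oA; elim: k f g => [|k IH] f g fg [cf df].
  split=> // x Ax; have := cf x Ax; rewrite /prop_for /continuous_at -fg//.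
  apply: cvg_trans; apply: near_eq_cvg.
  by apply: filterS (open_nbhs_nbhs (conj oA Ax)) => y Ay; rewrite -fg.
have fgn x : A x -> {near x, f =1 g}.
  by move=> Ax; apply: filterS (open_nbhs_nbhs (conj oA Ax)) => y /fg.
split=> [x Ax|v].
  have := cf x Ax; rewrite /prop_for /continuous_at -fg//.
  apply: cvg_trans; apply: near_eq_cvg.
  by apply: filterS (fgn x Ax) => y ->.
have [dfv Ckfv] := df v; split=> [x Ax|].
  exact: near_eq_derivable (fgn x Ax) (dfv x Ax).
by apply: IH Ckfv => x /fgn; exact: near_eq_derive.
Qed.

Lemma is_Ck_cst k A (c : R) : is_Ck k A (cst c).
Proof.
elim: k c => [|k IH] c; first by split=> // x _; exact: cvg_cst.
split=> [x _|v]; first exact: cvg_cst.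
split=> [x _|]; first exact: derivable_cst.
by rewrite (_ : derive _ ^~ v = cst 0) //; apply/funext => x; exact: derive_cst.
Qed.

Lemma is_CkD k A f g : open A ->
  is_Ck k A f -> is_Ck k A g -> is_Ck k A (fun x => f x + g x).
Proof.
move=> oA; elim: k f g => [|k IH] f g [cf df] [cg dg].
  by split=> // x Ax; apply: cvgD; [exact: cf|exact: cg].
split=> [x Ax|v]; first by apply: cvgD; [exact: cf|exact: cg].
have [dfv Cf] := df v; have [dgv Cg] := dg v.
split=> [x Ax|]; first by apply: derivableD; [exact: dfv|exact: dgv].
apply: (eq_is_Ck oA _ (IH _ _ Cf Cg)) => x Ax.
by rewrite deriveD//; [exact: dfv|exact: dgv].
Qed.

Lemma is_CkM k A f g : open A ->
  is_Ck k A f -> is_Ck k A g -> is_Ck k A (fun x => f x * g x).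
Proof.
move=> oA; elim: k f g => [|k IH] f g Ckf Ckg.
  by split=> // x Ax; apply: cvgM; [exact: Ckf.1|exact: Ckg.1].
split=> [x Ax|v]; first by apply: cvgM; [exact: Ckf.1|exact: Ckg.1].
have [dfv Cf] := Ckf.2 v; have [dgv Cg] := Ckg.2 v.
split=> [x Ax|]; first by apply: derivableM; [exact: dfv|exact: dgv].
have H := is_CkD oA (IH _ _ (is_Ck_pred Ckf) Cg) (IH _ _ (is_Ck_pred Ckg) Cf).
apply: (eq_is_Ck oA _ H) => x Ax.
by rewrite deriveM//; [exact: dfv|exact: dgv].
Qed.

Lemma is_CkV k A f : open A -> (forall x, A x -> f x != 0) ->
  is_Ck k A f -> is_Ck k A (fun x => (f x)^-1).
Proof.
move=> oA f0; elim: k => [|k IH] Ckf.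
  by split=> // x Ax; apply: cvgV; [exact: f0|exact: Ckf.1].
split=> [x Ax|v]; first by apply: cvgV; [exact: f0|exact: Ckf.1].
have [dfv Cf] := Ckf.2 v.
split=> [x Ax|]; first by apply: derivableV; [exact: f0|exact: dfv].
have H1 := IH (is_Ck_pred Ckf).
have H2 := is_CkM oA (is_Ck_cst k A (-1)) (is_CkM oA (is_CkM oA H1 H1) Cf).
apply: (eq_is_Ck oA _ H2) => x Ax.
rewrite deriveV; [|exact: f0|exact: dfv].
by rewrite /cst /= expr2 invfM mulN1r scaleNr.
Qed.

(** The two difference quotients are the same function up to [h *: 1 = h]. This reduces statements
    about directional derivatives to calculus in one variable. *)
Lemma is_derive_line f x v (t : R) : derivable f (t *: v + x) v ->
  is_derive t 1 (fun h : R => f (h *: v + x)) ('D_v f (t *: v + x)).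
Proof.
have E : (fun h : R => h^-1 *: (f (h *: v + (t *: v + x)) - f (t *: v + x))) =
    (fun h : R => h^-1 *: (f ((h *: 1 + t) *: v + x) - f (t *: v + x))).
  by apply/funext => h; rewrite -[h *: 1]/(h * 1) mulr1 scalerDl addrA.
move=> dfx; split; first by move: dfx; rewrite /derivable /comp /shift /= E.
by rewrite /derive /comp /shift /= E.
Qed.

(** Since [f] is only derivable along [v], the composite is restricted to the line through [x],
    where the one-variable chain rule applies. *)
Lemma is_derive_comp (c : R -> R) (d : R) f x v : is_derive (f x) 1 c d ->
  derivable f x v -> is_derive x v (c \o f) (d * 'D_v f x).
Proof.
move=> cd dfx.
have H : is_derive (0 : R) 1 (c \o (fun h : R => f (h *: v + x))) (d * 'D_v f x).
  apply: is_derive1_comp; first by rewrite scale0r add0r.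
  by have := @is_derive_line f x v (0 : R); rewrite scale0r add0r; exact.
have E : (fun h : R => h^-1 *: (c (f (h *: v + x)) - c (f x))) =
    (fun h : R => h^-1 *: (c (f ((h *: 1 + 0) *: v + x)) - c (f (0 *: v + x)))).
  by apply/funext => h; rewrite -[h *: 1]/(h * 1) mulr1 addr0 scale0r add0r.
case: H => H1 H2; split; first by move: H1; rewrite /derivable /comp /shift /= -E.
by rewrite -H2 /derive /comp /shift /= E.
Qed.

Lemma is_Ck_expR k A f : open A -> is_Ck k A f -> is_Ck k A (fun x => expR (f x)).
Proof.
move=> oA; elim: k => [|k IH] Ckf.
  split=> // x Ax; apply: continuous_comp; first exact: Ckf.1.
  exact: continuous_expR.
split=> [x Ax|v].
  by apply: continuous_comp; [exact: Ckf.1|exact: continuous_expR].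
have [dfv Cf] := Ckf.2 v.
have D x : A x -> is_derive x v (expR \o f) (expR (f x) * 'D_v f x).
  by move=> Ax; apply: is_derive_comp; exact: dfv.
split=> [x /D[]//|].
apply: (eq_is_Ck oA _ (is_CkM oA (IH (is_Ck_pred Ckf)) Cf)) => x Ax.
by apply/esym; have [] := D x Ax.
Qed.

Lemma is_Ck_atan k A f : open A -> is_Ck k A f -> is_Ck k A (fun x => atan (f x)).
Proof.
move=> oA; elim: k => [|k IH] Ckf.
  split=> // x Ax; apply: continuous_comp; first exact: Ckf.1.
  exact: continuous_atan.
split=> [x Ax|v].
  by apply: continuous_comp; [exact: Ckf.1|exact: continuous_atan].
have [dfv Cf] := Ckf.2 v.
have D x : A x -> is_derive x v (atan \o f) ((1 + f x ^+ 2)^-1 * 'D_v f x).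
  by move=> Ax; apply: is_derive_comp; exact: dfv.
split=> [x /D[]//|].
have f1 x : A x -> 1 + f x * f x != 0.
  by move=> _; rewrite gt_eqF// ltr_pwDl// -expr2 sqr_ge0.
have H := is_CkV oA f1 (is_CkD oA (is_Ck_cst k A 1)
  (is_CkM oA (is_Ck_pred Ckf) (is_Ck_pred Ckf))).
apply: (eq_is_Ck oA _ (is_CkM oA H Cf)) => x Ax.
by apply/esym; have [_ ->] := D x Ax; rewrite expr2.
Qed.

Lemma is_Ck_sum (I : Type) (r : seq I) k A (F : I -> V -> R) : open A ->
  (forall i, is_Ck k A (F i)) -> is_Ck k A (fun x => \sum_(i <- r) F i x).
Proof.
move=> oA CF; elim: r => [|i r IH].
  by rewrite (_ : (fun _ => _) = cst 0)//; [exact: is_Ck_cst|apply/funext => x; rewrite big_nil].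
have := is_CkD oA (CF i) IH.
by congr is_Ck; apply/funext => x; rewrite big_cons.
Qed.

Lemma is_Ck_linear k A (l : {linear V -> R}) : continuous l -> is_Ck k A l.
Proof.
move=> cl; case: k => [|k]; first by split=> // x _; exact: cl.
split=> [x _|v]; first exact: cl.
have dl x : differentiable l x by exact: linear_differentiable.
split=> [x _|]; first exact: diff_derivable.
have := is_Ck_cst k A (l v); congr is_Ck; apply/funext => x.
by rewrite deriveE// diff_lin.
Qed.

End CkFunctions.

(** Difference quotients of the composite along [v] are literally those of [f] along [L v], so the
    induction on [k] passes to ['D_(L v) f] without a chain rule. *)
Lemma is_Ck_comp_affine (R : realType) (V W : normedModType R) k (A : set V)
    (f : V -> R) (L : {linear W -> V}) (b : V) : continuous L -> is_Ck k A f ->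
  is_Ck k [set w | A (b + L w)] (fun w => f (b + L w)).
Proof.
move=> cL; elim: k f => [|k IH] f Ckf.
  split=> // w Aw; apply: continuous_comp; last exact: (is_Ck_continuous Ckf Aw).
  by apply: cvgD; [exact: cvg_cst|exact: cL].
split=> [w Aw|v].
  apply: continuous_comp; last exact: (is_Ck_continuous Ckf Aw).
  by apply: cvgD; [exact: cvg_cst|exact: cL].
have [dfv Cf] := Ckf.2 (L v).
have E w : (fun h : R => h^-1 *: (f (b + L (h *: v + w)) - f (b + L w))) =
    (fun h : R => h^-1 *: (f (h *: L v + (b + L w)) - f (b + L w))).
  by apply/funext => h; rewrite linearP addrCA.
split=> [w Aw|].
  by have := dfv _ Aw; rewrite /derivable /comp /shift /= E.
have := IH _ Cf; congr is_Ck; apply/funext => w.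
by rewrite /derive /comp /shift /= E.
Qed.

Lemma is_derive_mulr (R : realType) (h t : R) : is_derive t 1 (fun t => t * h) h.
Proof.
rewrite (_ : (fun t => t * h) = h \*: id); last by apply/funext => s /=; rewrite mulrC.
by apply: is_derive_eq; rewrite -[_ *: _]/(h * 1) mulr1.
Qed.

(** * The mean value theorem along lines and linearity of ['D_v f] in [v] *)

Section MeanValue.
Context {R : realType} {V : normedModType R}.
Implicit Types (A B : set V) (f g : V -> R).

Lemma mean_value_line f (x v : V) (h : R) :
  (forall t : R, 0 <= t <= 1 -> derivable f ((t * h) *: v + x) v) ->
  exists2 t : R, 0 <= t <= 1 &
    f (h *: v + x) - f x = h * 'D_v f ((t * h) *: v + x).
Proof.
move=> df; pose phi (t : R) := f ((t * h) *: v + x).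
have dphi (t : R) : 0 <= t <= 1 ->
    is_derive t 1 phi ('D_v f ((t * h) *: v + x) * h).
  move=> /df dft.
  rewrite -[phi]/((fun s : R => f (s *: v + x)) \o (fun t : R => t * h)).
  apply: is_derive1_comp; first exact: is_derive_line.
  exact: is_derive_mulr.
have [||t tI] := @MVT_segment R phi
  (fun t => 'D_v f ((t * h) *: v + x) * h) 0 1 ler01.
- by move=> t; rewrite in_itv /= => /andP[t0 t1]; apply: dphi; rewrite !ltW.
- apply: derivable_within_continuous => t; rewrite in_itv /= => tI.
  by have [] := dphi t tI.
move: tI; rewrite in_itv /= => tI.
by rewrite /phi mul1r mul0r scale0r add0r subr0 mulr1 => E; exists t => //; rewrite mulrC.
Qed.

(** Mean value arguments produce an intermediate point depending on [h] about which only a bound on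
    its parameters is known; hence the uniformity over [s] and [t]. *)
Lemma near_segment (P : set V) (x v w : V) : nbhs x P ->
  \forall h \near (0 : R), forall s t : R, `|s| <= `|h| -> `|t| <= `|h| ->
    P (s *: w + (t *: v + x)).
Proof.
move=> /nbhs_normP[e /= e0 eP].
have M0 : 0 < `|v| + `|w| + 1 by rewrite ltr_wpDl// addr_ge0.
exists (e / (`|v| + `|w| + 1)) => /=; first by rewrite divr_gt0.
move=> h; rewrite /ball /= sub0r normrN ltr_pdivlMr// => he s t sh th.
apply: eP; rewrite /ball_ /= distrC addrA addrK.
apply: le_lt_trans he; rewrite (le_trans (ler_normD _ _))// !normrZ.
have := ler_wpM2r (normr_ge0 w) sh; have := ler_wpM2r (normr_ge0 v) th.
have := normr_ge0 h; lra.
Qed.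

(** The increment along [h *: (v + w)] is taken in two stages, first [h *: v], then [h *: w]. The
    second stage is [h] times ['D_w f] at an intermediate point, which tends to ['D_w f x] by
    continuity of ['D_w f]. *)
Lemma derive_dirD f A (x v w : V) : open A -> A x -> is_Ck 1 A f ->
  'D_(v + w) f x = 'D_v f x + 'D_w f x.
Proof.
move=> oA Ax [_ Cf].
have [dfv _] := Cf v; have [dfw [cDw _]] := Cf w; have [dfvw _] := Cf (v + w).
apply: cvg_lim => //.
have E : (fun h : R => h^-1 *: (f (h *: (v + w) + x) - f x)) =
  (fun h : R => h^-1 *: (f (h *: w + (h *: v + x)) - f (h *: v + x)) +
                h^-1 *: (f (h *: v + x) - f x)).
  apply/funext => h; rewrite -scalerDr addrA subrK.
  by rewrite [h *: (v + w)]scalerDr [h *: v + h *: w]addrC addrA.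
rewrite /comp /shift /= E addrC; apply: cvgD; last exact: dfv.
apply/cvgrPdist_lt => e e0.
have nP : nbhs x (A `&` [set y | `|'D_w f x - 'D_w f y| < e]).
  apply: filterI; first exact: open_nbhs_nbhs.
  by have /cvgrPdist_lt/(_ e e0) := cDw x Ax.
rewrite /= near_withinE; near=> h => h0.
have H : forall s t : R, `|s| <= `|h| -> `|t| <= `|h| ->
    A (s *: w + (t *: v + x)) /\ `|'D_w f x - 'D_w f (s *: w + (t *: v + x))| < e.
  by near: h; exact: near_segment nP.
have sh (t : R) : 0 <= t <= 1 -> `|t * h| <= `|h|.
  by move=> /andP[t0 t1]; rewrite normrM ger0_norm// ler_piMl.
have [|t tI ->] := @mean_value_line f (h *: v + x) w h.
  by move=> t tI; apply: dfw; apply: (H _ _ _ _).1; rewrite ?sh.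
rewrite -[_ *: _]/(_ * _) mulKf//.
by apply: (H _ _ _ _).2; rewrite ?sh.
Unshelve. all: by end_near. Qed.

Lemma is_derive_dirZ f (x v : V) (c : R) : derivable f x v ->
  is_derive x (c *: v) f (c * 'D_v f x).
Proof.
move=> df.
have : is_derive (0 : R) 1 ((fun s : R => f (s *: v + x)) \o (fun t : R => t * c))
    ('D_v f x * c).
  apply: is_derive1_comp.
    by have := @is_derive_line _ _ f x v (0 : R); rewrite mul0r scale0r add0r; exact.
  exact: is_derive_mulr.
have E : (fun h : R => h^-1 *: (f (h *: (c *: v) + x) - f x)) =
    (fun h : R => h^-1 *: (f (((h *: 1 + 0) * c) *: v + x) - f ((0 * c) *: v + x))).
  apply/funext => h; rewrite -[h *: 1]/(h * 1) mulr1 addr0 mul0r scale0r add0r.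
  by rewrite scalerA.
case=> H1 H2; split; first by rewrite /derivable /comp /shift /= E.
by rewrite mulrC -H2 /derive /comp /shift /= E.
Qed.

Lemma derive_dirP f A (x v w : V) (a : R) : open A -> A x -> is_Ck 1 A f ->
  'D_(a *: v + w) f x = a * 'D_v f x + 'D_w f x.
Proof.
move=> oA Ax Cf; rewrite (derive_dirD _ _ oA Ax Cf).
by have [_ ->] := is_derive_dirZ a ((Cf.2 v).1 x Ax).
Qed.

End MeanValue.

(** * The chain rule along curves, in finitely many coordinates *)

Section Coordinates.
Context {R : realType} {V : normedModType R} {I : finType}.
Variables (b : I -> V) (c : I -> {linear V -> R}).
Hypothesis cc : forall i, continuous (c i).
Hypothesis cb : forall v, v = \sum_i c i v *: b i.
Implicit Types (A : set V) (f : V -> R).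

Lemma derive_coordE f A (x v : V) : open A -> A x -> is_Ck 1 A f ->
  'D_v f x = \sum_i c i v * 'D_(b i) f x.
Proof.
move=> oA Ax Cf; rewrite {1}(cb v).
elim: (index_enum I) => [|i r IH]; first by rewrite !big_nil derive0.
by rewrite !big_cons (derive_dirP _ _ _ oA Ax Cf) IH.
Qed.

(** With [W h] the slope of the secant of [g], the difference quotient of [f \o g] is ['D_(W h) f]
    at a point of the chord. Coordinates write ['D_u f y] as the function [D], jointly continuous in
    [u] and [y], so the limit follows. *)
Lemma is_derive_curve f A (g : R -> V) (t : R) (w : V) : open A -> A (g t) ->
  is_Ck 1 A f -> is_derive t 1 g w -> is_derive t 1 (f \o g) ('D_w f (g t)).
Proof.
move=> oA Ag Cf [dg Dg].
suff H : h^-1 *: (f (g (h *: 1 + t)) - f (g t)) @[h --> 0^'] --> 'D_w f (g t).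
  by split; [apply/cvg_ex; exists ('D_w f (g t)) | apply: cvg_lim].
pose W h := h^-1 *: (g (h *: 1 + t) - g t).
have Wlim : W h @[h --> 0^'] --> w by rewrite -Dg; exact: dg.
pose D (u : V * V) := \sum_i c i u.1 * 'D_(b i) f u.2.
have cD : {for (w, g t), continuous D}.
  rewrite /prop_for /continuous_at /D; apply: cvg_big => [|i _]; first exact: add_continuous.
  apply: cvgM.
    by apply: continuous_comp; [exact: cvg_fst|exact: cc].
  apply: (@continuous_comp _ _ _ snd ('D_(b i) f)); first exact: cvg_snd.
  by have [_ [+ _]] := Cf.2 (b i); apply.
have DE u y : A y -> 'D_u f y = D (u, y).
  by move=> Ay; rewrite (derive_coordE _ oA Ay Cf).
rewrite (DE _ _ Ag); apply/cvgrPdist_lt => e e0.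
have := cD; rewrite /prop_for /continuous_at => /cvgrPdist_lt /(_ e e0) [[P Q] /= [nP nQ] PQ].
have nQA : nbhs (g t) (Q `&` A) by apply: filterI => //; exact: open_nbhs_nbhs.
have [d /= d0 dQ] := (nbhs_normP _ _).1 nQA.
have nW : \forall h \near 0^', `|w - W h| < 1.
  by move/cvgrPdist_lt: Wlim => /(_ 1 ltr01).
have nP' : \forall h \near 0^', P (W h) by exact: Wlim.
near=> h.
have h0 : h != 0 by near: h; exact: nbhs_dnbhs_neq.
have hd : `|h| < d / (`|w| + 1).
  by near: h; apply: dnbhs0_lt; rewrite divr_gt0// ltr_wpDl.
have WE : g (h *: 1 + t) = h *: W h + g t.
  by rewrite /W scalerA mulfV// scale1r subrK.
have Wb : `|W h| < `|w| + 1.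
  have : `|w - W h| < 1 by near: h.
  have := ler_normB w (w - W h); rewrite opprB addrC subrK; lra.
have QA (s : R) : 0 <= s <= 1 -> (Q `&` A) ((s * h) *: W h + g t).
  move=> /andP[s0 s1]; apply: dQ; rewrite /ball_ /= distrC addrK normrZ normrM.
  rewrite ger0_norm//.
  have hd' : `|h| * (`|w| + 1) < d by rewrite -ltr_pdivlMr// ltr_wpDl.
  apply: le_lt_trans hd'; apply: ler_pM => //; last exact: ltW.
    by rewrite mulr_ge0.
  by rewrite ler_piMl.
have [|s sI] := @mean_value_line _ _ f (g t) (W h) h.
  by move=> s sI; have [dfW _] := Cf.2 (W h); apply: dfW; exact: (QA s sI).2.
rewrite -WE => ->; rewrite -[_ *: _]/(_ * _) mulKf// DE; last exact: (QA s sI).2.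
by apply: PQ; split => /=; [near: h|exact: (QA s sI).1].
Unshelve. all: by end_near. Qed.

End Coordinates.

(** * Hadamard's lemma *)

Section Mean.
Context {R : realType}.
Implicit Types f g : R -> R.
Notation mu := (@lebesgue_measure R).

Definition mean f : R := \int[mu]_(t in `[0, 1]) f t.

Lemma mean_integrable f : {within `[0, 1], continuous f} ->
  mu.-integrable `[0, 1] (EFin \o f).
Proof. by apply: continuous_compact_integrable; exact: segment_compact. Qed.

Lemma eq_mean f g : (forall t, 0 <= t <= 1 -> f t = g t) -> mean f = mean g.
Proof.
by move=> fg; apply: eq_Rintegral => t; rewrite inE /= in_itv /=; exact: fg.
Qed.

Lemma mean_cst (e : R) : mean (cst e) = e.
Proof.
rewrite /mean Rintegral_cst//= lebesgue_measure_itv /= lte_fin ltr01.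
by rewrite -EFinB subr0 mulr1.
Qed.

Lemma mean_norm_le f (e : R) : {within `[0, 1], continuous f} ->
  (forall t, 0 <= t <= 1 -> `|f t| <= e) -> `|mean f| <= e.
Proof.
move=> cf fe; have fint := mean_integrable cf.
rewrite -[e]mean_cst; apply: le_trans (le_normr_Rintegral _ fint) _ => //.
apply: le_Rintegral => //.
- exact: (integrable_norm fint).
- by apply: mean_integrable; apply: continuous_subspaceT => x; exact: cvg_cst.
Qed.

Lemma meanB f g : {within `[0, 1], continuous f} ->
  {within `[0, 1], continuous g} -> mean (fun t => f t - g t) = mean f - mean g.
Proof. by move=> cf cg; apply: RintegralB => //; exact: mean_integrable. Qed.

Lemma meanD f g : {within `[0, 1], continuous f} ->
  {within `[0, 1], continuous g} -> mean (fun t => f t + g t) = mean f + mean g.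
Proof. by move=> cf cg; apply: RintegralD => //; exact: mean_integrable. Qed.

Lemma meanZ f (r : R) : {within `[0, 1], continuous f} ->
  mean (fun t => r * f t) = r * mean f.
Proof. by move=> cf; apply: RintegralZl => //; exact: mean_integrable. Qed.

Lemma mean_derive f g : {within `[0, 1], continuous f} ->
  (forall t : R, 0 <= t <= 1 -> is_derive t 1 g (f t)) -> mean f = g 1 - g 0.
Proof.
move=> cf gf; rewrite /mean /Rintegral (@continuous_FTC2 _ f g)//.
  have cg (t : R) : 0 <= t <= 1 -> {for t, continuous g}.
    by move=> /gf[dg _]; apply/differentiable_continuous/derivable1_diffP.
  split=> [t||].
  - by rewrite in_itv /= => /andP[t0 t1]; have [] := gf t; rewrite ?ltW.
  - by apply: cvg_at_right_filter; apply: cg; rewrite lexx ler01.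
  - by apply: cvg_at_left_filter; apply: cg; rewrite lexx ler01.
move=> t; rewrite in_itv /= => /andP[t0 t1]; rewrite derive1E.
by have [|_ ->//] := gf t; rewrite ?ltW.
Qed.

End Mean.
Section Hadamard.
Context {R : realType} {V : normedModType R}.
Variables (q0 : V) (r : R).
Let B := ball q0 r.
Implicit Types F : V -> R.

Local Notation line q t := (t *: (q - q0) + q0).

Lemma line_ball q (t : R) : B q -> 0 <= t <= 1 -> B (line q t).
Proof.
move=> Bq /andP[t0 t1]; rewrite /B -ball_normE /ball_ /= distrC addrK.
rewrite normrZ ger0_norm//; apply: le_lt_trans (ler_piMl _ t1) _ => //.
by move: Bq; rewrite /B -ball_normE /ball_ /= distrC.
Qed.

Lemma line_continuous : continuous (fun u : R * V => line u.2 u.1).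
Proof.
move=> u;  apply: cvgD; last exact: cvg_cst.
apply: cvgZ; first exact: cvg_fst.
by apply: cvgB; [exact: cvg_snd|exact: cvg_cst].
Qed.

Lemma line_pair F q (t : R) : (forall y, B y -> {for y, continuous F}) ->
  B q -> 0 <= t <= 1 -> {for (t, q), continuous (fun u : R * V => F (line u.2 u.1))}.
Proof.
move=> cF Bq t01.
apply: (@continuous_comp _ _ _ (fun u : R * V => line u.2 u.1) F).
  exact: line_continuous.
by apply: cF; exact: line_ball.
Qed.

(** Compactness of [[0, 1]] makes continuity in [q] uniform in [t]; this is what allows limits to
    pass under the integral in [line_mean]. *)
Lemma near_line F q (e : R) : (forall y, B y -> {for y, continuous F}) -> B q ->
  0 < e ->
  \forall q' \near q, forall t : R, 0 <= t <= 1 -> `|F (line q' t) - F (line q t)| < e.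
Proof.
move=> cF Bq e0.
have : \forall q' \near q, `[0, 1] `<=` [set t : R | `|F (line q' t) - F (line q t)| < e].
  have /compact_near_coveringP := @segment_compact R 0 1.
  apply => t; rewrite /= in_itv /= => t01.
  have e2 : 0 < e / 2 by lra.
  have /cvgrPdist_lt/(_ _ e2)/= H := line_pair cF Bq t01.
  have H' : \forall t' \near t, `|F (line q t) - F (line q t')| < e / 2.
    have := @cvg_comp _ _ _ (fun t' : R => (t', q)) (fun u => F (line u.2 u.1))
      (nbhs t) _ _ _ (line_pair cF Bq t01).
    by move=> /(_ (cvg_pair cvg_id (cvg_cst _)))/cvgrPdist_lt/(_ _ e2).
  case: H => -[P Q] /= [nP nQ] PQ.
  exists ([set t' | P t' /\ `|F (line q t) - F (line q t')| < e / 2], Q) => /=.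
    by split=> //; exact: filterI.
  move=> [t' q'] /= [[Pt' ft'] Qq'].
  have := PQ (t', q') (conj Pt' Qq') => /= ft.
  have := ler_normB (F (line q t) - F (line q t')) (F (line q t) - F (line q' t')).
  rewrite opprB addrC addrA subrK distrC; lra.
by apply: filterS => q' H t t01; apply: H; rewrite /= in_itv.
Qed.

Lemma line_within F m q : (forall y, B y -> {for y, continuous F}) -> B q ->
  {within `[0, 1], continuous (fun t : R => t ^+ m * F (line q t))}.
Proof.
move=> cF Bq; apply: continuous_in_subspaceT => t.
rewrite inE /= in_itv /= => t01; apply: cvgM; first exact: exprn_continuous.
apply: (@continuous_comp _ _ _ (fun t : R => line q t) F).
  have := @continuous_comp _ _ _ (fun t : R => (t, q)) (fun u : R * V => line u.2 u.1) t.
  apply; last exact: line_continuous.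
  exact: (cvg_pair cvg_id (cvg_cst _)).
by apply: cF; exact: line_ball.
Qed.

(* [\int_0^1 t^m F(q0 + t (q - q0)) dt]: the derivative of this function of [q]
   along [v] is obtained by replacing [(m, F)] with [(m.+1, 'D_v F)]. *)
Definition line_mean m F q := mean (fun t : R => t ^+ m * F (line q t)).

(** Differentiation under the integral sign: the mean value theorem turns the difference quotient of
    the integrand into a value of ['D_v F], and [near_line] controls the error uniformly in [t]. *)
Lemma is_derive_line_mean m F q v : (forall j, is_Ck j B F) -> B q ->
  is_derive q v (line_mean m F) (line_mean m.+1 ('D_v F) q).
Proof.
move=> CF Bq.
have cF y : B y -> {for y, continuous F} by exact: (is_Ck_continuous (CF 0)).
have [dF CD] : _ /\ is_Ck 0 B ('D_v F) := (CF 1).2 v.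
have cD y : B y -> {for y, continuous ('D_v F)} by exact: (is_Ck_continuous CD).
suff H : h^-1 *: (line_mean m F (h *: v + q) - line_mean m F q) @[h --> 0^'] -->
    line_mean m.+1 ('D_v F) q.
  by split; [apply/cvg_ex; exists (line_mean m.+1 ('D_v F) q) | apply: cvg_lim].
apply/cvgrPdist_le => e e0.
have nP : nbhs q (B `&` [set q' | forall t : R, 0 <= t <= 1 ->
    `|'D_v F (line q' t) - 'D_v F (line q t)| < e]).
  apply: filterI; [by apply: open_nbhs_nbhs; split=> //; exact: ball_open|
                      exact: (near_line cD Bq e0)].
rewrite /= near_withinE; near=> h => h0.
have H : forall s t : R, `|s| <= `|h| -> `|t| <= `|h| ->
    B (s *: v + (t *: 0 + q)) /\ forall t' : R, 0 <= t' <= 1 ->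
      `|'D_v F (line (s *: v + (t *: 0 + q)) t') - 'D_v F (line q t')| < e.
  by near: h; exact: near_segment nP.
have {}H (s : R) : `|s| <= `|h| -> B (s *: v + q) /\ forall t : R, 0 <= t <= 1 ->
      `|'D_v F (line (s *: v + q) t) - 'D_v F (line q t)| < e.
  by move=> /H/(_ (lexx _)); rewrite scaler0 add0r.
have Bh : B (h *: v + q) by apply: (H h _).1.
have WD := @line_within _ m.+1 _ cD Bq.
have W1 := @line_within F m _ cF Bh; have W0 := @line_within F m _ cF Bq.
rewrite -[_ *: _]/(_ * _) /line_mean -meanB//.
rewrite -meanZ; last by move=> x; apply: cvgB; [exact: W1|exact: W0].
rewrite distrC -meanB; first last.
- exact: WD.
- by move=> x; apply: cvgM; [exact: cvg_cst|apply: cvgB; [exact: W1|exact: W0]].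
apply: mean_norm_le => [x|t /[dup] t01 /andP[t0 t1]].
  apply: cvgB; last exact: WD.
  by apply: cvgM; [exact: cvg_cst|apply: cvgB; [exact: W1|exact: W0]].
have lineE (s : R) : line (s *: v + q) t = (t * s) *: v + line q t.
  by rewrite -addrA scalerDr scalerA addrA.
have sh (s : R) : 0 <= s <= 1 -> `|s * h| <= `|h|.
  by move=> /andP[s0 s1]; rewrite normrM ger0_norm// ler_piMl.
(* Moving [q] by [h *: v] moves the point of parameter [t] by [(t * h) *: v], whence the extra
   factor [t]. The intermediate point is again some [line q' t] with [q'] in the ball, so [H]
   applies to it. *)
have [|s s01] := @mean_value_line _ _ F (line q t) v (t * h).
  move=> s s01; apply: dF; rewrite mulrCA -lineE; apply: line_ball => //.
  by apply: (H _ _).1; exact: sh.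
rewrite -lineE mulrCA -lineE => Fs.
have -> : h^-1 * (t ^+ m * F (line (h *: v + q) t) - t ^+ m * F (line q t)) =
    t ^+ m.+1 * 'D_v F (line ((s * h) *: v + q) t).
  by rewrite -mulrBr Fs exprSr; field.
rewrite -mulrBr normrM.
apply: le_trans (ltW ((H _ (sh s s01)).2 t t01)).
by rewrite ler_piMl// ger0_norm ?exprn_ge0 ?exprn_ile1.
Unshelve. all: by end_near. Qed.

Lemma is_Ck_line_mean k m F : (forall j, is_Ck j B F) -> is_Ck k B (line_mean m F).
Proof.
have c0 m' F' : (forall j, is_Ck j B F') ->
    forall q, B q -> {for q, continuous (line_mean m' F')}.
  move=> CF q Bq.
  have cF y : B y -> {for y, continuous F'} by exact: (is_Ck_continuous (CF 0)).
  apply/cvgrPdist_le => e e0.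
  have nB : \forall q' \near q, B q'.
    by apply: open_nbhs_nbhs; split=> //; exact: ball_open.
  near=> q'.
  have Bq' : B q' by near: q'.
  have H : forall t : R, 0 <= t <= 1 -> `|F' (line q' t) - F' (line q t)| < e.
    by near: q'; exact: near_line.
  rewrite /line_mean -meanB; [|exact: line_within..].
  apply: mean_norm_le => [x|t /[dup] t01 /andP[t0 t1]].
    by apply: cvgB; exact: line_within.
  rewrite -mulrBr normrM distrC; apply: le_trans (ltW (H t t01)).
  by rewrite ler_piMl// ger0_norm ?exprn_ge0 ?exprn_ile1.
have oB : open B by exact: ball_open.
elim: k m F => [|k IH] m F CF; first by split=> //; exact: c0.
split=> [q|v]; first exact: c0.
split=> [q Bq|]; first by have [] := is_derive_line_mean m v CF Bq.
have := IH m.+1 ('D_v F) (fun j => ((CF j.+1).2 v).2); apply: eq_is_Ck => // q Bq.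
by have [_ ->] := is_derive_line_mean m v CF Bq.
Unshelve. all: by end_near. Qed.

Lemma line_mean_FTC F q : (forall j, is_Ck j B F) -> B q ->
  F q - F q0 = line_mean 0 ('D_(q - q0) F) q.
Proof.
move=> CF Bq; have [dF CD] : _ /\ is_Ck 0 B ('D_(q - q0) F) := (CF 1).2 (q - q0).
have W := @line_within _ 0 _ (fun y => is_Ck_continuous CD) Bq.
have D (t : R) : 0 <= t <= 1 -> is_derive t 1 (fun t : R => F (t *: (q - q0) + q0))
    (t ^+ 0 * 'D_(q - q0) F (line q t)).
  move=> t01; rewrite expr0 mul1r; apply: is_derive_line; apply: dF.
  exact: line_ball.
by rewrite /line_mean (mean_derive W D) scale1r subrK scale0r add0r.
Qed.

End Hadamard.

(** Integrating ['D_(q - q0) F] along the segment from [q0] to [q], and expanding [q - q0] in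
    coordinates, gives the formula with [G i] the mean of ['D_(b i) F] over the segment. At [q = q0]
    the segment is a point, hence the value of [G i] there. A ball is taken because it contains
    these segments. *)
Lemma hadamard (R : realType) (V : normedModType R) (I : finType)
    (b : I -> V) (c : I -> {linear V -> R}) (A : set V) (q0 : V) (F : V -> R) :
  (forall v, v = \sum_i c i v *: b i) ->
  open A -> A q0 -> (forall k, is_Ck k A F) ->
  exists B (G : I -> V -> R), [/\ open B, B q0 & B `<=` A] /\
    [/\ forall i k, is_Ck k B (G i),
        forall i, G i q0 = 'D_(b i) F q0 &
        forall q, B q -> F q = F q0 + \sum_i (c i q - c i q0) * G i q].
Proof.
move=> cb oA Aq0 CF.
have /nbhs_ballP[r /= r0 rA] : nbhs q0 A by exact: open_nbhs_nbhs.
have oB : open (ball q0 r) by exact: ball_open.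
have Bq0 : ball q0 r q0 by exact: ballxx.
have CB k : is_Ck k (ball q0 r) F by exact: is_Ck_subset (CF k).
have CD v k : is_Ck k (ball q0 r) ('D_v F) by exact: ((CB k.+1).2 v).2.
exists (ball q0 r), (fun i => line_mean q0 0 ('D_(b i) F)); split=> //; split.
- by move=> i k; apply: is_Ck_line_mean => j; exact: CD.
- move=> i; rewrite /line_mean (@eq_mean _ _ (cst ('D_(b i) F q0))) ?mean_cst//.
  by move=> t t01; rewrite expr0 mul1r subrr scaler0 add0r.
- move=> q Bq; rewrite -[F q](subrK (F q0)) addrC (line_mean_FTC CB Bq).
  have W i : {within `[0, 1], continuous
      (fun t : R => t ^+ 0 * 'D_(b i) F (t *: (q - q0) + q0))}.
    exact: (@line_within _ _ q0 r _ 0 q (fun y => is_Ck_continuous (CD (b i) 0)) Bq).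
  have [oB' [Bq' C1]] : _ := conj oB (conj Bq (CB 1)).
  have lq t : 0 <= t <= 1 -> ball q0 r (t *: (q - q0) + q0) by exact: line_ball.
  under eq_bigr => i _ do rewrite -linearB.
  rewrite /line_mean.
  transitivity (F q0 + mean (fun t : R =>
      \sum_i c i (q - q0) * (t ^+ 0 * 'D_(b i) F (t *: (q - q0) + q0)))).
    congr (_ + _); apply: eq_mean => t t01.
    rewrite expr0 mul1r (derive_coordE cb _ oB (lq t t01) C1).
    by apply: eq_bigr => i _; rewrite mul1r.
  congr (_ + _); elim: (index_enum I) => [|i s IH].
    rewrite big_nil -[RHS](@mean_cst R 0).
    by apply: eq_mean => t _; rewrite big_nil.
  rewrite big_cons -IH -meanZ// -meanD.
  - by apply: eq_mean => t _; rewrite big_cons.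
  - by move=> t; apply: cvgM; [exact: cvg_cst|exact: W].
  - move=> t; apply: cvg_big => [|j _]; first exact: add_continuous.
    by apply: cvgM; [exact: cvg_cst|exact: W].
Qed.

(** * The ambient space of the circle times SL(2) *)

Lemma linear_continuous_coord (R : realType) (V W : normedModType R) (I : finType)
    (b : I -> V) (c : I -> {linear V -> R}) (l : {linear V -> W}) :
  (forall i, continuous (c i)) -> (forall v, v = \sum_i c i v *: b i) ->
  continuous l.
Proof.
move=> cc cb v; rewrite /continuous_at.
have lE u : l u = \sum_i c i u *: l (b i).
  by rewrite {1}(cb u) linear_sum; apply: eq_bigr => i _; rewrite linearZ.
suff : (fun u => \sum_i c i u *: l (b i)) @ v --> \sum_i c i v *: l (b i).
  by under eq_fun do rewrite -lE; rewrite -lE.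
apply: cvg_big => [|i _]; first exact: add_continuous.
exact: (cvgZ (cc i v) (cvg_cst (l (b i)))).
Qed.

Lemma is_derive_scalel (R : realType) (V : normedModType R) (f : R -> R) (v : V)
    (t d : R) : is_derive t 1 f d -> is_derive t 1 (fun s => f s *: v) (d *: v).
Proof.
case=> df Df.
suff H : h^-1 *: (f (h *: 1 + t) *: v - f t *: v) @[h --> 0^'] --> d *: v.
  by split; [apply/cvg_ex; exists (d *: v) | apply: cvg_lim].
under eq_fun do rewrite -scalerBl scalerA.
by apply: cvgZ (cvg_cst v); rewrite -Df; exact: df.
Qed.

Section Ambient.
Context {R : realType}.

Definition ambient := ('rV[R]_2 * 'M[R]_2)%type.
Definition amb_index := ('I_2 + 'I_2 * 'I_2)%type.

Definition amb_basis (i : amb_index) : ambient :=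
  match i with
  | inl j => (delta_mx 0 j, 0)
  | inr kl => (0, delta_mx kl.1 kl.2)
  end.

Definition amb_coord (i : amb_index) (v : ambient) : R :=
  match i with inl j => v.1 ord0 j | inr kl => v.2 kl.1 kl.2 end.

Lemma amb_coord_is_linear i : linear (amb_coord i).
Proof. by case: i => [j|kl] a u v; rewrite /= !mxE. Qed.

HB.instance Definition _ i :=
  GRing.isLinear.Build R ambient R _ (amb_coord i) (amb_coord_is_linear i).

Definition amb_lin (i : amb_index) : {linear ambient -> R} := amb_coord i.

Lemma amb_lin_continuous i : continuous (amb_lin i).
Proof.
case: i => [j|kl] v.
  apply: (@continuous_comp _ _ _ fst (fun u : 'rV[R]_2 => u ord0 j)).
    exact: cvg_fst.
  exact: coord_continuous.
apply: (@continuous_comp _ _ _ snd (fun u : 'M[R]_2 => u kl.1 kl.2)).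
  exact: cvg_snd.
exact: coord_continuous.
Qed.

Lemma ambientE (v : ambient) : v = \sum_i amb_lin i v *: amb_basis i.
Proof.
have fstE : {morph (fst : ambient -> 'rV[R]_2) : u w / u + w >-> u + w} by [].
have sndE : {morph (snd : ambient -> 'M[R]_2) : u w / u + w >-> u + w} by [].
have fst0 : fst (0 : ambient) = 0 by [].
have snd0 : snd (0 : ambient) = 0 by [].
case: v => z P; rewrite big_sumType /=.
apply: injective_projections; rewrite /=.
  rewrite ?fstE !(big_morph _ fstE fst0) [X in _ + X]big1 ?addr0.
    by rewrite {1}[z]row_sum_delta.
  by move=> kl _; rewrite /= scaler0.
rewrite ?sndE !(big_morph _ sndE snd0) [X in X + _]big1 ?add0r.
  rewrite -(pair_bigA _ (fun k l => P k l *: delta_mx k l)) /=.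
  by rewrite {1}[P]matrix_sum_delta.
by move=> kl _; rewrite /= scaler0.
Qed.

(* [a = tau + a0] with [a0] traceless acts on the circle factor by rotation with
   speed [tau], and on the matrix factor by left multiplication by [a0]. *)
Definition rot_mx : 'M[R]_2 := \matrix_(i, j)
  if (i == 0) && (j == 1) then 1 else if (i == 1) && (j == 0) then -1 else 0.

Definition frame_vec (a : 'M[R]_2) (q : ambient) : ambient :=
  ((\tr a / 2) *: (q.1 *m rot_mx), (a - (\tr a / 2)%:M) *m q.2).

Lemma frame_vec_is_linear a : linear (frame_vec a).
Proof.
move=> k u v; apply: injective_projections => /=.
  by rewrite mulmxDl -scalemxAl scalerDr !scalerA mulrC.
by rewrite mulmxDr -scalemxAr.
Qed.

HB.instance Definition _ a :=
  GRing.isLinear.Build R ambient ambient _ (frame_vec a) (frame_vec_is_linear a).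

Lemma frame_vecP k a b q :
  frame_vec (k *: a + b) q = k *: frame_vec a q + frame_vec b q.
Proof.
apply: injective_projections => /=; rewrite mxtraceD mxtraceZ mulrDl.
  by rewrite scalerDl scalerA mulrA.
rewrite scalemxAl -mulmxDl; congr (_ *m _); apply/matrixP => i j.
by rewrite !mxE; case: (i == j); rewrite ?mulr1n ?mulr0n; ring.
Qed.

Definition rmul_amb (P : 'M[R]_2) (q : ambient) : ambient := (q.1, q.2 *m P).

Lemma rmul_amb_is_linear P : linear (rmul_amb P).
Proof.
move=> k u v; apply: injective_projections => //=.
by rewrite mulmxDl -scalemxAl.
Qed.

HB.instance Definition _ P :=
  GRing.isLinear.Build R ambient ambient _ (rmul_amb P) (rmul_amb_is_linear P).

Lemma frame_vec_rmul a P q : frame_vec a (rmul_amb P q) = rmul_amb P (frame_vec a q).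
Proof. by rewrite /frame_vec /rmul_amb /= mulmxA. Qed.

Lemma amb_linear_continuous (W : normedModType R) (l : {linear ambient -> W}) :
  continuous l.
Proof. exact: (linear_continuous_coord amb_lin_continuous ambientE). Qed.

(* Rational curves through [q] in the product of the circle and SL(2): the
   Cayley parametrization of the one-parameter groups of [rot_mx] and [a0]. *)
Definition cayley_den (t d : R) := 1 + t ^+ 2 * (d / 4).

Definition cayley {m n} (t d : R) (u w : 'M[R]_(m, n)) :=
  ((1 - t ^+ 2 * (d / 4)) / cayley_den t d) *: u + (t / cayley_den t d) *: w.

Definition frame_curve a (q : ambient) (t : R) : ambient :=
  (cayley t ((\tr a / 2) ^+ 2) q.1 (frame_vec a q).1,
   cayley t (\det (a - (\tr a / 2)%:M)) q.2 (frame_vec a q).2).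

Lemma frame_curve0 a q : frame_curve a q 0 = q.
Proof.
rewrite /frame_curve /cayley /cayley_den expr0n /= !mul0r subr0 addr0 divr1.
by rewrite !scale1r !scale0r !addr0; case: q.
Qed.

Definition circleSL2 : set ambient := [set q | circle q.1 /\ SL2 q.2].

Lemma det2 (A : 'M[R]_2) : \det A = A 0 0 * A 1 1 - A 0 1 * A 1 0.
Proof.
rewrite (expand_det_row _ 0) !big_ord_recl big_ord0 /cofactor !det_mx11 !mxE.
have l0 (i : 'I_1) : lift (0 : 'I_2) i = 1 by apply/val_inj; rewrite (ord1 i).
have l1 (i : 'I_1) : lift (lift (0 : 'I_2) i) i = 0 by apply/val_inj; rewrite (ord1 i).
rewrite !l0 -?(l0 0) !l1 (l0 0).
by rewrite /= expr0 expr1 mul1r mulN1r mulrN addr0.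
Qed.

Lemma tr2 (A : 'M[R]_2) : \tr A = A 0 0 + A 1 1.
Proof.
by rewrite /mxtrace !big_ord_recl big_ord0 addr0; congr (_ + A _ _); exact/val_inj.
Qed.

Lemma cayley_derive (d : R) :
  is_derive (0 : R) 1 (fun t => (1 - t ^+ 2 * (d / 4)) / cayley_den t d) 0 /\
  is_derive (0 : R) 1 (fun t => t / cayley_den t d) 1.
Proof.
have d0 : is_derive (0 : R) 1 (cayley_den^~ d) 0.
  have -> : cayley_den^~ d = cst 1 + (d / 4) \*: (id * id).
    by apply/funext => t; rewrite /cayley_den expr2 mulrC.
  have did := is_derive_id (0 : R) 1.
  apply: (is_derive_eq (is_deriveD (is_derive_cst (1 : R) _ _) (is_deriveZ (d / 4) (is_deriveM did did)))).
  by rewrite !scale0r addr0 scaler0 addr0.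
have den0 : cayley_den 0 d = 1 by rewrite /cayley_den expr0n mul0r addr0.
have dV : is_derive (0 : R) 1 (fun t => (cayley_den t d)^-1) 0.
  have := @is_deriveV R (cayley_den^~ d) 0 0 1; rewrite den0 scaler0.
  by apply; rewrite ?oner_eq0.
split.
  have -> : (fun t => (1 - t ^+ 2 * (d / 4)) / cayley_den t d) =
      (cst 2 - cayley_den^~ d) * (fun t => (cayley_den t d)^-1).
    by apply/funext => t; congr (_ / _); change (1 - t ^+ 2 * (d / 4) = 2 - cayley_den t d); rewrite /cayley_den; ring.
  apply: (is_derive_eq (is_deriveM (is_deriveB (is_derive_cst (2 : R) _ _) d0) dV)).
  by rewrite subr0 !scaler0 addr0.
have -> : (fun t => t / cayley_den t d) = id * (fun t => (cayley_den t d)^-1) by [].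
apply: (is_derive_eq (is_deriveM (is_derive_id _ _) dV)).
by rewrite den0 invr1 scaler0 add0r scale1r.
Qed.

Lemma is_derive_frame_curve a q :
  is_derive (0 : R) 1 (frame_curve a q) (frame_vec a q).
Proof.
pose b d (t : R) := (1 - t ^+ 2 * (d / 4)) / cayley_den t d.
pose c d (t : R) := t / cayley_den t d.
pose d1 := (\tr a / 2) ^+ 2; pose d2 := \det (a - (\tr a / 2)%:M).
set w := frame_vec a q.
have -> : frame_curve a q =
  (fun t => b d1 t *: ((q.1, 0) : ambient)) + (fun t => c d1 t *: ((w.1, 0) : ambient)) +
  ((fun t => b d2 t *: ((0, q.2) : ambient)) + (fun t => c d2 t *: ((0, w.2) : ambient))).
  apply/funext => t; apply: injective_projections; rewrite /=.
    by rewrite !scaler0 !addr0.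
  by rewrite !scaler0 !add0r.
have [b1 c1] := cayley_derive d1; have [b2 c2] := cayley_derive d2.
have B1 := is_derive_scalel ((q.1, 0) : ambient) b1.
have B2 := is_derive_scalel ((0, q.2) : ambient) b2.
have C1 := is_derive_scalel ((w.1, 0) : ambient) c1.
have C2 := is_derive_scalel ((0, w.2) : ambient) c2.
have := is_deriveD (is_deriveD B1 C1) (is_deriveD B2 C2).
rewrite !scale0r !scale1r !add0r.
by rewrite (_ : (w.1, 0) + (0, w.2) = w)//; apply: injective_projections; rewrite /= ?addr0 ?add0r.
Qed.

(** A traceless [a0] of determinant [d] satisfies [a0 ^ 2 = - d], so the Cayley transform
    [(1 + t a0 / 2) / (1 - t a0 / 2)] equals [((1 - t ^ 2 d / 4) + t a0) / (1 + t ^ 2 d / 4)]. Its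
    determinant is 1, since [1 + t a0 / 2] and [1 - t a0 / 2] both have determinant
    [1 + t ^ 2 d / 4]. The circle is the case of [tau] times [rot_mx], with [d = tau ^ 2]. Small [t]
    keeps the denominators away from 0. *)
Lemma near_frame_curve a q : circleSL2 q ->
  \forall t \near (0 : R), circleSL2 (frame_curve a q t).
Proof.
have nden d : \forall t \near (0 : R), cayley_den t d != 0.
  have : cayley_den^~ d @ (0 : R) --> (1 : R).
    rewrite -[X in _ --> X](_ : 1 + 0 ^+ 2 * (d / 4) = 1); last by rewrite expr0n mul0r addr0.
    apply: cvgD; first exact: cvg_cst.
    by apply: cvgM; [exact: exprn_continuous|exact: cvg_cst].
  move=> /cvgr_neq0; apply; exact: oner_neq0.
move=> [cq sq]; near=> t; split.
  have d0 : cayley_den t ((\tr a / 2) ^+ 2) != 0 by near: t; exact: nden.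
  move: cq d0; rewrite /circle /frame_curve /cayley /= !mxE !big_ord_recl !big_ord0 !mxE /=.
  rewrite (_ : lift ord0 (ord0 : 'I_1) = ord_max :> 'I_2); last exact/val_inj.
  set z0 := q.1 _ _; set z1 := q.1 _ _; set tau := \tr a / 2; rewrite /cayley_den.
  move=> cq d0.
  transitivity (z0 ^+ 2 + z1 ^+ 2); last exact: cq.
  field; apply: contra_neq d0 => E; transitivity ((4 + (t * tau) ^+ 2) / 4); [by field|by rewrite E mul0r].
have d0 : cayley_den t (\det (a - (\tr a / 2)%:M)) != 0 by near: t; exact: nden.
set a0 := a - _ in d0; have tr0 : a0 1 1 = - a0 0 0.
  by rewrite /a0 !mxE /= !mulr1n tr2; field.
have sq' : \det q.2 = 1 by exact: sq.
suff : \det (cayley t (\det a0) q.2 (a0 *m q.2)) = 1 by [].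
clearbody a0.
have -> : cayley t (\det a0) q.2 (a0 *m q.2) =
  (((1 - t ^+ 2 * (\det a0 / 4)) / cayley_den t (\det a0))%:M +
   (t / cayley_den t (\det a0)) *: a0) *m q.2.
  by rewrite mulmxDl mul_scalar_mx -scalemxAl.
rewrite det_mulmx sq' mulr1; move: d0; rewrite /cayley_den; set d := \det a0 => d0.
  rewrite det2 !mxE /= tr0 !mulr1n !mulr0n.
  have dE : d = - a0 0 0 ^+ 2 - a0 0 1 * a0 1 0 by rewrite /d det2 tr0; ring.
transitivity (((1 - t ^+ 2 * (d / 4)) / (1 + t ^+ 2 * (d / 4))) ^+ 2 + (t / (1 + t ^+ 2 * (d / 4))) ^+ 2 * d).
  by rewrite [in X in _ = _ + _ * X]dE; ring.
field; apply: contra_neq d0 => Ed; transitivity ((4 + t ^+ 2 * d) / 4); [by field|by rewrite Ed mul0r].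
Unshelve. all: by end_near. Qed.

End Ambient.

(** * The quotient by the lattice *)

Section CosetTopology.
Context {G : topGroupType} (Gamma : groupClosed G).
Implicit Types (x y : G) (U : set G).
Local Notation proj := (@coset_proj G Gamma).

Lemma coset_projP x y : proj x = proj y <-> (x^-1 * y)%g \in Gamma.
Proof.
have H := @eqmodP _ (coset_equiv Gamma) x y.
split=> [xy|xy]; first by apply/H; exact: xy.
by move/H: xy => xy; exact: xy.
Qed.

Lemma coset_proj_surj (m : coset_space Gamma) : exists x, m = proj x.
Proof. by exists (repr m); rewrite /coset_proj reprK. Qed.

Lemma coset_projM x g : g \in Gamma -> proj (x * g)%g = proj x.
Proof. by move=> gG; apply/esym/coset_projP; rewrite mulKg. Qed.

Lemma mulgr_continuous (g : G) : continuous (fun x => (x * g)%g).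
Proof.
move=> x; apply: (@continuous_comp _ _ _ (fun x => (x, g)) (fun u : G * G => (u.1 * u.2)%g)).
  exact: (cvg_pair cvg_id (cvg_cst _)).
exact: mulg_continuous.
Qed.

Lemma coset_proj_continuous : continuous proj.
Proof. exact: pi_continuous. Qed.

(** The projection is open: the saturation of an open [W] is the union of its right translates by
    [Gamma]. *)
Lemma nbhs_coset_proj x U : nbhs x U -> nbhs (proj x) (proj @` U).
Proof.
rewrite nbhsE => -[W [oW Wx] WU].
apply: (@filterS _ _ _ (proj @` W)) => [m [y Wy <-]|]; first by exists y => //; exact: WU.
apply: open_nbhs_nbhs; split; last by exists x.
rewrite /open /= /quotient_open.
have -> : (\pi_(coset_space Gamma))%qT @^-1` (proj @` W) =
    \bigcup_(g in [set g | g \in Gamma]) ((fun y => (y * g)%g) @^-1` W).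
  apply/seteqP; split => [y [w Ww /coset_projP wy]|y [g /= gG Wyg]].
    exists (y^-1 * w)%g; last by rewrite /= mulVKg.
    by rewrite /= -gpredV invgM invgK.
  by exists (y * g)%g => //; rewrite coset_projM.
apply: bigcup_open => g _.
by move: oW; apply: open_comp => y _; exact: mulgr_continuous.
Qed.

(** Some neighbourhood of 1 meets [Gamma] in 1 only; by continuity [y^-1 * y'] lies in it once [y]
    and [y'] are both close to [x]. *)
Lemma coset_proj_local_inj x : discrete_subgroup Gamma ->
  exists U, nbhs x U /\ forall y y', U y -> U y' -> proj y = proj y' -> y = y'.
Proof.
move=> dG; have [W [oW W1 WG]] := dG 1%g gpred1.
have : nbhs (x, x) [set u : G * G | W (u.1^-1 * u.2)%g].
  have : continuous (fun u : G * G => (u.1^-1 * u.2)%g).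
    move=> u; apply: (@continuous_comp _ _ _ (fun u : G * G => (u.1^-1, u.2)%g)
      (fun u : G * G => (u.1 * u.2)%g)); last exact: mulg_continuous.
    apply: cvg_pair; last exact: cvg_snd.
    by apply: (@continuous_comp _ _ _ fst (fun x : G => x^-1%g));
      [exact: cvg_fst|exact: invg_continuous].
  move=> /(_ (x, x)) /=; apply; rewrite /= mulVg.
  exact: open_nbhs_nbhs.
move=> [[P Q] /= [nP nQ] PQ]; exists (P `&` Q); split; first exact: filterI.
move=> y y' [Py _] [_ Qy'] /coset_projP yy'.
have := WG _ (PQ (y, y') (conj Py Qy')) yy'.
by move=> /(congr1 (fun g => (y * g)%g)); rewrite /= mulVKg mulg1.
Qed.

End CosetTopology.

(** * Passing between the surface, its cover and the ambient space *)

Section Lifts.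
Context {R : realType} {G : topGroupType} (p : G -> 'M[R]_2).
Hypothesis hp : universal_cover_SL2 p.
Context (Gamma : groupClosed G).
Hypothesis hdisc : discrete_subgroup Gamma.

Local Notation M := (kodaira_thurston p Gamma).
Local Notation cover := (set_type (@circle R) * G)%type.
Local Notation ambient := (@ambient R).
Implicit Types (y : cover) (f : M -> R) (h : ambient -> R).

Definition embed y : ambient := (set_val y.1, p y.2).
Definition down y : M := (y.1, coset_proj Gamma y.2).

Lemma coverM x x' : p (x * x')%g = p x *m p x'.
Proof. by case: hp. Qed.

Lemma cover_SL2 x : SL2 (p x).
Proof. by case: hp => _ _ [_ <- _]; exists x. Qed.

Lemma cover_continuous : continuous p.
Proof. by case: hp => _ _ []. Qed.

Lemma embed_circleSL2 y : circleSL2 (embed y).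
Proof.
by split; [case: y => -[z zc] x /=; rewrite set_valE /=; exact: set_mem zc|exact: cover_SL2].
Qed.

Lemma embed_continuous : continuous embed.
Proof.
move=> y.
have c1 : (fun y' : cover => set_val y'.1 : 'rV[R]_2) @ y --> (set_val y.1 : 'rV[R]_2).
  apply: (@continuous_comp _ _ _ fst (set_val : set_type (@circle R) -> 'rV[R]_2)).
    exact: cvg_fst.
  exact: initial_continuous.
have c2 : (fun y' : cover => p y'.2) @ y --> p y.2.
  by apply: continuous_comp; [exact: cvg_snd|exact: cover_continuous].
exact: (cvg_pair c1 c2).
Qed.

Lemma down_surj (m : M) : exists y, m = down y.
Proof.
by case: m => z c; have [x ->] := coset_proj_surj c; exists (z, x).
Qed.

Lemma down_continuous : continuous down.
Proof.
move=> y.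
have c1 : (fun y' : cover => y'.1) @ y --> y.1 by exact: cvg_fst.
have c2 : (fun y' : cover => coset_proj Gamma y'.2) @ y --> coset_proj Gamma y.2.
  apply: (@continuous_comp _ _ _ snd (coset_proj Gamma)); first exact: cvg_snd.
  exact: coset_proj_continuous.
exact: (cvg_pair c1 c2).
Qed.

(** Because [down] is both continuous and open, local statements on the quotient can be checked on
    the cover, where representatives live. *)
Lemma near_down y (P : M -> Prop) :
  (\forall m \near down y, P m) <-> (\forall y' \near y, P (down y')).
Proof.
split; first by apply: down_continuous.
move=> [[U W] /= [nU nW] UW]; exists (U, coset_proj Gamma @` W) => /=.
  by split=> //; exact: nbhs_coset_proj.
by move=> [z c] /= [Uz [x Wx <-]]; exact: (UW (z, x)).
Qed.

(** [embed] is locally onto [circleSL2]: the continuous inverse [s] of [p] on the sheet through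
    [y.2] lifts nearby matrices to nearby group elements. It shows that two representatives of one
    germ agree on [circleSL2] near [embed y]. *)
Lemma near_embed y (P : cover -> Prop) : (\forall y' \near y, P y') ->
  \forall q \near embed y, circleSL2 q -> exists2 y', embed y' = q & P y'.
Proof.
move=> [[U W] /= [nU nW] UW].
case: hp => _ _ [_ _ /(_ (p y.2) (cover_SL2 _))].
move=> [N [oN Ny [I [S [oS _ pN pS]]]]].
have [i _ Siy] : (\bigcup_i S i) y.2 by rewrite -pN.
have [pSi [s [cs sp]]] := pS i.
have nC : \forall C \near p y.2, SL2 C -> (N C) /\ W (s C).
  have NC : (N `&` @SL2 R) (p y.2) by split=> //; exact: cover_SL2.
  have sW : nbhs (s (p y.2)) W by rewrite sp.
  have := cs (p y.2) W sW.
  rewrite -[X in X -> _]/(nbhs_subspace (p y.2 : subspace (N `&` @SL2 R)) (s @^-1` W)).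
  rewrite -nbhs_subspace_in// => nW'.
  have nN : nbhs (p y.2) N by exact: (open_nbhs_nbhs (conj oN Ny)).
  have {}nW' : \forall C \near p y.2, (N `&` @SL2 R) C -> W (s C) by exact: nW'.
  near=> C => SC; have NC' : N C by near: C.
  by split=> //; apply: (near nW' C) => //.
have [Z [oZ Zz ZU]] : exists Z : set 'rV[R]_2, [/\ open Z, Z (set_val y.1) &
    set_val @^-1` Z `<=` U].
  move: nU; rewrite nbhsE => -[U' [[Z oZ ZU'] U'z] U'U].
  by exists Z; split=> //; [rewrite -ZU' in U'z|rewrite ZU'].
exists (Z, [set C | SL2 C -> N C /\ W (s C)]) => /=.
  by split=> //; exact: open_nbhs_nbhs.
move=> [z C] /= [Zz' WC] [cz sC]; have [NC WsC] := WC sC.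
have [x Sx xC] : (p @` S i) C by rewrite pSi.
exists (exist _ z (mem_set cz), x); first by rewrite /embed /= set_valE xC.
apply: UW; split=> /=; first by apply: ZU.
by rewrite -(sp _ Sx) xC.
Unshelve. all: by end_near. Qed.

(** Discreteness enters here: points near [down y] have exactly one lift with second component in
    [U], at which [h] can be evaluated. Points without such a lift get the default 0, which does not
    affect the germ. *)
Lemma embed_extend y h : exists f, \forall y' \near y, f (down y') = h (embed y').
Proof.
have [U [nU injU]] := coset_proj_local_inj y.2 hdisc.
pose Q (m : M) := [set r | exists y', [/\ U y'.2, down y' = m & r = h (embed y')]].
exists (fun m => xget 0 (Q m)).
exists (setT, U) => /=; first by split=> //; exact: filterT.
move=> y' /= [_ Uy'].
case: xgetP => [r _ [y2 [Uy2 + ->]]|/(_ (h (embed y')))[]]; last by exists y'.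
by case: y' y2 Uy' Uy2 => [z x] [z2 x2] /= Ux Ux2 [-> /injU ->].
Qed.

End Lifts.

(** * Smooth germs on a normed space and on the ambient space *)

Section SmoothNear.
Context {R : realType} {V : normedModType R}.
Implicit Types (q v : V) (f g : V -> R).

Lemma smooth_near_derivable q v f : smooth_near q f -> derivable f q v.
Proof. by move=> [A [_ Aq /(_ 1)[_ /(_ v)[+ _]]]]; apply. Qed.

Lemma smooth_near_open q f : smooth_near q f -> \forall q' \near q, smooth_near q' f.
Proof.
move=> [A [oA Aq CA]]; apply: filterS (open_nbhs_nbhs (conj oA Aq)) => q' Aq'.
by exists A.
Qed.

Lemma smooth_near2 q (F : V -> R) f g :
  (forall A, open A -> (forall k, is_Ck k A f) -> (forall k, is_Ck k A g) ->
    forall k, is_Ck k A F) ->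
  smooth_near q f -> smooth_near q g -> smooth_near q F.
Proof.
move=> FP [A [oA Aq CA]] [B [oB Bq CB]]; exists (A `&` B); split=> //.
  exact: openI.
apply: FP; first exact: openI.
  by move=> k; apply: is_Ck_subset (CA k) => ? [].
by move=> k; apply: is_Ck_subset (CB k) => ? [].
Qed.

Lemma smooth_near_cst q (a : R) : smooth_near q (fun=> a).
Proof. by exists setT; split=> //; [exact: openT|move=> k; exact: is_Ck_cst]. Qed.

Lemma smooth_nearD q f g : smooth_near q f -> smooth_near q g ->
  smooth_near q (fun x => f x + g x).
Proof. by apply: smooth_near2 => A oA Cf Cg k; exact: is_CkD. Qed.

Lemma smooth_nearM q f g : smooth_near q f -> smooth_near q g ->
  smooth_near q (fun x => f x * g x).
Proof. by apply: smooth_near2 => A oA Cf Cg k; exact: is_CkM. Qed.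

Lemma smooth_near_expR q f : smooth_near q f -> smooth_near q (fun x => expR (f x)).
Proof. by move=> sf; apply: (smooth_near2 _ sf sf) => A oA Cf Cg k; exact: is_Ck_expR. Qed.

Lemma smooth_near_atan q f : smooth_near q f -> smooth_near q (fun x => atan (f x)).
Proof. by move=> sf; apply: (smooth_near2 _ sf sf) => A oA Cf Cg k; exact: is_Ck_atan. Qed.

Lemma smooth_nearV q f : f q != 0 -> smooth_near q f -> smooth_near q (fun x => (f x)^-1).
Proof.
move=> f0 [A [oA Aq CA]].
have : nbhs q (A `&` [set q' | f q' != 0]).
  apply: filterI; first exact: open_nbhs_nbhs.
  by have := is_Ck_continuous (CA 0%N) Aq => /cvgr_neq0; apply.
rewrite nbhsE => -[B [oB Bq] BA]; exists B; split=> // k.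
apply: is_CkV => //; first by move=> x /BA[].
by apply: is_Ck_subset (CA k) => x /BA[].
Qed.

Lemma smooth_near_linear q (l : {linear V -> R}) : continuous l -> smooth_near q l.
Proof.
by move=> cl; exists setT; split=> //; [exact: openT|move=> k; exact: is_Ck_linear].
Qed.

End SmoothNear.

Section SmoothAmbient.
Context {R : realType}.
Local Notation ambient := (@ambient R).
Implicit Types (q : ambient) (h : ambient -> R) (a : 'M[R]_2).

Lemma derive_ambientE h A q (v : ambient) : open A -> A q -> is_Ck 1 A h ->
  'D_v h q = \sum_i amb_lin i v * 'D_(amb_basis i) h q.
Proof.
exact: (@derive_coordE R ambient amb_index (@amb_basis R) (@amb_lin R)
  (@ambientE R) h A q v).
Qed.

Lemma is_derive_ambient_curve h A (g : R -> ambient) (t : R) (w : ambient) :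
  open A -> A (g t) -> is_Ck 1 A h -> is_derive t 1 g w ->
  is_derive t 1 (h \o g) ('D_w h (g t)).
Proof.
exact: (@is_derive_curve R ambient amb_index (@amb_basis R) (@amb_lin R)
  (@amb_lin_continuous R) (@ambientE R) h A g t w).
Qed.

Lemma derive_ambientP h q (v w : ambient) (k : R) : smooth_near q h ->
  'D_(k *: v + w) h q = k * 'D_v h q + 'D_w h q.
Proof. by move=> [A [oA Aq CA]]; have c1 := CA 1%N; exact: (derive_dirP _ _ _ oA Aq c1). Qed.

(** The direction varies with the point, whereas [is_Ck] speaks of fixed directions; expanding in
    [amb_basis] separates the linear coefficients from derivatives along fixed vectors. *)
Lemma smooth_near_frame_vec q h a : smooth_near q h ->
  smooth_near q (fun q' => 'D_(frame_vec a q') h q').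
Proof.
move=> [A [oA Aq CA]]; exists A; split=> // k.
have H : is_Ck k A (fun q' => \sum_i amb_lin i (frame_vec a q') * 'D_(amb_basis i) h q').
  apply: is_Ck_sum => // i; apply: is_CkM => //; last exact: ((CA k.+1).2 _).2.
  apply: (@is_Ck_linear _ _ _ _ (amb_lin i \o frame_vec a)).
  exact: amb_linear_continuous.
apply: eq_is_Ck H => // q' Aq'.
have c1 := CA 1%N.
by rewrite (derive_ambientE (frame_vec a q') oA Aq' c1).
Qed.

Lemma smooth_near_rmul P q h : smooth_near (rmul_amb P q) h ->
  smooth_near q (h \o rmul_amb P).
Proof.
move=> [A [oA Aq CA]].
have cP : continuous (@rmul_amb R P).
  exact: amb_linear_continuous.
exists (rmul_amb P @^-1` A); split=> // [|k].
  by apply: open_comp => // x _; apply: cP.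
have := is_Ck_comp_affine 0 cP (CA k).
rewrite (_ : (fun w => _) = h \o rmul_amb P); last first.
  by apply/funext => w; rewrite /= add0r.
by rewrite (_ : mkset _ = rmul_amb P @^-1` A)//; apply/funext => w /=; rewrite add0r.
Qed.

Lemma derive_rmul P q (v : ambient) h :
  'D_v (h \o rmul_amb P) q = 'D_(rmul_amb P v) h (rmul_amb P q).
Proof.
have E : (fun t : R => t^-1 *: (h (rmul_amb P (t *: v + q)) - h (rmul_amb P q))) =
    (fun t : R => t^-1 *: (h (t *: rmul_amb P v + rmul_amb P q) - h (rmul_amb P q))).
  by apply/funext => t; rewrite -linearP.
by rewrite /derive /comp /shift /= E.
Qed.

(* The frame vectors are tangent to [circleSL2], so that they only see the
   restriction of a function to it. *)
Lemma derive_frame_vec_eq a q h h' : circleSL2 q ->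
  smooth_near q h -> smooth_near q h' ->
  (\forall q' \near q, circleSL2 q' -> h q' = h' q') ->
  'D_(frame_vec a q) h q = 'D_(frame_vec a q) h' q.
Proof.
move=> Nq [A [oA Aq CA]] [A' [oA' Aq' CA']] hh'.
have dc := is_derive_frame_curve a q.
have c0 := frame_curve0 a q.
have H1 : is_derive (0 : R) 1 (h \o frame_curve a q) ('D_(frame_vec a q) h q).
  have c1 : is_Ck 1 A h := CA 1%N.
  have A0 : A (frame_curve a q 0) by rewrite c0.
  by have := is_derive_ambient_curve oA A0 c1 dc; rewrite c0.
have H2 : is_derive (0 : R) 1 (h' \o frame_curve a q) ('D_(frame_vec a q) h' q).
  have c1 : is_Ck 1 A' h' := CA' 1%N.
  have A0 : A' (frame_curve a q 0) by rewrite c0.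
  by have := is_derive_ambient_curve oA' A0 c1 dc; rewrite c0.
have cc : {for (0 : R), continuous (frame_curve a q)}.
  by apply: differentiable_continuous; apply/derivable1_diffP; have [] := dc.
have [_ <-] := H1; have [_ <-] := H2.
apply: near_eq_derive.
have := cc; rewrite /prop_for /continuous_at c0 => /(_ _ hh') H.
exact: filterS2 (fun t Ht Nt => Ht Nt) H (near_frame_curve a Nq).
Qed.

End SmoothAmbient.

(** * Frame fields *)

Fact frame_key : unit. Proof. by []. Qed.

Section Frame.
Context {R : realType} {G : topGroupType} (p : G -> 'M[R]_2).
Hypothesis hp : universal_cover_SL2 p.
Context (Gamma : groupClosed G).
Hypothesis hdisc : discrete_subgroup Gamma.

Local Notation M := (kodaira_thurston p Gamma).
Local Notation cover := (set_type (@circle R) * G)%type.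
Local Notation ambient := (@ambient R).
Local Notation dn := (@down R G p Gamma).
Local Notation emb := (@embed R G p).
Implicit Types (y : cover) (m : M) (f g : M -> R) (h : ambient -> R) (a b : 'M[R]_2).

(** A local ambient formula for [f] at the lift [y]. Only the restriction of [h] to [circleSL2] is
    determined by [f]. *)
Definition represents y f h : Prop :=
  smooth_near (emb y) h /\ \forall y' \near y, f (dn y') = h (emb y').

Lemma cover_smooth_atP y f :
  cover_smooth_at p y (fun y' => f (dn y')) <-> exists h, represents y f h.
Proof. by []. Qed.

Lemma embed_deck (x c : G) (z : set_type (@circle R)) :
  rmul_amb (p c^-1%g) (emb (z, x * c)%g) = emb (z, x).
Proof. by rewrite /rmul_amb /embed /= -(coverM hp) mulgK. Qed.

(** Another lift of the same point differs by right multiplication by an element of [Gamma], which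
    acts on the ambient space by the linear map [rmul_amb]; composing with its inverse transports
    the representative. *)
Lemma represents_deck (x c : G) (z : set_type (@circle R)) f h : c \in Gamma ->
  represents (z, x) f h ->
  represents (z, x * c)%g f (h \o rmul_amb (p c^-1%g)).
Proof.
move=> cG [sh fh]; split.
  by apply: smooth_near_rmul; rewrite embed_deck.
have c1 : (fun y' : cover => y'.1) @ ((z, x * c)%g : cover) --> z by exact: cvg_fst.
have c2 : (fun y' : cover => (y'.2 * c^-1)%g) @ ((z, x * c)%g : cover) --> x.
  rewrite -[X in _ --> X](mulgK c x).
  apply: (@cvg_comp _ _ _ snd (fun x : G => x * c^-1)%g _ (nbhs (x * c)%g)).
    exact: cvg_snd.
  exact: mulgr_continuous.
have nH : \forall y' \near ((z, x * c)%g : cover),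
    f (dn (y'.1, y'.2 * c^-1)%g) = h (emb (y'.1, y'.2 * c^-1)%g).
  exact: (cvg_pair c1 c2 fh).
apply: filterS nH => -[z' x'] /= H.
have -> : dn (z', x') = dn (z', x' * c^-1)%g.
  by rewrite /down /= coset_projM// gpredV.
by rewrite H -[in RHS](mulgVK c x') embed_deck.
Qed.

Lemma down_eqP (y y' : cover) : dn y = dn y' ->
  exists2 c, c \in Gamma & y' = (y.1, y.2 * c)%g.
Proof.
case: y y' => [z x] [z' x'] [<- /coset_projP xx'].
by exists (x^-1 * x')%g; rewrite //= mulVKg.
Qed.

(** Smoothness is required at all lifts of a point; by [represents_deck] a representative at one of
    them yields the others. *)
Lemma smooth_atP y f : smooth_at (dn y) f <-> exists h, represents y f h.
Proof.
split=> [sf|[h rh] z x]; first by case: y sf => z x; apply.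
move=> /(@down_eqP y (z, x))[c cG ->]; apply/cover_smooth_atP.
by case: y rh => z' x' rh; eexists; exact: represents_deck cG rh.
Qed.

Lemma represents_near y f h : represents y f h -> \forall y' \near y, represents y' f h.
Proof.
move=> [/smooth_near_open sh fh].
have sh' : \forall y' \near y, smooth_near (emb y') h := embed_continuous hp sh.
have fh' : \forall y' \near y, \forall y2 \near y', f (dn y2) = h (emb y2).
  exact: nbhs_interior fh.
by near=> y'; split; near: y'.
Unshelve. all: by end_near. Qed.

Lemma eq_represents y f g h : (\forall m \near dn y, f m = g m) ->
  represents y f h -> represents y g h.
Proof.
move=> /near_down fg [sh fh]; split=> //.
by apply: filterS2 fg fh => y' /= <-.
Qed.

Lemma represents2 y f1 f2 h1 h2 (F : R -> R -> R) :
  represents y f1 h1 -> represents y f2 h2 ->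
  smooth_near (emb y) (fun q => F (h1 q) (h2 q)) ->
  represents y (fun m => F (f1 m) (f2 m)) (fun q => F (h1 q) (h2 q)).
Proof.
move=> [_ fh1] [_ fh2] sF; split=> //.
by apply: filterS2 fh1 fh2 => y' -> ->.
Qed.

Lemma representsD y f1 f2 h1 h2 : represents y f1 h1 -> represents y f2 h2 ->
  represents y (fun m => f1 m + f2 m) (fun q => h1 q + h2 q).
Proof.
move=> r1 r2; apply: (@represents2 _ _ _ _ _ (fun a b : R => a + b) r1 r2).
by apply: smooth_nearD; [case: r1|case: r2].
Qed.

Lemma representsM y f1 f2 h1 h2 : represents y f1 h1 -> represents y f2 h2 ->
  represents y (fun m => f1 m * f2 m) (fun q => h1 q * h2 q).
Proof.
move=> r1 r2; apply: (@represents2 _ _ _ _ _ (fun a b : R => a * b) r1 r2).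
by apply: smooth_nearM; [case: r1|case: r2].
Qed.

Lemma represents_cst y (k : R) : represents y (fun=> k) (fun=> k).
Proof. by split; [exact: smooth_near_cst|near=> y']. Unshelve. all: by end_near. Qed.

Lemma represents_exists y h : smooth_near (emb y) h -> exists f, represents y f h.
Proof. by move=> sh; have [f fh] := embed_extend p hdisc y h; exists f. Qed.

(** This makes [frame] well defined. By [frame_vec_rmul] the derivative can be transported to the
    lift [y']; there the two representatives agree only on [circleSL2], which suffices by
    [derive_frame_vec_eq]. *)
Lemma represents_derive y y' f h h' a : dn y = dn y' ->
  represents y f h -> represents y' f h' ->
  'D_(frame_vec a (emb y)) h (emb y) = 'D_(frame_vec a (emb y')) h' (emb y').
Proof.
move=> /down_eqP[c cG ->]; case: y => z x /= rh rh'.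
have [sh1 fh1] := represents_deck cG rh.
transitivity ('D_(frame_vec a (emb (z, x * c)%g)) (h \o rmul_amb (p c^-1%g))
    (emb (z, x * c)%g)).
  by rewrite derive_rmul -frame_vec_rmul embed_deck.
apply: derive_frame_vec_eq => //; [exact: embed_circleSL2|by case: rh'|].
have [_ fh'] := rh'.
have fh1h' : \forall y2 \near ((z, x * c)%g : cover),
    (h \o rmul_amb (p c^-1%g)) (emb y2) = h' (emb y2).
  near=> y2.
  have <- : f (dn y2) = (h \o rmul_amb (p c^-1%g)) (emb y2) by near: y2.
  by near: y2.
have := near_embed hp fh1h'; apply: filterS => q' H Nq'.
by have [y2 <- ->] := H Nq'.
Unshelve. all: by end_near. Qed.

(* The vector field on [M] induced by the right-invariant vector field [a] (locked,
   because comparing two frame fields by unfolding is intractable). *)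
Definition frame : 'M[R]_2 -> field (S := M) := locked_with frame_key (fun a m f =>
  if `[< smooth_at m f >]
  then xget 0 [set r | exists y h, [/\ dn y = m, represents y f h &
         r = 'D_(frame_vec a (emb y)) h (emb y)]]
  else 0).

Lemma frame_out a m f : ~ smooth_at m f -> frame a m f = 0.
Proof. by move=> nf; rewrite /frame locked_withE asboolF. Qed.

Lemma frameE y f h a : represents y f h ->
  frame a (dn y) f = 'D_(frame_vec a (emb y)) h (emb y).
Proof.
move=> rh; rewrite /frame locked_withE asboolT; last by apply/smooth_atP; exists h.
case: xgetP => [r _ [y' [h' [yy' rh' ->]]]|/(_ ('D_(frame_vec a (emb y)) h (emb y)))[]].
  exact: (represents_derive a yy' rh' rh).
by exists y, h; split.
Qed.

Lemma represents_frame y f h a : represents y f h ->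
  represents y (fun m => frame a m f) (fun q => 'D_(frame_vec a q) h q).
Proof.
move=> rh; split; first by apply: smooth_near_frame_vec; case: rh.
by apply: filterS (represents_near rh) => y' /frameE ->.
Qed.

End Frame.

(** * Frame vectors as a basis of the tangent spaces of the circle times SL(2) *)

Section FrameCoefficients.
Context {R : realType}.
Local Notation ambient := (@ambient R).
Local Notation idx := amb_index.
Local Notation cz i := (inl i : idx).
Local Notation cm i j := (inr (i, j) : idx).

Lemma derive_linear_comb (V : normedModType R) (f g : V -> R) (q v : V) (k : R) :
  derivable f q v -> derivable g q v ->
  'D_v (fun x => k * f x + g x) q = k * 'D_v f q + 'D_v g q.
Proof.
move=> df dg; have -> : (fun x => k * f x + g x) = k \*: f + g by [].
by rewrite (deriveD (derivableZ (k := k) df) dg) (deriveZ k df).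
Qed.

Lemma derive_mul (V : normedModType R) (f g : V -> R) (q v : V) :
  derivable f q v -> derivable g q v ->
  'D_v (fun x => f x * g x) q = 'D_v f q * g q + f q * 'D_v g q.
Proof.
move=> df dg; have -> : (fun x => f x * g x) = f * g by [].
by rewrite (deriveM df dg) addrC; congr (_ + _); exact: mulrC.
Qed.

Lemma derive_linear (V : normedModType R) (l : {linear V -> R}) (q v : V) :
  continuous l -> 'D_v l q = l v.
Proof.
move=> cl; have dl : differentiable l q by exact: linear_differentiable.
by rewrite (deriveE v dl) diff_lin.
Qed.

Lemma derive_amb_lin i (q v : ambient) : 'D_v (amb_lin i) q = amb_lin i v.
Proof.
exact: (derive_linear _ _ (@amb_lin_continuous R i)).
Qed.

Lemma amb_lin_sum (s : amb_index -> R) i :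
  amb_lin i (\sum_j s j *: amb_basis j) = s i.
Proof.
have E j : amb_lin i (amb_basis j : ambient) = (i == j)%:R.
  case: i j => [i|[i k]] [j|[j l]]; rewrite /amb_lin /= /amb_coord /= !mxE //.
have EZ j : amb_lin i (s j *: amb_basis j) = s j * amb_lin i (amb_basis j).
  by rewrite linearZ.
have -> : amb_lin i (\sum_j s j *: amb_basis j) = \sum_j s j * (i == j)%:R.
  by rewrite linear_sum; apply: eq_bigr => j _; rewrite EZ E.
rewrite (bigD1 i)// eqxx mulr1 big1 /=; first by rewrite addr0.
by move=> j /negPf ji; rewrite eq_sym ji mulr0.
Qed.

(* For [q = (z, P)] and [w = (w1, w2)] with coordinates [s] and [t], this is
   [tau%:M + w2 *m \adj P], where [tau] is the component of [w1] along [z *m rot_mx]. *)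
Definition frame_coef (s t : amb_index -> R) : 'M[R]_2 :=
  let tau := t (cz 1) * s (cz 0) - t (cz 0) * s (cz 1) in
  \matrix_(i, j)
    if i == 0 then
      if j == 0 then tau + (t (cm 0 0) * s (cm 1 1) - t (cm 0 1) * s (cm 1 0))
      else t (cm 0 1) * s (cm 0 0) - t (cm 0 0) * s (cm 0 1)
    else
      if j == 0 then t (cm 1 0) * s (cm 1 1) - t (cm 1 1) * s (cm 1 0)
      else tau + (t (cm 1 1) * s (cm 0 0) - t (cm 1 0) * s (cm 0 1)).

Lemma ord2P (P : 'I_2 -> Prop) : P 0 -> P 1 -> forall i, P i.
Proof.
move=> P0 P1 [[|[|//]] i]; first by rewrite (_ : Ordinal i = 0)//; exact/val_inj.
by rewrite (_ : Ordinal i = 1)//; exact/val_inj.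
Qed.

Lemma mx2P (A B : 'M[R]_2) : A 0 0 = B 0 0 -> A 0 1 = B 0 1 ->
  A 1 0 = B 1 0 -> A 1 1 = B 1 1 -> A = B.
Proof. by move=> *; apply/matrixP; do 2 elim/ord2P. Qed.

Lemma sum2 (F : 'I_2 -> R) : \sum_i F i = F 0 + F 1.
Proof.
by rewrite !big_ord_recl big_ord0 addr0; congr (_ + F _); exact/val_inj.
Qed.

Lemma mul2 m n (A : 'M[R]_(m, 2)) (B : 'M[R]_(2, n)) i j :
  (A *m B) i j = A i 0 * B 0 j + A i 1 * B 1 j.
Proof. by rewrite mxE sum2. Qed.

Lemma frame_vecE a (q : ambient) (i : amb_index) :
  amb_lin i (frame_vec a q) =
  match i with
  | inl j => (\tr a / 2) * (if j == 0 then - q.1 0 1 else q.1 0 0)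
  | inr kl => a kl.1 0 * q.2 0 kl.2 + a kl.1 1 * q.2 1 kl.2 -
              (\tr a / 2) * q.2 kl.1 kl.2
  end.
Proof.
case: i => [j|[k l]].
  rewrite /amb_lin /= /amb_coord /= mxE mul2 !mxE; congr (_ * _).
  by elim/ord2P: j; rewrite /= ?mulr1 ?mulr0 ?addr0 ?add0r ?mulrN1.
rewrite /amb_lin /= /amb_coord /= mul2 !mxE.
by elim/ord2P: k; rewrite /= ?mulr1n ?mulr0n; ring.
Qed.

Lemma circleE (z : 'rV[R]_2) : circle z <-> z 0 0 * z 0 0 + z 0 1 * z 0 1 = 1.
Proof.
rewrite -!expr2 (_ : 1 = ord_max :> 'I_2); last exact/val_inj.
exact: iff_refl.
Qed.

Lemma circleSL2E (q : ambient) : circleSL2 q ->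
  q.1 0 0 * q.1 0 0 + q.1 0 1 * q.1 0 1 = 1 /\
  q.2 0 0 * q.2 1 1 - q.2 0 1 * q.2 1 0 = 1.
Proof.
by move=> [/circleE cq sq]; split=> //; rewrite -det2; exact: sq.
Qed.

(** The circle component returns [tau = \tr a / 2], because [z] is a unit vector, and the other one
    returns [(a - tau) *m P *m \adj P = a - tau], because [\det P = 1]. *)
Lemma frame_coefK a (q : ambient) : circleSL2 q ->
  frame_coef (fun i => amb_lin i q) (fun i => amb_lin i (frame_vec a q)) = a.
Proof.
move=> /circleSL2E[cq sq].
have E i : amb_lin i q = match i with inl j => q.1 0 j | inr kl => q.2 kl.1 kl.2 end.
  by case: i.
apply: mx2P; rewrite /frame_coef mxE !frame_vecE !E /= tr2;
  move: cq sq; move: (q.1 0 0) (q.1 0 1) (q.2 0 0) (q.2 0 1) (q.2 1 0) (q.2 1 1);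
  move: (a 0 0) (a 0 1) (a 1 0) (a 1 1) => a1 b c d z0 z1 p q' r s cq sq.
- transitivity ((a1 + d) / 2 * (z0 * z0 + z1 * z1) + (a1 - (a1 + d) / 2) * (p * s - q' * r)).
    by ring.
  by rewrite cq sq; ring.
- transitivity (b * (p * s - q' * r)); first by ring.
  by rewrite sq mulr1.
- transitivity (c * (p * s - q' * r)); first by ring.
  by rewrite sq mulr1.
- transitivity ((a1 + d) / 2 * (z0 * z0 + z1 * z1) + (d - (a1 + d) / 2) * (p * s - q' * r)).
    by ring.
  by rewrite cq sq; ring.
Qed.

Lemma frame_vec_inj (q : ambient) : circleSL2 q -> injective (frame_vec^~ q).
Proof.
move=> Nq a b ab; rewrite -(frame_coefK a Nq) -(frame_coefK b Nq).
by rewrite /= in ab; rewrite ab.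
Qed.

Definition circle_eq (q : ambient) : R :=
  amb_lin (cz 0) q * amb_lin (cz 0) q + amb_lin (cz 1) q * amb_lin (cz 1) q.

(** The determinant, written in the shape [k * f x + g x] of [derive_linear_comb]. *)
Definition SL2_eq (q : ambient) : R :=
  -1 * (amb_lin (cm 0 1) q * amb_lin (cm 1 0) q) +
  amb_lin (cm 0 0) q * amb_lin (cm 1 1) q.

Lemma smooth_amb_lin i (q : ambient) : smooth_near q (amb_lin i).
Proof. by apply: smooth_near_linear; exact: amb_lin_continuous. Qed.

Lemma smooth_circle_eq (q : ambient) : smooth_near q circle_eq.
Proof. by apply: smooth_nearD; apply: smooth_nearM; exact: smooth_amb_lin. Qed.

Lemma smooth_SL2_eq (q : ambient) : smooth_near q SL2_eq.
Proof.
apply: smooth_nearD; last by apply: smooth_nearM; exact: smooth_amb_lin.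
apply: smooth_nearM; first exact: smooth_near_cst.
by apply: smooth_nearM; exact: smooth_amb_lin.
Qed.

Lemma circleSL2_eq (q : ambient) : circleSL2 q -> circle_eq q = 1 /\ SL2_eq q = 1.
Proof.
by move=> /circleSL2E[cq sq]; split; [exact: cq|rewrite /SL2_eq mulN1r addrC; exact: sq].
Qed.

(** The entries are those of [P = (p, u; r, s)] and [w2 = (a, b; c, d)]. A vector orthogonal to [z]
    is [tau] times its rotation, and the linearized determinant equation says that [w2 *m \adj P] is
    traceless; so half the trace of the candidate matrix is [tau], and multiplying back by [P]
    recovers [w2]. *)
Lemma frame_vec_surj_coords (z0 z1 p u r s w0 w1 a b c d : R) :
  z0 * z0 + z1 * z1 = 1 -> p * s - u * r = 1 ->
  w0 * z0 + w1 * z1 = 0 -> a * s + p * d - (b * r + u * c) = 0 ->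
  let tau := w1 * z0 - w0 * z1 in
  let m00 := tau + (a * s - b * r) in
  let m11 := tau + (d * p - c * u) in
  [/\ (m00 + m11) / 2 = tau,
      w0 = tau * - z1 /\ w1 = tau * z0,
      a = m00 * p + (b * p - a * u) * r - tau * p /\
      b = m00 * u + (b * p - a * u) * s - tau * u &
      c = (c * s - d * r) * p + m11 * r - tau * r /\
      d = (c * s - d * r) * u + m11 * s - tau * s].
Proof.
move=> cq sq cw sw tau m00 m11; split; [|split|split|split].
- transitivity (tau + (a * s + p * d - (b * r + u * c)) / 2); last by rewrite sw mul0r addr0.
  by rewrite /m00 /m11; field.
- transitivity (w0 * (z0 * z0 + z1 * z1) - z0 * (w0 * z0 + w1 * z1)).
    by rewrite cq cw mulr0 subr0 mulr1.
  by rewrite /tau; ring.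
- transitivity (w1 * (z0 * z0 + z1 * z1) - z1 * (w0 * z0 + w1 * z1)).
    by rewrite cq cw mulr0 subr0 mulr1.
  by rewrite /tau; ring.
- by rewrite -[LHS]mulr1 -sq /m00; ring.
- by rewrite -[LHS]mulr1 -sq /m00; ring.
- by rewrite -[LHS]mulr1 -sq /m11; ring.
- by rewrite -[LHS]mulr1 -sq /m11; ring.
Qed.

Lemma frame_vec_surj (q w : ambient) : circleSL2 q ->
  'D_w circle_eq q = 0 -> 'D_w SL2_eq q = 0 -> exists a, w = frame_vec a q.
Proof.
move=> Nq.
have d i : derivable (amb_lin i) q w by exact: smooth_near_derivable (smooth_amb_lin i q).
have D i j : 'D_w (fun q => amb_lin i q * amb_lin j q) q =
    amb_lin i w * amb_lin j q + amb_lin i q * amb_lin j w.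
  by rewrite (derive_mul (d i) (d j)) !derive_amb_lin.
have d2 i j : derivable (fun q => amb_lin i q * amb_lin j q) q w.
  by apply: smooth_near_derivable; apply: smooth_nearM; exact: smooth_amb_lin.
have -> : 'D_w circle_eq q = 2 * (w.1 0 0 * q.1 0 0 + w.1 0 1 * q.1 0 1).
  have -> : circle_eq = fun q => 1 * (amb_lin (cz 0) q * amb_lin (cz 0) q) +
      amb_lin (cz 1) q * amb_lin (cz 1) q.
    by apply/funext => q'; rewrite mul1r.
  rewrite (derive_linear_comb _ (d2 _ _) (d2 _ _)) !D /amb_lin /amb_coord /=; ring.
have -> : 'D_w SL2_eq q = w.2 0 0 * q.2 1 1 + q.2 0 0 * w.2 1 1 -
    (w.2 0 1 * q.2 1 0 + q.2 0 1 * w.2 1 0).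
  rewrite (derive_linear_comb _ (d2 _ _) (d2 _ _)) !D /amb_lin /amb_coord /=; ring.
have [cq sq] := circleSL2E Nq.
move=> /eqP; rewrite mulf_eq0 pnatr_eq0 /= => /eqP cw sw.
exists (frame_coef (fun i => amb_lin i q) (fun i => amb_lin i w)).
set a := frame_coef _ _.
have [E0 [E1 E2] [E3 E4] [E5 E6]] /= := frame_vec_surj_coords cq sq cw sw.
have H i : amb_lin i w = amb_lin i (frame_vec a q).
  rewrite frame_vecE tr2 /a /frame_coef !mxE /= /amb_lin /amb_coord /= E0.
  by case: i => [j|[k l]] /=;
    [elim/ord2P: j|elim/ord2P: k; elim/ord2P: l; rewrite !mxE /=].
by rewrite (ambientE w) (ambientE (frame_vec a q)); apply: eq_bigr => i _; rewrite H.
Qed.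

End FrameCoefficients.

(** * Tangent vectors *)

Section SmoothSpace.
Context {R : realType} {S : smoothSpace R}.
Implicit Types (x : S) (f g : S -> R) (v : @preTangent R S).

(** A [smoothSpace] carries an arbitrary predicate [smooth_at]; these are the closure properties on
    which the tensor calculus below relies. *)
Definition smooth_calculus : Prop :=
  [/\ forall x f g, smooth_at x f -> (\forall y \near x, f y = g y) -> smooth_at x g,
      forall x f, smooth_at x f -> \forall y \near x, smooth_at y f,
      forall x (k : R), smooth_at x (fun _ : S => k),
      forall x f g, smooth_at x f -> smooth_at x g -> smooth_at x (fun y => f y + g y) &
      forall x f g, smooth_at x f -> smooth_at x g -> smooth_at x (fun y => f y * g y)].

Hypothesis SC : smooth_calculus.

Lemma eq_smooth_at x f g : (\forall y \near x, f y = g y) -> smooth_at x f -> smooth_at x g.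
Proof. by case: SC => H _ _ _ _ fg sf; exact: H sf fg. Qed.

Lemma smooth_at_near x f : smooth_at x f -> \forall y \near x, smooth_at y f.
Proof. by case: SC => _ H _ _ _; exact: H. Qed.

Lemma smooth_at_cst x (k : R) : smooth_at x (fun _ : S => k).
Proof. by case: SC. Qed.

Lemma smooth_atD x f g : smooth_at x f -> smooth_at x g -> smooth_at x (fun y => f y + g y).
Proof. by case: SC => _ _ _ H _; exact: H. Qed.

Lemma smooth_atM x f g : smooth_at x f -> smooth_at x g -> smooth_at x (fun y => f y * g y).
Proof. by case: SC => _ _ _ _ H; exact: H. Qed.

Lemma smooth_atN x f : smooth_at x f -> smooth_at x (fun y => - f y).
Proof.
move=> sf; apply: (eq_smooth_at _ (smooth_atM (smooth_at_cst x (-1)) sf)).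
by near=> y; rewrite mulN1r.
Unshelve. all: by end_near. Qed.

Lemma smooth_atB x f g : smooth_at x f -> smooth_at x g -> smooth_at x (fun y => f y - g y).
Proof. by move=> sf sg; apply: smooth_atD => //; exact: smooth_atN. Qed.

Lemma smooth_at_sum (I : Type) (r : seq I) x (F : I -> S -> R) :
  (forall i, smooth_at x (F i)) -> smooth_at x (fun y => \sum_(i <- r) F i y).
Proof.
move=> sF; elim: r => [|i r IH].
  by apply: (eq_smooth_at _ (smooth_at_cst x 0)); near=> y; rewrite big_nil.
by apply: (eq_smooth_at _ (smooth_atD (sF i) IH)); near=> y; rewrite big_cons.
Unshelve. all: by end_near. Qed.

Lemma tangent_cst x v (k : R) : tangent x v -> v (fun=> k) = 0.
Proof.
move=> tv; have s1 := smooth_at_cst x 1.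
have v1 : v (fun=> 1) = 0.
  have E : v (fun=> 1) = v (fun=> 1) * 1 + 1 * v (fun=> 1).
    rewrite -(tangent_leibniz tv s1 s1); congr v.
    by apply/funext => y; rewrite mulr1.
  by move: E; rewrite mulr1 mul1r; lra.
have s0 := smooth_at_cst x 0.
have v0 : v (fun=> 0) = 0.
  have E : v (fun=> 0) = v (fun=> 0) * 0 + 0 * v (fun=> 0).
    rewrite -(tangent_leibniz tv s0 s0); congr v.
    by apply/funext => y; rewrite mulr0.
  by rewrite E mulr0 mul0r addr0.
have E : v (fun=> k) = k * v (fun=> 1) + v (fun=> 0).
  rewrite -(tangent_linear tv k s1 s0); congr v.
  by apply/funext => y; rewrite mulr1 addr0.
by rewrite E v1 v0 mulr0 addr0.
Qed.

Lemma tangentD x v f g : tangent x v -> smooth_at x f -> smooth_at x g ->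
  v (fun y => f y + g y) = v f + v g.
Proof.
move=> tv sf sg; have := tangent_linear tv 1 sf sg; rewrite mul1r => <-.
by congr v; apply/funext => y; rewrite mul1r.
Qed.

Lemma tangentZ x v (k : R) f : tangent x v -> smooth_at x f ->
  v (fun y => k * f y) = k * v f.
Proof.
move=> tv sf; have := tangent_linear tv k sf (smooth_at_cst x 0).
rewrite (tangent_cst 0 tv) addr0 => <-.
by congr v; apply/funext => y; rewrite addr0.
Qed.

Lemma tangentN x v f : tangent x v -> smooth_at x f -> v (fun y => - f y) = - v f.
Proof.
move=> tv sf; rewrite -mulN1r -(tangentZ (-1) tv sf).
by congr v; apply/funext => y; rewrite mulN1r.
Qed.

Lemma tangentB x v f g : tangent x v -> smooth_at x f -> smooth_at x g ->
  v (fun y => f y - g y) = v f - v g.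
Proof.
by move=> tv sf sg; rewrite (tangentD tv sf (smooth_atN sg)) (tangentN tv sg).
Qed.

Lemma tangent_sum (I : Type) (r : seq I) x v (F : I -> S -> R) : tangent x v ->
  (forall i, smooth_at x (F i)) ->
  v (fun y => \sum_(i <- r) F i y) = \sum_(i <- r) v (F i).
Proof.
move=> tv sF; elim: r => [|i r IH].
  rewrite big_nil -[RHS](tangent_cst 0 tv).
  by congr v; apply/funext => y; rewrite big_nil.
rewrite big_cons -IH -(tangentD tv (sF i) (smooth_at_sum r sF)).
by congr v; apply/funext => y; rewrite big_cons.
Qed.

Lemma tangent_comb x v w (k : R) : tangent x v -> tangent x w -> tangent x (k *: v + w).
Proof.
move=> tv tw; have E f : (k *: v + w) f = k * v f + w f by [].
split.
- move=> f h sf sh fh; rewrite !E.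
  by rewrite (tangent_local tv sf sh fh) (tangent_local tw sf sh fh).
- move=> a f h sf sh; rewrite !E.
  by rewrite (tangent_linear tv a sf sh) (tangent_linear tw a sf sh); ring.
- move=> f h sf sh; rewrite !E.
  by rewrite (tangent_leibniz tv sf sh) (tangent_leibniz tw sf sh); ring.
- move=> f nf; rewrite !E.
  by rewrite (tangent_out tv nf) (tangent_out tw nf) mulr0 addr0.
Qed.

End SmoothSpace.

(** * The fields [frame a] trivialize the tangent bundle *)

Section Frame.
Context {R : realType} {G : topGroupType} (p : G -> 'M[R]_2).
Hypothesis hp : universal_cover_SL2 p.
Context (Gamma : groupClosed G).
Hypothesis hdisc : discrete_subgroup Gamma.

Local Notation M := (kodaira_thurston p Gamma).
Local Notation cover := (set_type (@circle R) * G)%type.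
Local Notation ambient := (@ambient R).
Local Notation dn := (@down R G p Gamma).
Local Notation emb := (@embed R G p).
Local Notation frame := (@frame R G p Gamma).
Implicit Types (y : cover) (m : M) (f g : M -> R) (h : ambient -> R) (a b : 'M[R]_2).

Lemma smooth_calculus_KT : smooth_calculus (S := M).
Proof.
split.
- move=> m f g; have [y ->] := down_surj m.
  move=> /(smooth_atP hp)[h rh] fg; apply/(smooth_atP hp); exists h.
  exact: eq_represents fg rh.
- move=> m f; have [y ->] := down_surj m => /(smooth_atP hp)[h rh].
  apply/near_down; apply: filterS (represents_near hp rh) => y' rh'.
  by apply/(smooth_atP hp); exists h.
- move=> m k; have [y ->] := down_surj m; apply/(smooth_atP hp).
  by exists (fun=> k); exact: represents_cst.
- move=> m f g; have [y ->] := down_surj m.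
  move=> /(smooth_atP hp)[h rh] /(smooth_atP hp)[k rk]; apply/(smooth_atP hp).
  by exists (fun q => h q + k q); exact: representsD.
- move=> m f g; have [y ->] := down_surj m.
  move=> /(smooth_atP hp)[h rh] /(smooth_atP hp)[k rk]; apply/(smooth_atP hp).
  by exists (fun q => h q * k q); exact: representsM.
Qed.
Let SC := smooth_calculus_KT.

Lemma frame_smooth a m f : smooth_at m f -> smooth_at m (fun m' => frame a m' f).
Proof.
have [y ->] := down_surj m; move=> /(smooth_atP hp)[h rh]; apply/(smooth_atP hp).
by exists (fun q => 'D_(frame_vec a q) h q); exact: represents_frame.
Qed.

Lemma frame_tangent a m : tangent m (frame a m).
Proof.
have [y ->] := down_surj m; split.
- move=> f g /(smooth_atP hp)[h rh] _ fg; have rg := eq_represents fg rh.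
  by rewrite (frameE hp a rh) (frameE hp a rg).
- move=> k f g /(smooth_atP hp)[h rh] /(smooth_atP hp)[h' rh'].
  rewrite (frameE hp a (representsD (representsM (represents_cst p Gamma y k) rh) rh')).
  rewrite (frameE hp a rh) (frameE hp a rh') derive_linear_comb//;
    apply: smooth_near_derivable; [by case: rh|by case: rh'].
- move=> f g /(smooth_atP hp)[h rh] /(smooth_atP hp)[h' rh'].
  rewrite (frameE hp a (representsM rh rh')) (frameE hp a rh) (frameE hp a rh').
  rewrite derive_mul; [|by apply: smooth_near_derivable; case: rh|
    by apply: smooth_near_derivable; case: rh'].
  have [_ /nbhs_singleton ->] := rh; have [_ /nbhs_singleton ->] := rh'.
  by [].
- by move=> f; exact: frame_out.
Qed.

Lemma frameP k a b m : frame (k *: a + b) m = k *: frame a m + frame b m.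
Proof.
apply/funext => f; have E : (k *: frame a m + frame b m) f = k * frame a m f + frame b m f by [].
rewrite E; have [sf|nf] := pselect (smooth_at m f); last by rewrite !frame_out// mulr0 addr0.
move: sf; have [y ->] := down_surj m; move=> /(smooth_atP hp)[h rh].
by rewrite !(frameE hp _ rh) frame_vecP derive_ambientP//; case: rh.
Qed.

Lemma frame_coord a y f i : represents y f (amb_lin i) ->
  frame a (dn y) f = amb_lin i (frame_vec a (emb y)).
Proof. by move=> /(frameE hp) ->; exact: derive_amb_lin. Qed.

Lemma coord_functions y : exists f : amb_index -> M -> R,
  forall i, represents y (f i) (amb_lin i).
Proof.
have H i : exists f, represents y f (amb_lin i).
  by apply: represents_exists => //; exact: smooth_amb_lin.
by have [f fP] := choice H; exists f.
Qed.

Lemma frame_inj m : injective (frame^~ m).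
Proof.
move=> a b /= ab; move: ab; have [y ->] := down_surj m => ab.
have [f fP] := coord_functions y.
apply: (frame_vec_inj (embed_circleSL2 hp y)); rewrite /=.
rewrite (ambientE (frame_vec a _)) (ambientE (frame_vec b _)).
by apply: eq_bigr => i _; rewrite -!(frame_coord _ (fP i)) ab.
Qed.

(* By Hadamard's lemma, [v] is determined by its values on the ambient coordinates. *)
Lemma tangent_derive y v : tangent (dn y) v ->
  exists w : ambient, forall f h, represents y f h -> v f = 'D_w h (emb y).
Proof.
move=> tv; have [c cP] := coord_functions y.
have sc i : smooth_at (dn y) (c i) by apply/(smooth_atP hp); exists (amb_lin i).
(* The only possible [w]: its coordinates are the values of [v] on the coordinate functions. *)
exists (\sum_i v (c i) *: amb_basis i) => f h rh.
have sf : smooth_at (dn y) f by apply/(smooth_atP hp); exists h.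
have [[A [oA Ay CA]] _] := rh.
have [B [H [[oB By BA] [CH HD hE]]]] := 
  @hadamard R ambient _ (@amb_basis R) (@amb_lin R) A (emb y) h (@ambientE R) oA Ay CA.
have sH i : smooth_near (emb y) (H i) by exists B; split=> // k; exact: CH.
have [g gP] : exists g : amb_index -> M -> R, forall i, represents y (g i) (H i).
  have [g gP] := choice (fun i => represents_exists hdisc (sH i)).
  by exists g.
have sg i : smooth_at (dn y) (g i) by apply/(smooth_atP hp); exists (H i).
(* The Hadamard expansion of [h] carried over to the surface; it agrees with [f] near [dn y] only,
   which is enough for a derivation. *)
pose F m := h (emb y) + \sum_i (c i m - amb_lin i (emb y)) * g i m.
have sci i : smooth_at (dn y) (fun m => c i m - amb_lin i (emb y)).
  by apply: (smooth_atB SC) => //; exact: (smooth_at_cst SC).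
have scg i : smooth_at (dn y) (fun m => (c i m - amb_lin i (emb y)) * g i m).
  exact: (smooth_atM SC (sci i) (sg i)).
have sum_s : smooth_at (dn y) (fun m => \sum_i (c i m - amb_lin i (emb y)) * g i m).
  exact: (smooth_at_sum SC _ scg).
have c0 := smooth_at_cst SC (dn y) (h (emb y)).
have sF : smooth_at (dn y) F by exact: (smooth_atD SC c0 sum_s).
have -> : v f = v F.
  apply: (tangent_local tv) => //; apply/near_down.
  have nB : \forall y' \near y, B (emb y').
    exact: (embed_continuous hp (open_nbhs_nbhs (conj oB By))).
  have nc : \forall y' \near y, forall i, c i (dn y') = amb_lin i (emb y').
    by apply: (@filter_forall _ _ (fun i y' => c i (dn y') = amb_lin i (emb y')) (nbhs y)) => i; case: (cP i).
  have ng : \forall y' \near y, forall i, g i (dn y') = H i (emb y').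
    by apply: (@filter_forall _ _ (fun i y' => g i (dn y') = H i (emb y')) (nbhs y)) => i; case: (gP i).
  have nf : \forall y' \near y, f (dn y') = h (emb y') by case: rh.
  near=> y'.
  have -> : f (dn y') = h (emb y') by near: y'.
  have By' : B (emb y') by near: y'.
  have cE : forall i, c i (dn y') = amb_lin i (emb y') by near: y'.
  have gE : forall i, g i (dn y') = H i (emb y') by near: y'.
  rewrite (hE _ By') /F; congr (_ + _).
  by apply: eq_bigr => i _; rewrite cE gE.
rewrite /F (tangentD tv c0 sum_s) (tangent_cst SC _ tv) add0r.
rewrite (tangent_sum SC _ tv scg) (derive_ambientE _ oA Ay (CA 1%N)).
(* The first factor vanishes at the point, so Leibniz leaves [v (c i)] times the value of [g i], a
   partial derivative of [h]. *)
apply: eq_bigr => i _; rewrite (tangent_leibniz tv (sci i) (sg i)).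
have -> : c i (dn y) = amb_lin i (emb y) by have [_ /nbhs_singleton] := cP i.
rewrite subrr mul0r addr0 (tangentB SC tv (sc i) (smooth_at_cst SC _ _)).
rewrite (tangent_cst SC _ tv) subr0.
have -> : g i (dn y) = 'D_(amb_basis i) h (emb y).
  by have [_ /nbhs_singleton ->] := gP i; exact: HD.
by rewrite (amb_lin_sum (fun j => v (c j))).
Unshelve. all: by end_near. Qed.

(** On [circleSL2] the functions [circle_eq] and [SL2_eq] are equal to 1, so they represent a
    constant, which [v] annihilates. Hence the ambient vector [w] satisfies both linearized
    equations and is a frame vector. *)
Lemma tangent_frame m v : tangent m v -> exists a, v = frame a m.
Proof.
have [y ->] := down_surj m => tv; have [w wP] := tangent_derive tv.
have cst h : smooth_near (emb y) h -> (forall q, circleSL2 q -> h q = 1) ->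
    'D_w h (emb y) = 0.
  move=> sh h1; rewrite -(wP (fun=> 1)); first exact: (tangent_cst SC 1 tv).
  by split=> //; near=> y'; rewrite h1//; exact: embed_circleSL2.
have c0 : 'D_w (@circle_eq R) (emb y) = 0.
  by apply: cst; [exact: smooth_circle_eq|move=> q /circleSL2_eq[]].
have s0 : 'D_w (@SL2_eq R) (emb y) = 0.
  by apply: cst; [exact: smooth_SL2_eq|move=> q /circleSL2_eq[]].
have [a wE] := frame_vec_surj (embed_circleSL2 hp y) c0 s0.
exists a; apply/funext => f; have [sf|nf] := pselect (smooth_at (dn y) f); last first.
  by rewrite (tangent_out tv nf) frame_out.
move: sf => /(smooth_atP hp)[h rh].
by rewrite (wP f h rh) (frameE hp a rh) wE.
Unshelve. all: by end_near. Qed.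

Definition coef : M -> preTangent -> 'M[R]_2 :=
  locked_with frame_key (fun m v => xget 0 [set a | v = frame a m]).

Lemma coefK m v : tangent m v -> frame (coef m v) m = v.
Proof.
move=> /tangent_frame[a va]; rewrite /coef locked_withE.
by case: xgetP => [b _ <-//|/(_ a)[]].
Qed.

Lemma frameK a m : coef m (frame a m) = a.
Proof. by apply: (@frame_inj m); apply: coefK; exact: frame_tangent. Qed.

Lemma coefP k m v w : tangent m v -> tangent m w ->
  coef m (k *: v + w) = k *: coef m v + coef m w.
Proof. by move=> tv tw; rewrite -{1}(coefK tv) -{1}(coefK tw) -frameP frameK. Qed.

(** Coefficients are polynomials in the coordinates and in the values of [v] on them; this is why a
    smooth field has smooth coefficients. *)
Lemma coef_coordE y (c : amb_index -> M -> R) v :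
  (forall i, represents y (c i) (amb_lin i)) -> tangent (dn y) v ->
  coef (dn y) v = frame_coef (c^~ (dn y)) (fun i => v (c i)).
Proof.
move=> cP tv; rewrite -{2}(coefK tv).
rewrite -[LHS](frame_coefK _ (embed_circleSL2 hp y)); congr frame_coef.
  by apply/funext => i; have [_ /nbhs_singleton ->] := cP i.
by apply/funext => i; rewrite (frame_coord _ (cP i)).
Qed.

Lemma smooth_frame_coef m (s t : amb_index -> M -> R) i j :
  (forall k, smooth_at m (s k)) -> (forall k, smooth_at m (t k)) ->
  smooth_at m (fun m' => frame_coef (s^~ m') (t^~ m') i j).
Proof.
move=> ss st.
have sM k l : smooth_at m (fun m' => t k m' * s l m') by exact: (smooth_atM SC).
have sB k l k' l' : smooth_at m (fun m' => t k m' * s l m' - t k' m' * s l' m').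
  exact: (smooth_atB SC (sM _ _) (sM _ _)).
have sD k l k' l' k1 l1 k1' l1' : smooth_at m (fun m' =>
    (t k m' * s l m' - t k' m' * s l' m') + (t k1 m' * s l1 m' - t k1' m' * s l1' m')).
  exact: (smooth_atD SC (sB _ _ _ _) (sB _ _ _ _)).
under eq_fun do rewrite mxE.
by case: (i == 0); case: (j == 0); [exact: sD|exact: sB|exact: sB|exact: sD].
Qed.

Lemma coef_smooth V X i j : open V -> vector_field V X ->
  smooth_on V (fun m => coef m (X m) i j).
Proof.
move=> oV VX m; have [y ->] := down_surj m => Vy.
have [c cP] := coord_functions y.
have sc k : smooth_at (dn y) (c k) by apply/(smooth_atP hp); exists (amb_lin k).
have sX k : smooth_at (dn y) (fun m' => X m' (c k)) by apply: (VX _ Vy).2.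
apply: (eq_smooth_at SC _ (smooth_frame_coef i j sc sX)).
apply/near_down.
have nV : \forall y' \near y, V (dn y').
  by apply/near_down; exact: (open_nbhs_nbhs (conj oV Vy)).
(* The same functions [c k] must serve as coordinates at all nearby points, so that the formula for
   [coef] holds near [y]. *)
have nc : \forall y' \near y, forall k, represents y' (c k) (amb_lin k).
  by apply: (@filter_forall _ _ (fun k y' => represents y' (c k) (amb_lin k)) (nbhs y))
    => k; exact: (represents_near hp (cP k)).
near=> y'; have Vy' : V (dn y') by near: y'.
have ny' : forall k, represents y' (c k) (amb_lin k) by near: y'.
by rewrite (coef_coordE ny' (VX _ Vy').1).
Unshelve. all: by end_near. Qed.

Definition smooth_mx V (A : M -> 'M[R]_2) := forall i j, smooth_on V (fun m => A m i j).

Lemma frameZ (k : R) a m : frame (k *: a) m = k *: frame a m.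
Proof.
have f0 : frame 0 m = 0.
  by have := frameP (-1) 0 0 m; rewrite scaler0 addr0 scaleN1r addNr.
by have := frameP k a 0 m; rewrite f0 !addr0.
Qed.

Lemma frameD a b m : frame (a + b) m = frame a m + frame b m.
Proof. by have := frameP 1 a b m; rewrite !scale1r. Qed.

Lemma frame_entries a m f : frame a m f =
  a 0 0 * frame (delta_mx 0 0) m f + a 0 1 * frame (delta_mx 0 1) m f +
  a 1 0 * frame (delta_mx 1 0) m f + a 1 1 * frame (delta_mx 1 1) m f.
Proof.
have aE : a = a 0 0 *: delta_mx 0 0 + a 0 1 *: delta_mx 0 1 +
              a 1 0 *: delta_mx 1 0 + a 1 1 *: delta_mx 1 1.
  by apply: mx2P; rewrite !mxE /= ?mulr1 ?mulr0 ?addr0 ?add0r.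
by rewrite {1}aE !frameD !frameZ.
Qed.

Lemma vector_field_frame V (A : M -> 'M[R]_2) : smooth_mx V A ->
  vector_field V (fun m => frame (A m) m).
Proof.
move=> sA m Vm; split=> [|f sf]; first exact: frame_tangent.
under eq_fun do rewrite frame_entries.
have sE i j : smooth_at m (fun m' => A m' i j * frame (delta_mx i j) m' f).
  exact: (smooth_atM SC (sA i j m Vm) (frame_smooth _ sf)).
exact: (smooth_atD SC (smooth_atD SC (smooth_atD SC (sE 0 0) (sE 0 1)) (sE 1 0)) (sE 1 1)).
Qed.

End Frame.

(** * Torsion-free connections *)

Section Geometry.
Context {R : realType} {S : smoothSpace R}.
Hypothesis SC : @smooth_calculus R S.
Local Notation preTangent := (@preTangent R S).
Local Notation field := (@field R S).
Implicit Types (x : S) (f : S -> R) (v w : preTangent) (X Y Z : field) (U V : set S).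
Implicit Types (J : endo S) (g : bilinear_field S) (nabla : preConnection S).

Lemma tangentBr x v w : tangent x v -> tangent x w -> tangent x (v - w).
Proof.
by move=> tv tw; rewrite addrC -scaleN1r; exact: tangent_comb.
Qed.

Lemma tangentDr x v w : tangent x v -> tangent x w -> tangent x (v + w).
Proof. by move=> tv tw; rewrite -[v]scale1r; exact: tangent_comb. Qed.

Lemma tangent0 x v : tangent x v -> tangent x (0 : preTangent).
Proof. by move=> tv; rewrite -(subrr v); exact: tangentBr. Qed.

Lemma tangentZr x (k : R) v : tangent x v -> tangent x (k *: v).
Proof. by move=> tv; rewrite -[k *: v]addr0; exact: tangent_comb (tangent0 tv). Qed.

Lemma field_local V X x f h : open V -> V x -> vector_field V X ->
  smooth_at x f -> smooth_at x h -> (\forall y \near x, f y = h y) ->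
  \forall y \near x, X y f = X y h.
Proof.
move=> oV Vx VX sf sh fh.
have nV : \forall y \near x, V y := open_nbhs_nbhs (conj oV Vx).
have nf := smooth_at_near SC sf; have nh := smooth_at_near SC sh.
have nfh : \forall y \near x, \forall z \near y, f z = h z := nbhs_interior fh.
near=> y; apply: (tangent_local (VX y _).1); near: y => //.
Unshelve. all: by end_near. Qed.

(** The product rule for the bracket holds because the cross terms of [X (Y (f h))] are symmetric in
    [X] and [Y] and cancel in the difference. *)
Lemma tangent_bracket V X Y x : open V -> V x -> vector_field V X ->
  vector_field V Y -> tangent x (bracket X Y x).
Proof.
move=> oV Vx VX VY.
have bE f : smooth_at x f -> bracket X Y x f =
    X x (fun y => Y y f) - Y x (fun y => X y f).
  by move=> sf; rewrite /bracket asboolT.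
have [tX sX] := VX x Vx; have [tY sY] := VY x Vx.
have nV : \forall y \near x, V y := open_nbhs_nbhs (conj oV Vx).
split.
- move=> f h sf sh fh; rewrite !bE//.
  rewrite (tangent_local tX (sY _ sf) (sY _ sh) (field_local oV Vx VY sf sh fh)).
  by rewrite (tangent_local tY (sX _ sf) (sX _ sh) (field_local oV Vx VX sf sh fh)).
- move=> a f h sf sh.
  have saf : smooth_at x (fun y => a * f y) by exact: (smooth_atM SC (smooth_at_cst SC _ _)).
  have sfh : smooth_at x (fun y => a * f y + h y) by exact: (smooth_atD SC saf).
  have lin (W W' : field) : vector_field V W -> vector_field V W' ->
      W x (fun y => W' y (fun z => a * f z + h z)) =
      a * W x (fun y => W' y f) + W x (fun y => W' y h).
    move=> VW VW'; have [tW _] := VW x Vx; have [_ sW'] := VW' x Vx.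
    rewrite -(tangent_linear tW a (sW' _ sf) (sW' _ sh)).
    apply: (tangent_local tW); first exact: sW'.
      exact: (smooth_atD SC (smooth_atM SC (smooth_at_cst SC _ _) (sW' _ sf)) (sW' _ sh)).
    have nf := smooth_at_near SC sf; have nh := smooth_at_near SC sh.
    near=> y; have Vy : V y by near: y.
    have sfy : smooth_at y f by near: y.
    have shy : smooth_at y h by near: y.
    exact: (tangent_linear (VW' y Vy).1).
  by rewrite !bE// !lin//; ring.
- move=> f h sf sh.
  have sfh : smooth_at x (fun y => f y * h y) by exact: (smooth_atM SC).
  have leib (W W' : field) : vector_field V W -> vector_field V W' ->
      W x (fun y => W' y (fun z => f z * h z)) =
      W x (fun y => W' y f) * h x + W' x f * W x h +
      (W x f * W' x h + f x * W x (fun y => W' y h)).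
    move=> VW VW'; have [tW _] := VW x Vx; have [_ sW'] := VW' x Vx.
    rewrite -(tangent_leibniz tW (sW' _ sf) sh) -(tangent_leibniz tW sf (sW' _ sh)).
    have s1 := smooth_atM SC (sW' _ sf) sh; have s2 := smooth_atM SC sf (sW' _ sh).
    rewrite -(tangentD tW s1 s2).
    apply: (tangent_local tW); [exact: sW'|exact: (smooth_atD SC s1 s2)|].
    have nf := smooth_at_near SC sf; have nh := smooth_at_near SC sh.
    near=> y; have Vy : V y by near: y.
    have sfy : smooth_at y f by near: y.
    have shy : smooth_at y h by near: y.
    exact: (tangent_leibniz (VW' y Vy).1).
  by rewrite !bE// !leib//; ring.
- by move=> f nf; rewrite /bracket asboolF.
Unshelve. all: by end_near. Qed.

Lemma endoB U J x v w : endomorphism U J -> U x -> tangent x v -> tangent x w ->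
  J x (v - w) = J x v - J x w.
Proof.
move=> eJ Ux tv tw.
by rewrite addrC -scaleN1r (endo_linear eJ)// scaleN1r addrC.
Qed.

(** Torsion-freeness turns every bracket of the Nijenhuis tensor into covariant derivatives, and a
    parallel [J] can be moved out of them. The eight resulting terms cancel in pairs. *)
Lemma parallel_integrable U nabla J : connection U nabla -> torsion_free U nabla ->
  endomorphism U J -> parallel_endo U nabla J -> integrable_endo U J.
Proof.
move=> cN tN eJ pJ V X Y oV VX VY x Vx.
have Ux : U x by exact: oV.2.
have VJX := endo_smooth eJ oV VX; have VJY := endo_smooth eJ oV VY.
have tX := (VX x Vx).1; have tY := (VY x Vx).1.
have tJX := (VJX x Vx).1; have tJY := (VJY x Vx).1.
have tn v W : tangent x v -> vector_field V W -> tangent x (nabla x v W).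
  by move=> tv VW; exact: (conn_tangent cN oV VW Vx tv).
have tJ v : tangent x v -> tangent x (J x v) by exact: (endo_tangent eJ Ux).
have pX v : tangent x v -> nabla x v (endo_app J X) = J x (nabla x v X).
  by move=> tv; exact: (pJ V).
have pY v : tangent x v -> nabla x v (endo_app J Y) = J x (nabla x v Y).
  by move=> tv; exact: (pJ V).
rewrite /nijenhuis -(tN V X Y oV VX VY x Vx) -(tN V _ _ oV VJX VJY x Vx).
rewrite -(tN V _ _ oV VJX VY x Vx) -(tN V _ _ oV VX VJY x Vx) /cov_deriv.
rewrite !(pX, pY)//.
rewrite (endoB eJ Ux (tn _ _ tX VY) (tn _ _ tY VX)).
rewrite (endoB eJ Ux (tn _ _ tJX VY) (tJ _ (tn _ _ tY VX))).
rewrite (endoB eJ Ux (tJ _ (tn _ _ tX VY)) (tn _ _ tJY VX)).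
rewrite (endoB eJ Ux (tJ _ (tn _ _ tX VY)) (tJ _ (tn _ _ tY VX))).
move: (J x (J x (nabla x (X x) Y))) (J x (J x (nabla x (Y x) X))).
move: (J x (nabla x (endo_app J X x) Y)) (J x (nabla x (endo_app J Y x) X)).
move=> a b c d; apply/funext => f.
rewrite -[LHS]/(c f - d f + (a f - b f) - (a f - d f) - (c f - b f)) -[RHS]/(0 : R).
ring.
Qed.

(* Torsion-freeness gives [dF(X,Y,Z) = sum_cyc (nabla_X F)(Y,Z)]. *)
Lemma weyl_lee_equation U g J nabla (theta : one_form S) :
  connection U nabla -> torsion_free U nabla ->
  endomorphism U J -> parallel_endo U nabla J -> neutral_metric U g ->
  (forall x v w, U x -> tangent x v -> tangent x w -> g x v (J x w) = - g x w (J x v)) ->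
  (forall V Y Z x v, open_in U V -> vector_field V Y -> vector_field V Z ->
    V x -> tangent x v -> v (fun y => g y (Y y) (Z y)) =
      g x (nabla x v Y) (Z x) + g x (Y x) (nabla x v Z) + theta x v * g x (Y x) (Z x)) ->
  lee_equation U g J theta.
Proof.
move=> cN tN eJ pJ mg skew weyl V X Y Z oV VX VY VZ x Vx.
have Ux : U x by exact: oV.2.
have tn v W : tangent x v -> vector_field V W -> tangent x (nabla x v W).
  by move=> tv VW; exact: (conn_tangent cN oV VW Vx tv).
have tJ v : tangent x v -> tangent x (J x v) by exact: (endo_tangent eJ Ux).
(* Parallelism of [J] and skewness of the fundamental form leave [J] on the field that is not
   differentiated, which is the form the terms in [B] have. *)
have D (W1 W2 W3 : field) : vector_field V W1 -> vector_field V W2 -> vector_field V W3 ->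
    W1 x (fun y => fundamental_form g J y (W2 y) (W3 y)) =
    g x (nabla x (W1 x) W2) (J x (W3 x)) - g x (nabla x (W1 x) W3) (J x (W2 x)) +
    theta x (W1 x) * g x (W2 x) (J x (W3 x)).
  move=> V1 V2 V3; have [t1 _] := V1 x Vx; have [t2 _] := V2 x Vx.
  have VJ := endo_smooth eJ oV V3.
  rewrite (weyl V W2 (endo_app J W3) x (W1 x) oV V2 VJ Vx t1) (pJ V W3 x (W1 x) oV V3 Vx t1).
  by rewrite [X in _ + X + _]skew//; exact: tn.
have B (W1 W2 W3 : field) : vector_field V W1 -> vector_field V W2 -> vector_field V W3 ->
    fundamental_form g J x (bracket W1 W2 x) (W3 x) =
    g x (nabla x (W1 x) W2) (J x (W3 x)) - g x (nabla x (W2 x) W1) (J x (W3 x)).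
  move=> V1 V2 V3; have [t1 _] := V1 x Vx; have [t2 _] := V2 x Vx.
  have [t3 _] := V3 x Vx.
  rewrite /fundamental_form -(tN V W1 W2 oV V1 V2 x Vx) /cov_deriv addrC -scaleN1r.
  rewrite (metric_linear mg _ Ux (tn _ _ t2 V1) (tn _ _ t1 V2) (tJ _ t3)).
  by rewrite mulN1r addrC.
rewrite /ext_d2 !D// !B// /wedge12 /fundamental_form; ring.
Qed.

End Geometry.

(** * Matrix-valued functions and their entrywise derivatives *)

Section MatrixFunctions.
Context {R : realType} {S : smoothSpace R}.
Hypothesis SC : @smooth_calculus R S.
Implicit Types (x : S) (v w : @preTangent R S) (A B : S -> 'M[R]_2).

Definition smooth_mx_at x A := forall i j, smooth_at x (fun y => A y i j).

Definition derive_mx v A : 'M[R]_2 := \matrix_(i, j) v (fun y => A y i j).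

Lemma smooth_mx_atD x A B : smooth_mx_at x A -> smooth_mx_at x B ->
  smooth_mx_at x (fun y => A y + B y).
Proof. by move=> sA sB i j; under eq_fun do rewrite mxE; exact: (smooth_atD SC). Qed.

Lemma smooth_mx_atZ x (k : R) A : smooth_mx_at x A -> smooth_mx_at x (fun y => k *: A y).
Proof.
move=> sA i j; under eq_fun do rewrite mxE.
exact: (smooth_atM SC (smooth_at_cst SC _ _)).
Qed.

Lemma smooth_mx_atM x A B : smooth_mx_at x A -> smooth_mx_at x B ->
  smooth_mx_at x (fun y => A y *m B y).
Proof.
move=> sA sB i j; under eq_fun do rewrite mul2.
exact: (smooth_atD SC (smooth_atM SC (sA _ _) (sB _ _)) (smooth_atM SC (sA _ _) (sB _ _))).
Qed.

Lemma smooth_mx_at_cst x (a : 'M[R]_2) : smooth_mx_at x (fun=> a).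
Proof. by move=> i j; exact: (smooth_at_cst SC). Qed.

Lemma eq_smooth_mx_at x A B : (\forall y \near x, A y = B y) ->
  smooth_mx_at x A -> smooth_mx_at x B.
Proof.
move=> AB sA i j; apply: (eq_smooth_at SC _ (sA i j)).
by apply: filterS AB => y ->.
Qed.

Lemma derive_mx_local x v A B : tangent x v -> smooth_mx_at x A -> smooth_mx_at x B ->
  (\forall y \near x, A y = B y) -> derive_mx v A = derive_mx v B.
Proof.
move=> tv sA sB AB; apply/matrixP => i j; rewrite !mxE.
by apply: (tangent_local tv) => //; apply: filterS AB => y ->.
Qed.

Lemma derive_mx_cst x v (a : 'M[R]_2) : tangent x v -> derive_mx v (fun=> a) = 0.
Proof. by move=> tv; apply/matrixP => i j; rewrite !mxE; exact: (tangent_cst SC _ tv). Qed.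

Lemma derive_mxD x v A B : tangent x v -> smooth_mx_at x A -> smooth_mx_at x B ->
  derive_mx v (fun y => A y + B y) = derive_mx v A + derive_mx v B.
Proof.
move=> tv sA sB; apply/matrixP => i j; rewrite !mxE -(tangentD tv (sA i j) (sB i j)).
by congr v; apply/funext => y; rewrite mxE.
Qed.

Lemma derive_mxM x v A B : tangent x v -> smooth_mx_at x A -> smooth_mx_at x B ->
  derive_mx v (fun y => A y *m B y) = derive_mx v A *m B x + A x *m derive_mx v B.
Proof.
move=> tv sA sB; apply/matrixP => i j; rewrite [RHS]mxE !mul2 !mxE.
rewrite addrACA -!(tangent_leibniz tv (sA _ _) (sB _ _)).
rewrite -(tangentD tv (smooth_atM SC (sA _ _) (sB _ _)) (smooth_atM SC (sA _ _) (sB _ _))).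
by congr v; apply/funext => y; rewrite mul2.
Qed.

Lemma derive_mx_comb k v w A : derive_mx (k *: v + w) A = k *: derive_mx v A + derive_mx w A.
Proof. by apply/matrixP => i j; rewrite !mxE. Qed.

Lemma tangent_leibniz4 x v (a1 a2 a3 a4 b1 b2 b3 b4 : S -> R) : tangent x v ->
  smooth_at x a1 -> smooth_at x a2 -> smooth_at x a3 -> smooth_at x a4 ->
  smooth_at x b1 -> smooth_at x b2 -> smooth_at x b3 -> smooth_at x b4 ->
  v (fun y => a1 y * b1 y + a2 y * b2 y + a3 y * b3 y + a4 y * b4 y) =
  v a1 * b1 x + v a2 * b2 x + v a3 * b3 x + v a4 * b4 x +
  (a1 x * v b1 + a2 x * v b2 + a3 x * v b3 + a4 x * v b4).
Proof.
move=> tv sa1 sa2 sa3 sa4 sb1 sb2 sb3 sb4.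
have s1 := smooth_atM SC sa1 sb1; have s2 := smooth_atM SC sa2 sb2.
have s3 := smooth_atM SC sa3 sb3; have s4 := smooth_atM SC sa4 sb4.
have s12 := smooth_atD SC s1 s2; have s123 := smooth_atD SC s12 s3.
rewrite (tangentD tv s123 s4) (tangentD tv s12 s3) (tangentD tv s1 s2).
rewrite (tangent_leibniz tv sa1 sb1) (tangent_leibniz tv sa2 sb2).
rewrite (tangent_leibniz tv sa3 sb3) (tangent_leibniz tv sa4 sb4); ring.
Qed.

End MatrixFunctions.

(** * Lie brackets in the frame *)

Section FrameBracket.
Context {R : realType} {G : topGroupType} (p : G -> 'M[R]_2).
Hypothesis hp : universal_cover_SL2 p.
Context (Gamma : groupClosed G).
Hypothesis hdisc : discrete_subgroup Gamma.

Local Notation M := (kodaira_thurston p Gamma).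
Local Notation cover := (set_type (@circle R) * G)%type.
Local Notation ambient := (@ambient R).
Local Notation dn := (@down R G p Gamma).
Local Notation emb := (@embed R G p).
Local Notation frame := (@frame R G p Gamma).
Implicit Types (y : cover) (m : M) (f g : M -> R) (h : ambient -> R) (a b : 'M[R]_2).
Local Notation coef := (@coef R G p Gamma).
Local Notation SC := (smooth_calculus_KT hp Gamma).

(** Scalars are central and a commutator is traceless: the circle components vanish on both sides,
    and the shifts by [\tr a / 2] and [\tr b / 2] drop out of the matrix components. *)
Lemma frame_vec_commutator a b (q : ambient) :
  frame_vec (b *m a - a *m b) q = frame_vec b (frame_vec a q) - frame_vec a (frame_vec b q).
Proof.
apply: injective_projections.
  rewrite -[RHS]/((frame_vec b (frame_vec a q)).1 - (frame_vec a (frame_vec b q)).1).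
  rewrite /frame_vec /= raddfB /= mxtrace_mulC subrr mul0r scale0r.
  by rewrite -!scalemxAl !scalerA mulrC subrr.
rewrite -[RHS]/((frame_vec b (frame_vec a q)).2 - (frame_vec a (frame_vec b q)).2).
rewrite /frame_vec /= raddfB /= mxtrace_mulC subrr mul0r.
rewrite !mulmxA -mulmxBl; congr (_ *m _).
by apply: mx2P; rewrite !mxE !sum2 !mxE /= ?mulr1n ?mulr0n ?mul0rn; ring.
Qed.

Lemma smooth_at_coord y f i : represents y f (amb_lin i) -> smooth_at (dn y) f.
Proof. by move=> r; apply/(smooth_atP hp); exists (amb_lin i). Qed.

Lemma field_frame V a : vector_field V (fun m => frame a m).
Proof. by move=> m Vm; split; [exact: frame_tangent|move=> f; exact: frame_smooth]. Qed.

Lemma frame_bracket a b m f : smooth_at m f ->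
  frame a m (fun m' => frame b m' f) - frame b m (fun m' => frame a m' f) =
  frame (b *m a - a *m b) m f.
Proof.
move=> sf; have tb : tangent m (bracket (fun m => frame a m) (fun m => frame b m) m).
  by apply: (tangent_bracket SC (V := setT)) => //; [exact: openT|exact: field_frame..].
have [c cE] := tangent_frame hp hdisc tb.
have bE f' : smooth_at m f' -> frame c m f' =
    frame a m (fun m' => frame b m' f') - frame b m (fun m' => frame a m' f').
  by move=> sf'; rewrite -cE /bracket asboolT.
rewrite -(bE f sf); congr (frame _ m f).
move: bE; have [y ->] := down_surj m => bE.
have [x xP] := coord_functions p hdisc y.
apply: (frame_vec_inj (embed_circleSL2 hp y)) => /=.
rewrite frame_vec_commutator (ambientE (frame_vec c _)) (ambientE (_ - _)).
apply: eq_bigr => i _; congr (_ *: _).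
rewrite -(frame_coord hp _ (xP i)) (bE _ (smooth_at_coord (xP i))).
(* A frame derivative of a coordinate is represented by the linear map [amb_lin i \o frame_vec b'],
   whose derivative is known exactly. *)
have D a' b' : frame a' (dn y) (fun m' => frame b' m' (x i)) =
    amb_lin i (frame_vec b' (frame_vec a' (emb y))).
  have r : represents y (fun m' => frame b' m' (x i)) (amb_lin i \o frame_vec b').
    split; first by apply: smooth_near_linear; exact: amb_linear_continuous.
    apply: filterS (represents_near hp (xP i)) => y' ry'.
    exact: frame_coord.
  rewrite (frameE hp a' r).
  exact: (derive_linear _ _ (@amb_linear_continuous R _ (amb_lin i \o frame_vec b'))).
by rewrite !D [RHS]linearB.
Qed.

Lemma tangent_leibniz_frame m v (B : M -> 'M[R]_2) f : tangent m v -> smooth_at m f ->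
  smooth_mx_at m B ->
  v (fun m' => frame (B m') m' f) = frame (derive_mx v B) m f + v (fun m' => frame (B m) m' f).
Proof.
move=> tv sf sB.
have s i j : smooth_at m (fun m' => frame (delta_mx i j) m' f) by exact: frame_smooth.
(* [K] collects what depends on [A m] alone; it is then identified by taking the constant function
   [B m], whose derivative is 0. *)
have [K KE] : exists K : 'M[R]_2 -> R, forall A : M -> 'M[R]_2, smooth_mx_at m A ->
    v (fun m' => frame (A m') m' f) = frame (derive_mx v A) m f + K (A m).
  exists (fun a => a 0 0 * v (fun m' => frame (delta_mx 0 0) m' f) +
     a 0 1 * v (fun m' => frame (delta_mx 0 1) m' f) +
     a 1 0 * v (fun m' => frame (delta_mx 1 0) m' f) +
     a 1 1 * v (fun m' => frame (delta_mx 1 1) m' f)) => A sA.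
  rewrite (frame_entries hp (derive_mx v A)) !mxE.
  rewrite -(tangent_leibniz4 SC tv (sA 0 0) (sA 0 1) (sA 1 0) (sA 1 1)
    (s 0 0) (s 0 1) (s 1 0) (s 1 1)).
  by congr v; apply/funext => m'; exact: frame_entries.
have E0 := KE _ (smooth_mx_at_cst SC m (B m)).
have f0 : frame 0 m = 0 by rewrite -(scale0r (B m)) (frameZ hp) scale0r.
rewrite (derive_mx_cst SC _ tv) f0 add0r in E0.
by rewrite (KE B sB) -E0.
Qed.

Lemma coef_bracket V X Y m : open V -> vector_field V X -> vector_field V Y -> V m ->
  coef m (bracket X Y m) =
  derive_mx (X m) (fun m' => coef m' (Y m')) - derive_mx (Y m) (fun m' => coef m' (X m')) +
  (coef m (Y m) *m coef m (X m) - coef m (X m) *m coef m (Y m)).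
Proof.
move=> oV VX VY Vm.
rewrite -[RHS](frameK hp hdisc _ m); congr (coef m _); apply/funext => f.
have [sf|nf] := pselect (smooth_at m f); last by rewrite /bracket asboolF// frame_out.
rewrite /bracket asboolT//.
have L (W W' : field (S := M)) : vector_field V W -> vector_field V W' ->
    W m (fun m' => W' m' f) = frame (derive_mx (W m) (fun m' => coef m' (W' m'))) m f +
    frame (coef m (W m)) m (fun m' => frame (coef m (W' m)) m' f).
  move=> VW VW'; have [tW _] := VW m Vm; have [_ sW'] := VW' m Vm.
  have sc : smooth_mx_at m (fun m' => coef m' (W' m')).
    by move=> i j; exact: (coef_smooth hp hdisc i j oV VW' Vm).
  rewrite (coefK hp hdisc tW) -(tangent_leibniz_frame tW sf sc).
  apply: (tangent_local tW); first exact: sW'.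
    apply: (eq_smooth_at SC _ (sW' f sf)).
    apply: filterS (open_nbhs_nbhs (conj oV Vm)) => m' Vm'.
    by rewrite (coefK hp hdisc (VW' m' Vm').1).
  apply: filterS (open_nbhs_nbhs (conj oV Vm)) => m' Vm'.
  by rewrite (coefK hp hdisc (VW' m' Vm').1).
rewrite (L X Y VX VY) (L Y X VY VX).
have FB := frame_bracket (coef m (X m)) (coef m (Y m)) sf.
move: FB; move: (coef m (Y m) *m coef m (X m) - _) => c FB.
have -> : frame (derive_mx (X m) (fun m' => coef m' (Y m')) -
    derive_mx (Y m) (fun m' => coef m' (X m')) + c) m f =
    frame (derive_mx (X m) (fun m' => coef m' (Y m'))) m f -
    frame (derive_mx (Y m) (fun m' => coef m' (X m'))) m f + frame c m f.
  by rewrite (frameD hp) (frameD hp) -scaleN1r (frameZ hp) scaleN1r.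
by rewrite -FB opprD addrACA.
Qed.

End FrameBracket.

(** * Constant-coefficient connections *)

Section FrameConnection.
Context {R : realType} {G : topGroupType} (p : G -> 'M[R]_2).
Hypothesis hp : universal_cover_SL2 p.
Context (Gamma : groupClosed G).
Hypothesis hdisc : discrete_subgroup Gamma.

Local Notation M := (kodaira_thurston p Gamma).
Local Notation cover := (set_type (@circle R) * G)%type.
Local Notation ambient := (@ambient R).
Local Notation dn := (@down R G p Gamma).
Local Notation emb := (@embed R G p).
Local Notation frame := (@frame R G p Gamma).
Implicit Types (y : cover) (m : M) (f g : M -> R) (h : ambient -> R) (a b : 'M[R]_2).
Implicit Types (U V : set M) (X Y Z : field (S := M)) (v w : @preTangent R M).
Local Notation coef := (@coef R G p Gamma).
Local Notation SC := (smooth_calculus_KT hp Gamma).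
Local Notation coef_field Y := (fun m => coef m (Y m)).

Lemma smooth_coef V Y m : open V -> vector_field V Y -> V m ->
  smooth_mx_at m (coef_field Y).
Proof. by move=> oV VY Vm i j; exact: (coef_smooth hp hdisc i j oV VY Vm). Qed.

Lemma coefD m v w : tangent m v -> tangent m w -> coef m (v + w) = coef m v + coef m w.
Proof. by move=> tv tw; have := coefP hp hdisc 1 tv tw; rewrite !scale1r. Qed.

Lemma coefZ m (k : R) v : tangent m v -> coef m (k *: v) = k *: coef m v.
Proof.
move=> tv; have t0 : tangent m (0 : @preTangent R M).
  by have := tangentBr tv tv; rewrite subrr.
have c0 : coef m 0 = 0.
  by have := coefP hp hdisc (-1) t0 t0; rewrite scaler0 addr0 scaleN1r addNr.
by have := coefP hp hdisc k tv t0; rewrite !addr0 c0 addr0.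
Qed.

Lemma coefB m v w : tangent m v -> tangent m w -> coef m (v - w) = coef m v - coef m w.
Proof.
move=> tv tw; rewrite addrC -scaleN1r (coefP hp hdisc) // scaleN1r addrC //.
Qed.

Lemma coef_inj m v w : tangent m v -> tangent m w -> coef m v = coef m w -> v = w.
Proof.
by move=> tv tw vw; rewrite -(coefK hp hdisc tv) -(coefK hp hdisc tw) vw.
Qed.

(** Antisymmetrizing in [a] and [b] gives [(s - t)] times [b *m a - a *m b], the structure constants
    of the frame: hence the condition [s - t = 1] for vanishing torsion. *)
Definition conn_mx (s t : R) (a b : 'M[R]_2) : 'M[R]_2 := s *: (b *m a) + t *: (a *m b).

Definition frame_conn (s t : R) : preConnection M := fun m v Y =>
  frame (derive_mx v (coef_field Y) + conn_mx s t (coef m v) (coef m (Y m))) m.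

Lemma coef_frame_conn s t m v Y : coef m (frame_conn s t m v Y) =
  derive_mx v (coef_field Y) + conn_mx s t (coef m v) (coef m (Y m)).
Proof. exact: frameK. Qed.

Lemma frame_conn_tangent s t m v Y : tangent m (frame_conn s t m v Y).
Proof. exact: frame_tangent. Qed.

Lemma smooth_derive_mx V X Y m : open V -> vector_field V X -> vector_field V Y ->
  V m -> smooth_mx_at m (fun m' => derive_mx (X m') (coef_field Y)).
Proof.
move=> oV VX VY Vm i j; under eq_fun do rewrite mxE.
exact: ((VX m Vm).2 _ (smooth_coef oV VY Vm i j)).
Qed.

Lemma smooth_conn_mx s t m (A B : M -> 'M[R]_2) : smooth_mx_at m A -> smooth_mx_at m B ->
  smooth_mx_at m (fun m' => conn_mx s t (A m') (B m')).
Proof.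
move=> sA sB; apply: (smooth_mx_atD SC); apply: (smooth_mx_atZ SC);
  exact: (smooth_mx_atM SC).
Qed.

Lemma frame_conn_connection s t U : connection U (frame_conn s t).
Proof.
split.
- move=> V X Y [oV _] VX VY; apply: (vector_field_frame hp) => i j m Vm.
  apply: (smooth_mx_atD SC (smooth_derive_mx oV VX VY Vm)).
  exact: (smooth_conn_mx _ _ (smooth_coef oV VX Vm) (smooth_coef oV VY Vm)).
- by move=> *; exact: frame_conn_tangent.
- move=> V Y Z m v [oV _] VY VZ YZ Vm tv.
  rewrite /frame_conn YZ//; congr (frame (_ + _) m).
  apply: (derive_mx_local tv (smooth_coef oV VY Vm) (smooth_coef oV VZ Vm)).
  by apply: filterS (open_nbhs_nbhs (conj oV Vm)) => m' Vm'; rewrite YZ.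
- move=> V Y m a v w _ VY Vm tv tw.
  rewrite /frame_conn -(frameP hp); congr (frame _ m).
  rewrite (coefP hp hdisc _ tv tw) derive_mx_comb /conn_mx.
  rewrite mulmxDr mulmxDl -scalemxAr -scalemxAl.
  by apply/matrixP => i j; rewrite !mxE; ring.
- move=> V Y Z m v [oV _] VY VZ Vm tv.
  have [tY _] := VY m Vm; have [tZ _] := VZ m Vm.
  apply: (@coef_inj m); [exact: frame_conn_tangent|
    by apply: tangentDr; exact: frame_conn_tangent|].
  rewrite coefD; [|exact: frame_conn_tangent..]; rewrite !coef_frame_conn.
  have sY := smooth_coef oV VY Vm; have sZ := smooth_coef oV VZ Vm.
  have nE : \forall m' \near m, coef m' (Y m') + coef m' (Z m') = coef m' (Y m' + Z m').
    apply: filterS (open_nbhs_nbhs (conj oV Vm)) => m' Vm'.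
    by rewrite coefD//; [exact: (VY m' Vm').1|exact: (VZ m' Vm').1].
  have sYZ := smooth_mx_atD SC sY sZ.
  rewrite -(derive_mx_local tv sYZ (eq_smooth_mx_at SC nE sYZ) nE).
  rewrite (derive_mxD tv sY sZ) (coefD tY tZ) /conn_mx mulmxDl mulmxDr.
  by apply/matrixP => i j; rewrite !mxE; ring.
- move=> V f Y m v [oV _] sf VY Vm tv.
  have [tY _] := VY m Vm; have sY := smooth_coef oV VY Vm.
  have tC := frame_conn_tangent s t m v Y.
  apply: (@coef_inj m); [exact: frame_conn_tangent|
    by apply: tangentDr; exact: tangentZr|].
  rewrite (coefP hp hdisc (v f) tY (tangentZr (f m) tC)) (coefZ _ tC) !coef_frame_conn.
  have nE : \forall m' \near m, f m' *: coef m' (Y m') = coef m' (f m' *: Y m').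
    apply: filterS (open_nbhs_nbhs (conj oV Vm)) => m' Vm'.
    by rewrite coefZ//; exact: (VY m' Vm').1.
  have sfY : smooth_mx_at m (fun m' => f m' *: coef m' (Y m')).
    move=> i j; under eq_fun do rewrite mxE.
    exact: (smooth_atM SC (sf m Vm) (sY i j)).
  rewrite -(derive_mx_local tv sfY (eq_smooth_mx_at SC nE sfY) nE).
  have -> : derive_mx v (fun m' => f m' *: coef m' (Y m')) =
      v f *: coef m (Y m) + f m *: derive_mx v (coef_field Y).
    apply/matrixP => i j; rewrite !mxE -(tangent_leibniz tv (sf m Vm) (sY i j)).
    by congr v; apply/funext => m'; rewrite mxE.
  rewrite (coefZ _ tY) /conn_mx -scalemxAl -scalemxAr.
  by apply/matrixP => i j; rewrite !mxE; ring.
Qed.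

Lemma frame_conn_torsion_free s t U : s - t = 1 -> torsion_free U (frame_conn s t).
Proof.
move=> st V X Y [oV _] VX VY m Vm; rewrite /cov_deriv.
apply: (@coef_inj m).
- by apply: tangentBr; exact: frame_conn_tangent.
- exact: (tangent_bracket SC oV Vm VX VY).
rewrite coefB; [|exact: frame_conn_tangent..].
rewrite !coef_frame_conn (coef_bracket hp hdisc oV VX VY Vm) /conn_mx.
have -> : s = 1 + t by rewrite -st subrK.
by apply/matrixP => i j; rewrite !mxE; ring.
Qed.

Definition lmul_endo (j : 'M[R]_2) : endo M := fun m v => frame (j *m coef m v) m.

Lemma coef_lmul j m v : coef m (lmul_endo j m v) = j *m coef m v.
Proof. exact: frameK. Qed.

Lemma lmul_endo_tangent j m v : tangent m (lmul_endo j m v).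
Proof. exact: frame_tangent. Qed.

Lemma lmul_endomorphism j U : endomorphism U (lmul_endo j).
Proof.
split.
- by move=> *; exact: lmul_endo_tangent.
- move=> m a v w _ tv tw.
  by rewrite /lmul_endo -(frameP hp) (coefP hp hdisc _ tv tw) mulmxDr -scalemxAr.
- move=> V X [oV _] VX; apply: (vector_field_frame hp) => i k m Vm.
  exact: (smooth_mx_atM SC (smooth_mx_at_cst SC m j) (smooth_coef oV VX Vm)).
Qed.

(* [frame_conn 1 0] is the flat connection of the algebra of 2x2 matrices, whose
   positive cone is a covering of the Kodaira-Thurston surface. *)
Lemma lmul_endo_parallel j U : parallel_endo U (frame_conn 1 0) (lmul_endo j).
Proof.
move=> V Y m v [oV _] VY Vm tv; have sY := smooth_coef oV VY Vm.
apply: (@coef_inj m); [exact: frame_conn_tangent|exact: lmul_endo_tangent|].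
rewrite coef_lmul !coef_frame_conn /endo_app coef_lmul /conn_mx !scale0r !addr0 !scale1r.
have -> : (fun m' => coef m' (lmul_endo j m' (Y m'))) = fun m' => j *m coef m' (Y m').
  by apply/funext => m'; rewrite coef_lmul.
rewrite (derive_mxM SC tv (smooth_mx_at_cst SC m j) sY) (derive_mx_cst SC _ tv).
(* For [t = 0] the connection term is a right multiplication, which commutes with left
   multiplication by [j]. *)
by rewrite mul0mx add0r mulmxDr mulmxA.
Qed.

(** The second derivatives of the coefficients cancel against the derivative along the bracket, and
    the terms without derivatives cancel by associativity: [(z y) x - (z x) y = z (y x - x y)], with
    the structure constants of the frame on the right. *)
Lemma frame_conn_flat U : flat_connection U (frame_conn 1 0).
Proof.
move=> V X Y Z oV VX VY VZ m Vm.
have [tX sX] := VX m Vm; have [tY sY] := VY m Vm.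
have sZ := smooth_coef oV.1 VZ Vm.
have L (W W' : field (S := M)) : vector_field V W -> vector_field V W' ->
    coef m (cov_deriv (frame_conn 1 0) W (cov_deriv (frame_conn 1 0) W' Z) m) =
    derive_mx (W m) (fun m' => derive_mx (W' m') (coef_field Z)) +
    (derive_mx (W m) (coef_field Z) *m coef m (W' m) +
     coef m (Z m) *m derive_mx (W m) (coef_field W')) +
    (derive_mx (W' m) (coef_field Z) + coef m (Z m) *m coef m (W' m)) *m coef m (W m).
  move=> VW VW'; have [tW _] := VW m Vm.
  have sW' := smooth_coef oV.1 VW' Vm.
  have E m' : coef m' (cov_deriv (frame_conn 1 0) W' Z m') =
      derive_mx (W' m') (coef_field Z) + coef m' (Z m') *m coef m' (W' m').
    by rewrite /cov_deriv coef_frame_conn /conn_mx scale0r addr0 scale1r.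
  rewrite {1}/cov_deriv coef_frame_conn /conn_mx scale0r addr0 scale1r E.
  congr (_ + _).
  have -> : (fun m' => coef m' (cov_deriv (frame_conn 1 0) W' Z m')) = fun m' =>
      derive_mx (W' m') (coef_field Z) + coef m' (Z m') *m coef m' (W' m').
    exact/funext.
  rewrite (derive_mxD tW (smooth_derive_mx oV.1 VW' VZ Vm) (smooth_mx_atM SC sZ sW')).
  by rewrite (derive_mxM SC tW sZ sW').
have tF W v : tangent m (frame_conn 1 0 m v W) by exact: frame_conn_tangent.
have t0 : tangent m (0 : @preTangent R M) by have := tangentBr tX tX; rewrite subrr.
apply: (@coef_inj m) => //.
  by apply: tangentBr; [apply: tangentBr|]; exact: tF.
have -> : coef m 0 = 0 by rewrite -(subrr (X m)) coefB// subrr.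
rewrite coefB; [|by apply: tangentBr; exact: tF|exact: tF].
rewrite coefB; [|exact: tF..].
rewrite (L X Y VX VY) (L Y X VY VX) {1}/cov_deriv coef_frame_conn.
rewrite (coef_bracket hp hdisc oV.1 VX VY Vm) /conn_mx scale0r addr0 scale1r.
have -> : derive_mx (bracket X Y m) (coef_field Z) =
    derive_mx (X m) (fun m' => derive_mx (Y m') (coef_field Z)) -
    derive_mx (Y m) (fun m' => derive_mx (X m') (coef_field Z)).
  apply/matrixP => i j; rewrite !mxE /bracket asboolT; last exact: sZ.
  by congr (X m _ - Y m _); apply/funext => m'; rewrite mxE.
rewrite !(mulmxDl, mulmxDr, mulNmx, mulmxN) !mulmxA.
by apply/matrixP => i j; rewrite !mxE; ring.
Qed.

End FrameConnection.

(** * The metric *)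

Section DetForm.
Context {R : realType}.
Implicit Types (a b c j : 'M[R]_2).

Definition det_form a b : R :=
  (a 0 0 * b 1 1 + a 1 1 * b 0 0 - a 0 1 * b 1 0 - a 1 0 * b 0 1) / 2.

Lemma det_form_sym a b : det_form a b = det_form b a.
Proof. by rewrite /det_form; ring. Qed.

Lemma det_formP k a b c : det_form (k *: a + b) c = k * det_form a c + det_form b c.
Proof. by rewrite /det_form !mxE; ring. Qed.

Lemma det_formDl a b c : det_form (a + b) c = det_form a c + det_form b c.
Proof. by rewrite /det_form !mxE; ring. Qed.

Lemma det_formDr a b c : det_form c (a + b) = det_form c a + det_form c b.
Proof. by rewrite /det_form !mxE; ring. Qed.

Lemma det_form_mull j a b : det_form (j *m a) (j *m b) = \det j * det_form a b.
Proof. by rewrite /det_form det2 !mul2; ring. Qed.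

(** The adjoint of left multiplication by [j] for this form is left multiplication by [\adj j],
    which is [- j] when [j] is traceless. *)
Lemma det_form_skew j a b : \tr j = 0 -> det_form a (j *m b) = - det_form b (j *m a).
Proof.
rewrite tr2 => /eqP; rewrite addr_eq0 => /eqP j0.
by rewrite /det_form !mul2 j0; ring.
Qed.

(** Linearization of [\det (b (1 + e a)) = (1 + e \tr a) \det b] up to order one in [e], polarized
    in [b]; multiplication on the other side contributes the same trace, so the weights add up to
    [s + t]. *)
Lemma det_form_conn_mx s t a b c :
  det_form (conn_mx s t a b) c + det_form b (conn_mx s t a c) =
  (s + t) * \tr a * det_form b c.
Proof. by rewrite /det_form /conn_mx tr2 !mxE !sum2; ring. Qed.

Definition paraquat1 : 'M[R]_2 :=
  \matrix_(i, j) if i == j then (if i == 0 then 1 else -1) else 0.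
Definition paraquat2 : 'M[R]_2 := \matrix_(i, j) if i == j then 0 else 1.
Definition paraquat3 : 'M[R]_2 :=
  \matrix_(i, j) if i == j then 0 else (if i == 0 then 1 else -1).

Lemma paraquat_mul :
  [/\ paraquat1 *m paraquat1 = 1%:M, paraquat2 *m paraquat2 = 1%:M,
      paraquat3 *m paraquat3 = - 1%:M, paraquat1 *m paraquat2 = paraquat3 &
      paraquat2 *m paraquat1 = - paraquat3].
Proof.
by split; apply: mx2P; rewrite !mxE ?sum2 ?mxE /= ?mulr1n ?mulr0n; ring.
Qed.

Lemma paraquat_tr : [/\ \tr paraquat1 = 0, \tr paraquat2 = 0 & \tr paraquat3 = 0].
Proof. by split; rewrite tr2 !mxE /= ?addr0 ?subrr. Qed.

Lemma paraquat_det : [/\ \det paraquat1 = -1, \det paraquat2 = -1 & \det paraquat3 = 1].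
Proof. by split; rewrite det2 !mxE /=; ring. Qed.

End DetForm.

Section FrameMetric.
Context {R : realType} {G : topGroupType} (p : G -> 'M[R]_2).
Hypothesis hp : universal_cover_SL2 p.
Context (Gamma : groupClosed G).
Hypothesis hdisc : discrete_subgroup Gamma.

Local Notation M := (kodaira_thurston p Gamma).
Local Notation cover := (set_type (@circle R) * G)%type.
Local Notation ambient := (@ambient R).
Local Notation dn := (@down R G p Gamma).
Local Notation emb := (@embed R G p).
Local Notation frame := (@frame R G p Gamma).
Implicit Types (y : cover) (m : M) (f g : M -> R) (h : ambient -> R) (a b : 'M[R]_2).
Implicit Types (U V : set M) (X Y Z : field (S := M)) (v w : @preTangent R M).
Implicit Types (u : M -> R).
Local Notation coef := (@coef R G p Gamma).
Local Notation SC := (smooth_calculus_KT hp Gamma).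
Local Notation coef_field Y := (fun m => coef m (Y m)).
Local Notation frame_conn := (@frame_conn R G p Gamma).
Local Notation lmul_endo := (@lmul_endo R G p Gamma).

Lemma smooth_at_expR m f : smooth_at m f -> smooth_at m (fun m' => expR (f m')).
Proof.
have [y ->] := down_surj m; move=> /(smooth_atP hp)[h [sh fh]]; apply/(smooth_atP hp).
exists (fun q => expR (h q)); split; first exact: smooth_near_expR.
by apply: filterS fh => y' ->.
Qed.

Lemma tangent_expR m v f : tangent m v -> smooth_at m f ->
  v (fun m' => expR (f m')) = expR (f m) * v f.
Proof.
move=> /(tangent_frame hp hdisc)[a ->].
have [y ->] := down_surj m; move=> /(smooth_atP hp)[h rh].
have [sh fh] := rh.
have re : represents y (fun m' => expR (f m')) (expR \o h).
  by split; [exact: smooth_near_expR|apply: filterS fh => y' /= ->].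
have dh : derivable h (emb y) (frame_vec a (emb y)) by exact: smooth_near_derivable.
have [_ E] := is_derive_comp (is_derive_expR (h (emb y))) dh.
by rewrite (frameE hp a re) (frameE hp a rh) E (nbhs_singleton fh).
Qed.

Definition frame_metric : bilinear_field M := fun m v w => det_form (coef m v) (coef m w).

Lemma smooth_det_form m (A B : M -> 'M[R]_2) : smooth_mx_at m A -> smooth_mx_at m B ->
  smooth_at m (fun m' => det_form (A m') (B m')).
Proof.
move=> sA sB; rewrite /det_form.
have sM i j k l : smooth_at m (fun m' => A m' i j * B m' k l).
  exact: (smooth_atM SC (sA i j) (sB k l)).
exact: (smooth_atM SC (smooth_atB SC (smooth_atB SC (smooth_atD SC (sM _ _ _ _) (sM _ _ _ _))
  (sM _ _ _ _)) (sM _ _ _ _)) (smooth_at_cst SC _ _)).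
Qed.

Lemma tangent_det_form m v (A B : M -> 'M[R]_2) : tangent m v ->
  smooth_mx_at m A -> smooth_mx_at m B ->
  v (fun m' => det_form (A m') (B m')) =
  det_form (derive_mx v A) (B m) + det_form (A m) (derive_mx v B).
Proof.
move=> tv sA sB; rewrite /det_form !mxE.
(* Signs and the factor 1/2 are absorbed into the entries of [A], so that the form becomes a sum of
   four products as in [tangent_leibniz4]. *)
have sN i j : smooth_at m (fun m' => - A m' i j / 2).
  exact: (smooth_atM SC (smooth_atN SC (sA i j)) (smooth_at_cst SC _ _)).
have sP i j : smooth_at m (fun m' => A m' i j / 2).
  exact: (smooth_atM SC (sA i j) (smooth_at_cst SC _ _)).
have dP i j : v (fun m' => A m' i j / 2) = v (fun m' => A m' i j) / 2.
  by rewrite mulrC -(tangentZ SC _ tv (sA i j)); congr v; apply/funext => m'; rewrite mulrC.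
have dN i j : v (fun m' => - A m' i j / 2) = - v (fun m' => A m' i j) / 2.
  rewrite mulNr -dP -(tangentN SC tv (sP i j)); congr v; apply/funext => m'.
  by rewrite mulNr.
transitivity (v (fun m' => A m' 0 0 / 2 * B m' 1 1 + A m' 1 1 / 2 * B m' 0 0 +
    - A m' 0 1 / 2 * B m' 1 0 + - A m' 1 0 / 2 * B m' 0 1)).
  by congr v; apply/funext => m'; field.
rewrite (tangent_leibniz4 SC tv (sP 0 0) (sP 1 1) (sN 0 1) (sN 1 0)
  (sB 1 1) (sB 0 0) (sB 1 0) (sB 0 1)) !dP !dN.
by field.
Qed.

(** The exponential contributes [v u] and the connection fails to preserve [det_form] by
    [(s + t) \tr]. This single identity gives the Levi-Civita connections of the metric and of its
    conformal changes, and also the Lee form. *)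
Lemma conformal_weyl s t U u V Y Z m v : smooth_on U u -> open_in U V ->
  vector_field V Y -> vector_field V Z -> V m -> tangent m v ->
  v (fun m' => conformal u frame_metric m' (Y m') (Z m')) =
  conformal u frame_metric m (frame_conn s t m v Y) (Z m) +
  conformal u frame_metric m (Y m) (frame_conn s t m v Z) +
  (v u - (s + t) * \tr (coef m v)) * conformal u frame_metric m (Y m) (Z m).
Proof.
move=> su [oV VU] VY VZ Vm tv; have su' := su m (VU m Vm).
have sY := smooth_coef hp hdisc oV VY Vm; have sZ := smooth_coef hp hdisc oV VZ Vm.
rewrite /conformal /frame_metric.
rewrite (tangent_leibniz tv (smooth_at_expR su') (smooth_det_form sY sZ)).
rewrite (tangent_expR tv su') (tangent_det_form tv sY sZ).
rewrite !(coef_frame_conn hp hdisc) det_formDl det_formDr.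
have := det_form_conn_mx s t (coef m v) (coef m (Y m)) (coef m (Z m)).
move: (det_form (conn_mx _ _ _ _) _) (det_form _ (conn_mx _ _ _ _)) => x1 x2 E.
have -> : x2 = (s + t) * \tr (coef m v) * det_form (coef m (Y m)) (coef m (Z m)) - x1.
  by rewrite -E addrC addKr.
ring.
Qed.

Lemma levi_civita_frame s t U u : s - t = 1 -> smooth_on U u ->
  (forall m v, U m -> tangent m v -> v u = (s + t) * \tr (coef m v)) ->
  levi_civita U (conformal u frame_metric) (frame_conn s t).
Proof.
move=> st su du; split; first exact: (frame_conn_connection hp hdisc).
  exact: (frame_conn_torsion_free hp hdisc).
move=> V Y Z m v oV VY VZ Vm tv.
rewrite (conformal_weyl s t su oV VY VZ Vm tv).
by rewrite (du m v (oV.2 _ Vm) tv) subrr mul0r addr0.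
Qed.

Lemma lmul_endoA a b m v : tangent m v -> lmul_endo a m (lmul_endo b m v) =
  lmul_endo (a *m b) m v.
Proof. by move=> tv; rewrite /lmul_endo (frameK hp hdisc) mulmxA. Qed.

Lemma lmul_endo1 m v : tangent m v -> lmul_endo 1%:M m v = v.
Proof. by move=> tv; rewrite /lmul_endo mul1mx (coefK hp hdisc tv). Qed.

Lemma lmul_endoN a m v : lmul_endo (- a) m v = - lmul_endo a m v.
Proof. by rewrite /lmul_endo -scaleN1r -scalemxAl (frameZ hp) scaleN1r. Qed.

Lemma lmul_hyper_paracomplex U : hyper_paracomplex U (lmul_endo (paraquat1 (R := R)))
  (lmul_endo (paraquat2 (R := R))) (lmul_endo (paraquat3 (R := R))).
Proof.
split; first by split; exact: (lmul_endomorphism hp hdisc).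
have I j : integrable_endo U (lmul_endo j).
  apply: (parallel_integrable (nabla := frame_conn 1 0)).
  - exact: (frame_conn_connection hp hdisc).
  - by apply: (frame_conn_torsion_free hp hdisc); rewrite subr0.
  - exact: (lmul_endomorphism hp hdisc).
  - exact: (lmul_endo_parallel hp hdisc).
split; last by split; exact: I.
move=> m v Um tv; have [e1 e2 e3 e12 e21] := paraquat_mul (R := R).
split.
- by rewrite lmul_endoA// e1 lmul_endo1.
- by rewrite lmul_endoA// e2 lmul_endo1.
- by rewrite lmul_endoA// e3 lmul_endoN lmul_endo1.
- by rewrite lmul_endoA// e12.
- by rewrite lmul_endoA// e21 lmul_endoN opprK.
Qed.

Lemma conformal_metric U u : smooth_on U u -> neutral_metric U (conformal u frame_metric).
Proof.
move=> su; split.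
- by move=> m v w *; rewrite /conformal /frame_metric det_form_sym.
- move=> m a v v' w Um tv tv' tw; rewrite /conformal /frame_metric.
  by rewrite (coefP hp hdisc a tv tv') det_formP; ring.
- move=> V X Y [oV VU] VX VY m Vm.
  have sX := smooth_coef hp hdisc oV VX Vm; have sY := smooth_coef hp hdisc oV VY Vm.
  exact: (smooth_atM SC (smooth_at_expR (su m (VU m Vm))) (smooth_det_form sX sY)).
(* Rescaling by [r] compensates the conformal factor, which enters quadratically in the basis. *)
- move=> m Um; pose r := expR (- u m / 2).
  have rr : expR (u m) * (r * r) = 1.
    by rewrite /r -!expRD -[RHS]expR0; congr expR; field.
  (* Positive vectors come first: the determinant is 1 on the identity and [paraquat3], and -1 on
     [paraquat1] and [paraquat2]. *)
  pose e (i : 'I_4) : 'M[R]_2 := if i == 0 then 1%:M else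
    if i == 1 then paraquat3 else if i == 2 then paraquat1 else paraquat2.
  exists (fun i => frame (r *: e i) m); split.
  + by move=> i; exact: frame_tangent.
  + move=> v tv; pose a := coef m v.
    have r0 : r != 0 by rewrite gt_eqF// expR_gt0.
    pose c (i : 'I_4) : R := (if i == 0 then (a 0 0 + a 1 1) / 2 else
      if i == 1 then (a 0 1 - a 1 0) / 2 else
      if i == 2 then (a 0 0 - a 1 1) / 2 else (a 0 1 + a 1 0) / 2) / r.
    exists c; rewrite -[LHS](coefK hp hdisc tv) -/a.
    rewrite !big_ord_recl big_ord0 addr0 -!(frameZ hp) -!(frameD hp).
    congr (frame _ m); rewrite !scalerA /c /e /= !divfK//.
    by apply: mx2P; rewrite !mxE /= ?mulr1n ?mulr0n; field.
  + move=> i j; rewrite /conformal /frame_metric !(frameK hp hdisc).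
    have -> : det_form (r *: e i) (r *: e j) = r * r * det_form (e i) (e j).
      by rewrite /det_form !mxE; ring.
    rewrite mulrA rr mul1r /det_form /e.
    by case: i => [[|[|[|[|//]]]] ?]; case: j => [[|[|[|[|//]]]] ?];
      rewrite /= !mxE /= ?mulr1n ?mulr0n; field.
Qed.

Lemma conformal_hyper_paraHermitian U u : smooth_on U u ->
  hyper_paraHermitian U (conformal u frame_metric) (lmul_endo (paraquat1 (R := R)))
    (lmul_endo (paraquat2 (R := R))) (lmul_endo (paraquat3 (R := R))).
Proof.
move=> su; split; [exact: lmul_hyper_paracomplex|exact: conformal_metric|].
have [d1 d2 d3] := paraquat_det (R := R).
move=> m v w Um tv tw; rewrite /conformal /frame_metric !(coef_lmul hp hdisc).
by rewrite !det_form_mull d1 d2 d3 !mulN1r mulrN mul1r.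
Qed.

Definition frame_lee : one_form M := fun m v => - \tr (coef m v).

Lemma frame_lee_smooth U : smooth_one_form U frame_lee.
Proof.
split.
- move=> m a v w Um tv tw; rewrite /frame_lee (coefP hp hdisc a tv tw).
  by rewrite raddfD /= mxtraceZ opprD mulrN.
- move=> V X [oV _] VX m Vm; have sX := smooth_coef hp hdisc oV VX Vm.
  rewrite /frame_lee; under eq_fun do rewrite tr2.
  exact: (smooth_atN SC (smooth_atD SC (sX _ _) (sX _ _))).
Qed.

Lemma conformal0 : conformal (fun=> 0) frame_metric = frame_metric.
Proof.
by apply/funext => m; apply/funext => v; apply/funext => w; rewrite /conformal expR0 mul1r.
Qed.

Lemma frame_lee_equation U j : \tr j = 0 ->
  lee_equation U frame_metric (lmul_endo j) frame_lee.
Proof.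
move=> j0; have s0 : smooth_on U (fun _ : M => 0 : R) by move=> m _; exact: (smooth_at_cst SC).
apply: (weyl_lee_equation (nabla := frame_conn 1 0)).
- exact: (frame_conn_connection hp hdisc).
- by apply: (frame_conn_torsion_free hp hdisc); rewrite subr0.
- exact: (lmul_endomorphism hp hdisc).
- exact: (lmul_endo_parallel hp hdisc).
- by rewrite -conformal0; exact: conformal_metric.
- by move=> m v w *; rewrite /frame_metric !(coef_lmul hp hdisc) det_form_skew.
- move=> V Y Z m v oV VY VZ Vm tv; rewrite -conformal0.
  (* For [u = 0] and the flat connection, the defect of metricity is [- \tr], that is,
     [frame_lee]. *)
  rewrite (conformal_weyl 1 0 s0 oV VY VZ Vm tv) (tangent_cst SC _ tv).
  by rewrite addr0 mul1r sub0r.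
Qed.

Lemma frame_lee_form U : lee_form U frame_metric (lmul_endo (paraquat1 (R := R)))
  (lmul_endo (paraquat2 (R := R))) (lmul_endo (paraquat3 (R := R))) frame_lee.
Proof.
have [t1 t2 t3] := paraquat_tr (R := R).
by split; [exact: frame_lee_smooth|split; exact: frame_lee_equation].
Qed.

Lemma frame_levi_civita U : levi_civita U frame_metric (frame_conn (1 / 2) (- (1 / 2))).
Proof.
rewrite -conformal0; apply: levi_civita_frame.
- by field.
- by move=> m _; exact: (smooth_at_cst SC).
- by move=> m v _ tv; rewrite (tangent_cst SC _ tv) subrr mul0r.
Qed.

(** For [s = - t] the connection term is a multiple of a commutator, so it has trace 0, and the
    trace of the covariant derivative is the derivative of the trace. *)
Lemma frame_lee_parallel U :
  parallel_one_form U (frame_conn (1 / 2) (- (1 / 2))) frame_lee.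
Proof.
move=> V Y m v [oV _] VY Vm tv; have sY := smooth_coef hp hdisc oV VY Vm.
rewrite /frame_lee (coef_frame_conn hp hdisc) raddfD /=.
have -> : \tr (conn_mx (1 / 2) (- (1 / 2)) (coef m v) (coef m (Y m))) = 0.
  by rewrite /conn_mx raddfD /= !mxtraceZ mxtrace_mulC -mulrDl subrr mul0r.
rewrite addr0 tr2 !mxE -(tangentD tv (sY 0 0) (sY 1 1)).
rewrite -(tangentN SC tv (smooth_atD SC (sY 0 0) (sY 1 1))).
by congr v; apply/funext => m'; rewrite tr2.
Qed.

Lemma conformal_flat_hyper_paraKahler U u : smooth_on U u ->
  (forall m v, U m -> tangent m v -> v u = \tr (coef m v)) ->
  flat_hyper_paraKahler U (conformal u frame_metric) (lmul_endo (paraquat1 (R := R)))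
    (lmul_endo (paraquat2 (R := R))) (lmul_endo (paraquat3 (R := R))).
Proof.
move=> su du; split; first exact: conformal_hyper_paraHermitian.
exists (frame_conn 1 0); split.
  apply: levi_civita_frame => //; first by rewrite subr0.
  by move=> m v Um tv; rewrite (du m v Um tv) addr0 mul1r.
by split; [exact: (lmul_endo_parallel hp hdisc)..|exact: (frame_conn_flat hp hdisc)].
Qed.

End FrameMetric.

(** * Conformal flatness *)

Lemma set_val_exist (T : Type) (A : set T) (x : T) (xA : x \in A) :
  set_val (exist (fun x => x \in A) x xA : A) = x.
Proof. by rewrite set_valE. Qed.

(** * The local angle on the circle *)

Section Angle.
Context {R : realType}.
Local Notation ambient := (@ambient R).
Implicit Types (q : ambient) (a b k l : R) (c : 'M[R]_2).

Definition circle_lin k l q : R :=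
  k * amb_lin (inl 0 : amb_index) q + l * amb_lin (inl 1 : amb_index) q.

Lemma smooth_circle_lin k l q : smooth_near q (circle_lin k l).
Proof.
by apply: smooth_nearD; apply: smooth_nearM;
  solve [exact: smooth_near_cst | exact: smooth_amb_lin].
Qed.

Lemma derive_circle_lin k l c q :
  'D_(frame_vec c q) (circle_lin k l) q = \tr c / 2 * circle_lin l (- k) q.
Proof.
have dl i : derivable (amb_lin i) q (frame_vec c q).
  exact: smooth_near_derivable (smooth_amb_lin i q).
have d0 : derivable (fun _ : ambient => 0 : R) q (frame_vec c q) by exact: derivable_cst.
have E : (fun q => l * amb_lin (inl 1 : amb_index) q) =
    fun q => l * amb_lin (inl 1 : amb_index) q + 0 by apply/funext => ?; rewrite addr0.
have dl1 : derivable (fun q => l * amb_lin (inl 1 : amb_index) q) q (frame_vec c q).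
  by apply: smooth_near_derivable; apply: smooth_nearM;
    [exact: smooth_near_cst|exact: smooth_amb_lin].
rewrite /circle_lin (derive_linear_comb k (dl _) dl1) E (derive_linear_comb l (dl _) d0).
rewrite !derive_amb_lin derive_cst addr0 !frame_vecE /amb_lin /amb_coord /=.
by rewrite (_ : ord0 = 0)//; ring.
Qed.

(* Twice the angle between [(a, b)] and the circle component of [q]. *)
Definition angle2 a b q : R := 2 * atan (circle_lin (- b) a q * (circle_lin a b q)^-1).

Lemma smooth_angle2 a b q : circle_lin a b q != 0 -> smooth_near q (angle2 a b).
Proof.
move=> w0; apply: smooth_nearM; first exact: smooth_near_cst.
apply: smooth_near_atan; apply: smooth_nearM; first exact: smooth_circle_lin.
by apply: smooth_nearV => //; exact: smooth_circle_lin.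
Qed.

(** Along the rotation of speed [tau = \tr c / 2], [w1] and [w2] behave like a cosine and a sine:
    their derivatives are [- tau * w2] and [tau * w1]. So the arctangent of [w2 / w1] grows at speed
    [tau], and the factor 2 in [angle2] makes this [\tr c]. *)
Lemma derive_angle2 a b c q : circle_lin a b q != 0 ->
  'D_(frame_vec c q) (angle2 a b) q = \tr c.
Proof.
set v := frame_vec c q; pose w1 := circle_lin a b; pose w2 := circle_lin (- b) a.
move=> w0.
have dw k l : derivable (circle_lin k l) q v.
  by apply: smooth_near_derivable; exact: smooth_circle_lin.
have sV : smooth_near q (fun q => (w1 q)^-1).
  by apply: smooth_nearV => //; exact: smooth_circle_lin.
have dV : derivable (fun q => (w1 q)^-1) q v := smooth_near_derivable sV.
have DV : 'D_v (fun q => (w1 q)^-1) q = - (w1 q) ^- 2 * 'D_v w1 q.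
  by rewrite (deriveV w0 (dw a b)).
pose r q := w2 q * (w1 q)^-1.
have sr : smooth_near q r by apply: smooth_nearM => //; exact: smooth_circle_lin.
have [_ Da] := @is_derive_comp R ambient atan _ r q v (is_derive1_atan (r q))
  (smooth_near_derivable sr).
have da : derivable (fun q => atan (r q)) q v := smooth_near_derivable (smooth_near_atan sr).
have d0 : derivable (fun _ : ambient => 0 : R) q v by exact: derivable_cst.
have -> : angle2 a b = fun q => 2 * atan (r q) + 0.
  by apply/funext => ?; rewrite addr0.
rewrite (derive_linear_comb 2 da d0) derive_cst addr0.
have -> : 'D_v (fun q => atan (r q)) q = (1 + r q ^+ 2)^-1 * 'D_v r q by exact: Da.
rewrite (derive_mul (dw _ _) dV) DV !derive_circle_lin /r.
have -> : circle_lin b (- a) q = - w2 q by rewrite /w2 /circle_lin; ring.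
rewrite opprK -/(w1 q) -/(w2 q).
move: w0; rewrite -/(w1 q); move: (w1 q) (w2 q) (\tr c) => x1 x2 t x10.
have x0 : x1 ^+ 2 + x2 ^+ 2 != 0.
  by rewrite gt_eqF// ltr_pwDl ?sqr_ge0// exprn_even_gt0.
by field; rewrite x10 x0.
Qed.

End Angle.

Section ConformalFlatness.
Context {R : realType} {G : topGroupType} (p : G -> 'M[R]_2).
Hypothesis hp : universal_cover_SL2 p.
Context (Gamma : groupClosed G).
Hypothesis hdisc : discrete_subgroup Gamma.

Local Notation M := (kodaira_thurston p Gamma).
Local Notation cover := (set_type (@circle R) * G)%type.
Local Notation ambient := (@ambient R).
Local Notation dn := (@down R G p Gamma).
Local Notation emb := (@embed R G p).
Local Notation frame := (@frame R G p Gamma).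
Implicit Types (y : cover) (m : M) (f g : M -> R) (h : ambient -> R) (a b : 'M[R]_2).
Implicit Types (U V : set M) (X Y Z : field (S := M)) (v w : @preTangent R M).
Implicit Types (u : M -> R).
Local Notation coef := (@coef R G p Gamma).
Local Notation SC := (smooth_calculus_KT hp Gamma).
Local Notation coef_field Y := (fun m => coef m (Y m)).
Local Notation frame_conn := (@frame_conn R G p Gamma).
Local Notation lmul_endo := (@lmul_endo R G p Gamma).
Local Notation frame_metric := (@frame_metric R G p Gamma).
Local Notation J1 := (lmul_endo (paraquat1 (R := R))).
Local Notation J2 := (lmul_endo (paraquat2 (R := R))).
Local Notation J3 := (lmul_endo (paraquat3 (R := R))).


Definition circle_pt (m : M) : 'rV[R]_2 :=
  set_val (fst (m : set_type (@circle R) * coset_space Gamma)%type).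

Lemma circle_pt_continuous : continuous circle_pt.
Proof.
move=> m; apply: (@continuous_comp _ _ _ fst (set_val : set_type (@circle R) -> 'rV[R]_2)).
  exact: cvg_fst.
exact: initial_continuous.
Qed.

Lemma circle_lin_continuous k l : continuous (fun m => circle_lin k l (circle_pt m, 0)).
Proof.
move=> m.
have c i : (fun m : M => circle_pt m 0 i) @ m --> circle_pt m 0 i.
  apply: (@continuous_comp _ _ _ circle_pt (fun z : 'rV[R]_2 => z 0 i)).
    exact: circle_pt_continuous.
  exact: coord_continuous.
by apply: cvgD; apply: cvgM; solve [exact: cvg_cst | exact: c].
Qed.

Lemma conf_flat_local : locally_conf_flat_hpK frame_metric J1 J2 J3.
Proof.
move=> m0; pose a := circle_pt m0 0 0; pose b := circle_pt m0 0 1.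
pose w (m : M) : R := circle_lin a b (circle_pt m, 0).
(* The angle reads the circle component only, so the matrix component is filled with 0. *)
pose u (m : M) : R := angle2 a b (circle_pt m, 0).
have wE (y : cover) : w (dn y) = circle_lin a b (emb y) by [].
have cw : continuous w by exact: circle_lin_continuous.
(* The open half circle centred at [m0]: the denominator in [angle2] is positive there, and
   [w m0 = 1] is the equation of the circle. *)
pose U := [set m | 0 < w m].
have ru y : U (dn y) -> represents y u (angle2 a b).
  move=> Uy; split; last by near=> y'.
  by apply: smooth_angle2; rewrite -wE gt_eqF.
have su : smooth_on U u.
  move=> m; have [y ->] := down_surj m => Uy; apply/(smooth_atP hp).
  by exists (angle2 a b); exact: ru.
exists U, u; split=> //.
- by apply: (@open_comp _ _ w [set x : R | 0 < x]) => [m _|]; [exact: cw|exact: open_gt].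
- have [y yE] := down_surj m0.
  have [cz _] := circleSL2E (embed_circleSL2 hp y).
  rewrite /U /= (_ : w m0 = 1) ?ltr01//.
  by rewrite -[RHS]cz /w /a /b yE.
- apply: (conformal_flat_hyper_paraKahler hp hdisc su) => m v Um tv.
  have [c ->] := tangent_frame hp hdisc tv; rewrite (frameK hp hdisc).
  move: Um; have [y ->] := down_surj m => Uy.
  rewrite (frameE hp c (ru y Uy)) derive_angle2//.
  by rewrite -wE gt_eqF.
Unshelve. all: by end_near. Qed.

Lemma coef_frame_bracket (a b : 'M[R]_2) m :
  coef m (bracket (fun m => frame a m) (fun m => frame b m) m) = b *m a - a *m b.
Proof.
rewrite (coef_bracket hp hdisc openT (field_frame hp a) (field_frame hp b) I).
rewrite !(frameK hp hdisc).
have cst c : (fun m' => coef m' (frame c m')) = fun=> c.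
  by apply/funext => m'; rewrite (frameK hp hdisc).
rewrite !cst !(derive_mx_cst SC _ (frame_tangent hp _ m)).
by rewrite subr0 add0r.
Qed.

(* The closedness of the fundamental form of [exp(u) g], tested on the vector field
   tangent to the circle and two vector fields tangent to the other factor. *)
Lemma conf_flat_derive u : smooth_on [set: M] u ->
  flat_hyper_paraKahler [set: M] (conformal u frame_metric) J1 J2 J3 ->
  forall m, frame 1%:M m (fun m' => expR (u m')) = 2 * expR (u m).
Proof.
move=> su [hPH [nabla [[cN tN mN] [pJ _ _ _]]]] m.
have [d1 d2 d3] := paraquat_det (R := R); have [t1 t2 t3] := paraquat_tr (R := R).
(* Closedness of the fundamental form, phrased as the Lee equation with zero Lee form: the
   connection is metric, so there is no defect. *)
have lee : lee_equation [set: M] (conformal u frame_metric) J1 (fun _ _ => 0).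
  apply: (weyl_lee_equation cN tN (lmul_endomorphism hp hdisc _ _) pJ).
  - by case: hPH.
  - move=> m' v w *; rewrite /conformal /frame_metric !(coef_lmul hp hdisc).
    by rewrite det_form_skew// mulrN.
  - by move=> V Y Z m' v oV VY VZ Vm tv; rewrite (mN V Y Z m' v oV VY VZ Vm tv) mul0r addr0.
pose X a : field (S := M) := fun m => frame a m.
have vX a : vector_field [set: M] (X a) by exact: field_frame.
have oT : open_in [set: M] [set: M] by split=> //; exact: openT.
have := lee _ (X 1%:M) (X paraquat2) (X paraquat3) oT (vX _) (vX _) (vX _) m I.
have -> : wedge12 (fun _ _ => 0) (fundamental_form (conformal u frame_metric) J1) m
   (X 1%:M m) (X paraquat2 m) (X paraquat3 m) = 0 by rewrite /wedge12 !mul0r !addr0.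
have FE m' v w : fundamental_form (conformal u frame_metric) J1 m' v w =
    expR (u m') * det_form (coef m' v) (paraquat1 *m coef m' w).
  by rewrite /fundamental_form /conformal /frame_metric (coef_lmul hp hdisc).
have XE a m' : coef m' (X a m') = a by exact: frameK.
have tX a : tangent m (X a m) by exact: frame_tangent.
have se := smooth_at_expR hp (su m I).
have D (a b c : 'M[R]_2) : X a m (fun m' =>
    fundamental_form (conformal u frame_metric) J1 m' (X b m') (X c m')) =
    det_form b (paraquat1 *m c) * frame a m (fun m' => expR (u m')).
  rewrite -(tangentZ SC _ (tX a) se); congr (X a m _); apply/funext => m'.
  by rewrite FE !XE mulrC.
rewrite /ext_d2 !D !FE !XE !coef_frame_bracket.
(* Only the derivative along [X 1%:M] and the bracket of the other two fields survive, so the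
   equation reads [- X 1%:M (exp u) + 2 exp u = 0]. *)
have -> : det_form paraquat2 (paraquat1 *m paraquat3) = -1 :> R.
  by rewrite /det_form !mul2 !mxE /=; field.
have -> : det_form paraquat3 (paraquat1 *m 1%:M) = 0 :> R.
  by rewrite /det_form !mul2 !mxE /=; field.
have -> : det_form 1%:M (paraquat1 *m paraquat2) = 0 :> R.
  by rewrite /det_form !mul2 !mxE /=; field.
have -> : det_form (paraquat3 *m paraquat2 - paraquat2 *m paraquat3)
    (paraquat1 *m 1%:M) = -2 :> R.
  by rewrite /det_form !mxE !sum2 !mxE /=; field.
have c1 (a : 'M[R]_2) : a *m 1%:M - 1%:M *m a = 0 by rewrite mulmx1 mul1mx subrr.
have c1' (a : 'M[R]_2) : 1%:M *m a - a *m 1%:M = 0 by rewrite mulmx1 mul1mx subrr.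
rewrite c1 c1'; have d0 b : det_form 0 b = 0 :> R by rewrite /det_form !mxE; ring.
by rewrite !d0; lra.
Qed.

Section Circle.
Variables (z : set_type (@circle R)) (x : G).

Lemma rotation_circle (t : R) :
  circle (cos t *: set_val z + sin t *: (set_val z *m rot_mx)).
Proof.
have [cz _] := circleSL2E (embed_circleSL2 hp (z, x)).
apply/circleE; move: cz; rewrite /= !mxE !sum2 !mxE /=.
move: (set_val z 0 0) (set_val z 0 1) => z0 z1 cz.
transitivity ((cos t ^+ 2 + sin t ^+ 2) * (z0 * z0 + z1 * z1)); first by ring.
by rewrite cos2Dsin2 cz mulr1.
Qed.

Definition circle_curve (t : R) : cover :=
  (exist (fun z => z \in @circle R) _ (mem_set (rotation_circle t)), x).

Lemma embed_circle_curve t : emb (circle_curve t) =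
  cos t *: ((set_val z, 0) : ambient) + sin t *: ((set_val z *m rot_mx, 0) : ambient) +
  ((0, p x) : ambient).
Proof.
apply: injective_projections => /=; last by rewrite !scaler0 !add0r.
by rewrite addr0; exact: set_val_exist.
Qed.

(** The identity has half-trace 1 and zero traceless part, so its frame field is the unit speed
    rotation of the circle factor; [rot_mx *m rot_mx = -1] matches the derivatives of cosine and
    sine. *)
Lemma is_derive_circle_curve (t : R) :
  is_derive t 1 (emb \o circle_curve) (frame_vec 1%:M (emb (circle_curve t))).
Proof.
have -> : emb \o circle_curve =
  (fun t => cos t *: ((set_val z, 0) : ambient)) +
  (fun t => sin t *: ((set_val z *m rot_mx, 0) : ambient)) + cst ((0, p x) : ambient).
  by apply/funext => s; exact: embed_circle_curve.
have C := is_derive_scalel ((set_val z, 0) : ambient) (is_derive_cos t).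
have D := is_derive_scalel ((set_val z *m rot_mx, 0) : ambient) (is_derive_sin t).
apply: (is_derive_eq (is_deriveD (is_deriveD C D) (is_derive_cst _ _ _))).
have tr1 : \tr (1%:M : 'M[R]_2) / 2 = 1 by rewrite mxtrace1 divff// pnatr_eq0.
rewrite addr0 embed_circle_curve /frame_vec tr1.
apply: injective_projections => /=; last by rewrite subrr mul0mx !scaler0 addr0.
have r2 : rot_mx *m rot_mx = - 1%:M :> 'M[R]_2.
  by apply: mx2P; rewrite !mxE ?sum2 ?mxE /= ?mulr1n ?mulr0n; ring.
rewrite scale1r addr0 mulmxDl -!scalemxAl -mulmxA r2 mulmxN mulmx1.
by rewrite scalerN scaleNr addrC.
Qed.

Lemma circle_curve_continuous : continuous circle_curve.
Proof.
move=> t.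
have c1 : (fun t => (circle_curve t).1) @ t --> (circle_curve t).1.
  apply: (@continuous_comp_initial _ _ _ (set_val : set_type (@circle R) -> 'rV[R]_2)
    (fun t => (circle_curve t).1)) => s.
  rewrite (_ : set_val \o _ = fun t =>
      cos t *: set_val z + sin t *: (set_val z *m rot_mx)); last first.
    by apply/funext => r; exact: set_val_exist.
  apply: cvgD.
    by apply: cvgZ; [exact: continuous_cos|exact: cvg_cst].
  by apply: cvgZ; [exact: continuous_sin|exact: cvg_cst].
have c2 : (fun t : R => (circle_curve t).2) @ t --> (circle_curve t).2 by exact: cvg_cst.
exact: (cvg_pair c1 c2).
Qed.

Lemma circle_curve_period : circle_curve 0 = circle_curve (2 * pi).
Proof.
rewrite /circle_curve; congr (_, _); apply: val_inj => /=.
by rewrite cos0 sin0 mulr_natl cos2pi sin2pi.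
Qed.

Lemma derive_circle_curve (f : M -> R) (t : R) : smooth_at (dn (circle_curve t)) f ->
  is_derive t 1 (f \o dn \o circle_curve) (frame 1%:M (dn (circle_curve t)) f).
Proof.
move=> /(smooth_atP hp)[h rh]; rewrite (frameE hp _ rh).
have [[A [oA Ay CA]] fh] := rh.
have c1 : is_Ck 1 A h := CA 1%N.
have H := is_derive_ambient_curve oA Ay c1 (is_derive_circle_curve t).
apply: near_eq_is_derive H.
have n : \forall s \near t, f (dn (circle_curve s)) = h (emb (circle_curve s)).
  exact: (circle_curve_continuous fh).
by apply: filterS n => s /= ->.
Qed.

End Circle.

Lemma not_conf_flat_global : ~ globally_conf_flat_hpK frame_metric J1 J2 J3.
Proof.
move=> [u [su /(conf_flat_derive su) du]].
have z1 : circle (\row_j (if j == 0 then 1 else 0) : 'rV[R]_2).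
  by apply/circleE; rewrite !mxE /=; ring.
pose c := circle_curve (exist (fun z => z \in @circle R) _ (mem_set z1)) 1%g.
pose phi := (fun m => expR (u m)) \o dn \o c.
have Dphi (t : R) : is_derive t 1 phi (2 * phi t).
  rewrite -[phi t]/(expR (u (dn (c t)))) -du; apply: derive_circle_curve.
  by apply: (smooth_at_expR hp); exact: su.
(* Equal values at both ends of a period force a zero of the derivative, but the derivative is
   [2 * phi t], which is positive. *)
have [||||t _ D0] := @Rolle R phi 0 (2 * pi).
- by rewrite mulr_gt0// pi_gt0.
- by move=> t _; have [] := Dphi t.
- apply: continuous_subspaceT => t; apply: differentiable_continuous.
  by apply/derivable1_diffP; have [] := Dphi t.
- by rewrite /phi /= /c circle_curve_period.
have [_ E] := Dphi t; have [_ E0] := D0; have : 2 * phi t = 0 by rewrite -E -E0.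
by apply/eqP; rewrite gt_eqF// mulr_gt0// expR_gt0.
Qed.

End ConformalFlatness.

Unset Implicit Arguments.
Local Close Scope ring_scope.

Theorem theorem1p3 (R : realType) (G : topGroupType) (p : G -> 'M[R]_2)
    (hp : universal_cover_SL2 p)
    (Gamma : groupClosed G)
    (hdisc : discrete_subgroup Gamma)
    (hcomp : compact_manifold R 3 (coset_space Gamma)) :
  let M := kodaira_thurston p Gamma in
  exists (J1 J2 J3 : endo M) (g : bilinear_field M) (theta : one_form M)
         (nabla : preConnection M),
    hyper_paraHermitian [set: M] g J1 J2 J3 /\
    lee_form [set: M] g J1 J2 J3 theta /\
    levi_civita [set: M] g nabla /\
    parallel_one_form [set: M] nabla theta /\
    locally_conf_flat_hpK g J1 J2 J3 /\
    ~ globally_conf_flat_hpK g J1 J2 J3.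
Proof.
set J := @lmul_endo R G p Gamma.
exists (J (@paraquat1 R)), (J (@paraquat2 R)), (J (@paraquat3 R)).
exists (@frame_metric R G p Gamma), (@frame_lee R G p Gamma).
exists (@frame_conn R G p Gamma (1 / 2)%R (- (1 / 2))%R).
split.
  (* The metric itself is the case [u = 0] of its conformal family. *)
  rewrite -conformal0; apply: (conformal_hyper_paraHermitian hp hdisc) => m _.
  exact: (smooth_at_cst (smooth_calculus_KT hp Gamma)).
split; first exact: (frame_lee_form hp hdisc).
split; first exact: (frame_levi_civita hp hdisc).
split; first exact: (frame_lee_parallel hp hdisc).
by split; [exact: (conf_flat_local hp hdisc)|exact: (not_conf_flat_global hp hdisc)].
Qed.
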